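(* Let $N\ge 2$, $R>0$ and $\Omega\in\mathcal{C}_R$. Let $H:\Omega\times\mathbb{R}^N\to\mathbb{R}$ be continuous and such that $$H(x,t\xi)=tH(x,\xi)\qquad\forall (x,t,\xi)\in\Omega\times\mathbb{R}_+\times\mathbb{R}^N,$$ and such that there is a modulus of continuity $\omega$ with $$|H(x,\xi)-H(y,\xi)|\le\omega\big(|x-y|(1+|\xi|)\big)\qquad\forall x,y\in\Omega,\ \xi\in\mathbb{R}^N.$$ Let $b=\sup_{(x,\xi)\in\Omega\times B_1}|H(x,\xi)|$ and assume $bR<1$. Then there exists a function $\psi_1\in\mathrm{Lip}(\overline\Omega)$, negative in $\Omega$, which is a viscosity solution of $$\mathcal{P}^-_1(D^2\psi_1)+H(x,\nabla\psi_1)+\mu_1^-\psi_1=0\ \text{ in }\Omega,\qquad \psi_1=0\ \text{ on }\partial\Omega .$$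
   Context: For a real symmetric $N\times N$ matrix $X$, $\mathcal{P}^-_1(X)$ is its smallest eigenvalue. $B_R(y)$ is the open ball of radius $R$ centred at $y$, $B_1=B_1(0)$; $\mathcal{C}_R$ is the class of bounded domains $\Omega\subset\mathbb{R}^N$ such that $\Omega=\bigcap_{y\in Y}B_R(y)$ for some $Y\subset\mathbb{R}^N$. $\mathrm{Lip}(\overline\Omega)$ is the space of Lipschitz continuous functions on $\overline\Omega$. A modulus of continuity is a nondecreasing function $\omega:[0,\infty)\to[0,\infty)$ with $\omega(s)\to 0=\omega(0)$ as $s\to 0^+$. Viscosity sense: a real-valued $u$ is a subsolution (resp. supersolution) of $F(x,u,\nabla u,D^2u)=0$ in $\Omega$ if it is upper (resp. lower) semicontinuous and, for every $x\in\Omega$ and every $C^2$ function $\varphi$ touching $u$ from above (resp. below) at $x$, $F(x,u(x),\nabla\varphi(x),D^2\varphi(x))\ge 0$ (resp. $\le 0$). A continuous function which is both is a solution. $\mu_1^-=\sup\{\mu\in\mathbb{R}:\ \exists\, w<0\text{ in }\Omega,\ w\text{ a subsolution of }\mathcal{P}^-_1(D^2w)+H(x,\nabla w)+\mu w=0\text{ in }\Omega\}$. *)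

(* Defs.v *)
From HB Require Import structures.
From mathcomp Require Import all_boot all_order all_algebra.
From mathcomp Require Import all_classical all_reals all_analysis.
Import Order.TTheory GRing.Theory Num.Theory.
Import numFieldNormedType.Exports.

Set Implicit Arguments.
Unset Strict Implicit.
Unset Printing Implicit Defensive.

Local Open Scope classical_set_scope.
Local Open Scope ring_scope.

(* Points of R^N are row vectors. The library norm on matrices is the sup norm,
   so the Euclidean norm is introduced here; both norms induce the same
   topology, bounded sets and Lipschitz functions, for which the library notions
   are used. *)
Definition enorm (R : realType) (N : nat) (x : 'rV[R]_N) : R :=
  Num.sqrt (\sum_(i < N) x ord0 i ^+ 2).

Definition eball (R : realType) (N : nat) (y : 'rV[R]_N) (r : R)
    : set 'rV[R]_N :=
  [set x | enorm (x - y) < r].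

Definition bounded_domain (R : realType) (N : nat) (Om : set 'rV[R]_N) : Prop :=
  [/\ open Om, Om !=set0, connected Om & bounded_set Om].

Definition class_C (R : realType) (N : nat) (r : R) (Om : set 'rV[R]_N) : Prop :=
  bounded_domain Om /\
  exists Y : set 'rV[R]_N, Om = \bigcap_(y in Y) eball y r.

Definition modulus_of_continuity (R : realType) (omega : R -> R) : Prop :=
  [/\ forall s t, 0 <= s -> s <= t -> omega s <= omega t,
      forall s, 0 <= s -> 0 <= omega s,
      omega 0 = 0
    & omega s @[s --> 0^'+] --> (0 : R)].

(* The set of eigenvalues of a real symmetric matrix is finite and, for N > 0,
   nonempty, so that this infimum is a minimum. *)
Definition smallest_eigenvalue (R : realType) (N : nat) (X : 'M[R]_N) : R :=
  inf [set a | eigenvalue X a].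

Definition partial (R : realType) (N : nat) (i : 'I_N) (phi : 'rV[R]_N -> R)
    : 'rV[R]_N -> R :=
  'D_(delta_mx ord0 i) phi.

Definition gradient (R : realType) (N : nat) (phi : 'rV[R]_N -> R)
    (x : 'rV[R]_N) : 'rV[R]_N :=
  \row_(i < N) partial i phi x.

Definition hessian (R : realType) (N : nat) (phi : 'rV[R]_N -> R)
    (x : 'rV[R]_N) : 'M[R]_N :=
  \matrix_(i < N, j < N) partial j (partial i phi) x.

Definition C1_on (R : realType) (N : nat) (Om : set 'rV[R]_N)
    (phi : 'rV[R]_N -> R) : Prop :=
  forall x, Om x -> {for x, continuous phi} /\
    forall i : 'I_N, derivable phi x (delta_mx ord0 i) /\
      {for x, continuous (partial i phi)}.

(* Only meant for open Om. *)
Definition C2_on (R : realType) (N : nat) (Om : set 'rV[R]_N)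
    (phi : 'rV[R]_N -> R) : Prop :=
  C1_on Om phi /\ forall i : 'I_N, C1_on Om (partial i phi).

Definition usc_on (R : realType) (N : nat) (Om : set 'rV[R]_N)
    (u : 'rV[R]_N -> R) : Prop :=
  forall x a, Om x -> u x < a -> \forall y \near within Om (nbhs x), u y < a.

Definition lsc_on (R : realType) (N : nat) (Om : set 'rV[R]_N)
    (u : 'rV[R]_N -> R) : Prop :=
  forall x a, Om x -> a < u x -> \forall y \near within Om (nbhs x), a < u y.

Definition touches_from_above (R : realType) (N : nat) (Om : set 'rV[R]_N)
    (phi u : 'rV[R]_N -> R) (x : 'rV[R]_N) : Prop :=
  phi x = u x /\ \forall y \near within Om (nbhs x), u y <= phi y.

Definition touches_from_below (R : realType) (N : nat) (Om : set 'rV[R]_N)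
    (phi u : 'rV[R]_N -> R) (x : 'rV[R]_N) : Prop :=
  phi x = u x /\ \forall y \near within Om (nbhs x), phi y <= u y.

(* The equation F(x, u, Du, D^2u) = 0. *)
Definition equation (R : realType) (N : nat) : Type :=
  'rV[R]_N -> R -> 'rV[R]_N -> 'M[R]_N -> R.

Definition viscosity_subsolution (R : realType) (N : nat) (Om : set 'rV[R]_N)
    (F : equation R N) (u : 'rV[R]_N -> R) : Prop :=
  usc_on Om u /\
  forall x phi, Om x -> C2_on Om phi -> touches_from_above Om phi u x ->
    0 <= F x (u x) (gradient phi x) (hessian phi x).

Definition viscosity_supersolution (R : realType) (N : nat) (Om : set 'rV[R]_N)
    (F : equation R N) (u : 'rV[R]_N -> R) : Prop :=
  lsc_on Om u /\
  forall x phi, Om x -> C2_on Om phi -> touches_from_below Om phi u x ->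
    F x (u x) (gradient phi x) (hessian phi x) <= 0.

Definition viscosity_solution (R : realType) (N : nat) (Om : set 'rV[R]_N)
    (F : equation R N) (u : 'rV[R]_N -> R) : Prop :=
  [/\ {within Om, continuous u}, viscosity_subsolution Om F u
    & viscosity_supersolution Om F u].

Definition eigen_equation (R : realType) (N : nat)
    (H : 'rV[R]_N -> 'rV[R]_N -> R) (mu : R) : equation R N :=
  fun x u p X => smallest_eigenvalue X + H x p + mu * u.

Definition mu1_minus (R : realType) (N : nat) (Om : set 'rV[R]_N)
    (H : 'rV[R]_N -> 'rV[R]_N -> R) : \bar R :=
  ereal_sup [set mu%:E | mu in [set mu : R | exists w : 'rV[R]_N -> R,
    (forall x, Om x -> w x < 0) /\
    viscosity_subsolution Om (eigen_equation H mu) w]].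

Definition first_order_bound (R : realType) (N : nat) (Om : set 'rV[R]_N)
    (H : 'rV[R]_N -> 'rV[R]_N -> R) : \bar R :=
  ereal_sup [set `|H z.1 z.2|%:E | z in Om `*` eball 0 1].

(* Main.v *)
(** The proof uses no comparison principle between viscosity sub- and
supersolutions: subsolutions are only compared with explicit barriers.

Let W(x) be the supremum over y in Y of |x - y|^2 - r^2, so that Om = {W < 0}
and W = 0 on the boundary.  Since b r < 1, A W is a subsolution with a margin
proportional to A, which for the equation with zeroth order term mu survives
near the boundary.  Comparison with cones makes every subsolution u between A W
and 0 Lipschitz, with a constant depending on A only, and gives Harnack's
inequality; comparison with perturbed 1-homogeneous barriers at boundary points
gives Hopf's lemma, w <= c W for every negative subsolution w.

For 0 < mu < mu1, let u be the largest subsolution, among those between A W and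
0, of the equation with zeroth order term mu and right-hand side - W.  The
choice of - W is the point.  By Hopf's lemma a multiple of a negative
subsolution w for some mu' > mu is a competitor, so that u exists; Perron's bump
argument shows that u is a solution.  Conversely A W <= u makes u a subsolution
of the homogeneous equation for mu + 1/A, hence 1/A <= mu1 - mu.  As A may be
taken proportional to sup |u|, the functions u blow up as mu tends to mu1, and
u / sup |u| subconverges to the eigenfunction. *)

(* Why - W. Passing from mu' to mu in the equation of a multiple k w leaves the gain - k (mu' - mu)
   w, which Hopf's lemma bounds below by a multiple of - W, but which in general no positive
   constant bounds below. Conversely A W <= u reads - W >= - u / A, so the right-hand side acts as
   an increase of mu by 1/A. Why A can be proportional to s = sup |u|. For A' large, A' W is a
   subsolution where |W| < (1 - b r) / mu; elsewhere A' >= s mu / (1 - b r) puts it below - s <= u.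
   So max(u, A' W) is again a competitor, and maximality of u gives A' W <= u. All competitors above
   the same A W share one Lipschitz constant. Hence their supremum is Lipschitz without any
   semicontinuous envelope, and the normalised u converge uniformly up to the boundary, so that the
   limit is not 0. The inner arguments use paraboloids only; C^2 test functions occur in the passage
   between viscosity inequalities and jets, where symmetry of the Hessian and a second order Taylor
   formula are needed. A supersolution u is handled as the jet subsolution - u of the reflected
   equation. *)
Require Import Defs.
From HB Require Import structures.
From mathcomp Require Import all_boot all_order all_algebra.
From mathcomp Require Import all_classical all_reals all_analysis.
From mathcomp Require Import ring lra.
Import Order.TTheory GRing.Theory Num.Theory.
Import numFieldNormedType.Exports.
Local Open Scope classical_set_scope.
Local Open Scope ring_scope.

Set Implicit Arguments.
Unset Strict Implicit.
Unset Printing Implicit Defensive.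

(** * Euclidean geometry of row vectors *)

Section Euclidean.
Context {R : realType} {N : nat}.
Implicit Types (x y z h p : 'rV[R]_N) (a b e : R).

Definition dotv x y : R := \sum_(i < N) x ord0 i * y ord0 i.

Lemma dotvC x y : dotv x y = dotv y x.
Proof. by apply: eq_bigr => i _; rewrite mulrC. Qed.

Lemma dotvDl x y z : dotv (x + y) z = dotv x z + dotv y z.
Proof. by rewrite -big_split; apply: eq_bigr => i _; rewrite !mxE mulrDl. Qed.

Lemma dotvDr x y z : dotv x (y + z) = dotv x y + dotv x z.
Proof. by rewrite dotvC dotvDl !(dotvC x). Qed.

Lemma dotvZl a x y : dotv (a *: x) y = a * dotv x y.
Proof. by rewrite mulr_sumr; apply: eq_bigr => i _; rewrite !mxE mulrA. Qed.

Lemma dotvZr a x y : dotv x (a *: y) = a * dotv x y.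
Proof. by rewrite dotvC dotvZl dotvC. Qed.

Lemma dotvNl x y : dotv (- x) y = - dotv x y.
Proof. by rewrite -scaleN1r dotvZl mulN1r. Qed.

Lemma dotvNr x y : dotv x (- y) = - dotv x y.
Proof. by rewrite dotvC dotvNl dotvC. Qed.

Lemma dotv0l x : dotv 0 x = 0.
Proof. by rewrite -(scale0r x) dotvZl mul0r. Qed.

Lemma dotv0r x : dotv x 0 = 0.
Proof. by rewrite dotvC dotv0l. Qed.

Definition dotvE := (dotvDl, dotvDr, dotvNl, dotvNr, dotvZl, dotvZr).

Lemma dotv_delta x i : dotv x (delta_mx ord0 i) = x ord0 i.
Proof.
rewrite /dotv (bigD1 i) //= big1 => [|j ji]; rewrite mxE eqxx ?eqxx /=.
  by rewrite mulr1 addr0.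
by rewrite (negbTE ji) mulr0.
Qed.

Lemma dotvv_ge0 x : 0 <= dotv x x.
Proof. by apply: sumr_ge0 => i _; rewrite -expr2 sqr_ge0. Qed.

Lemma enorm_ge0 x : 0 <= enorm x.
Proof. exact: sqrtr_ge0. Qed.

Lemma enorm_sqr x : enorm x ^+ 2 = dotv x x.
Proof.
rewrite sqr_sqrtr; first by apply: eq_bigr => i _; rewrite expr2.
by apply: sumr_ge0 => i _; rewrite sqr_ge0.
Qed.

Lemma enorm_eq0 x : (enorm x == 0) = (x == 0).
Proof.
apply/eqP/eqP => [x0|->]; last first.
  by apply/eqP; rewrite -sqrf_eq0 enorm_sqr dotv0l.
have /psumr_eq0P xi0 : \sum_(i < N) x ord0 i * x ord0 i = 0.
  by rewrite -/(dotv x x) -enorm_sqr x0 expr0n.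
apply/rowP => i; rewrite mxE; apply/eqP.
by rewrite -sqrf_eq0 expr2 xi0 // => j _; rewrite -expr2 sqr_ge0.
Qed.

Lemma enorm0 : enorm (0 : 'rV[R]_N) = 0.
Proof. by apply/eqP; rewrite enorm_eq0. Qed.

Lemma enorm_gt0 x : (0 < enorm x) = (x != 0).
Proof. by rewrite lt_def enorm_ge0 andbT enorm_eq0. Qed.

Lemma enormZ a x : enorm (a *: x) = `|a| * enorm x.
Proof.
apply/eqP; rewrite -(eqrXn2 (ltn0Sn 1)) ?mulr_ge0 ?enorm_ge0 //.
by rewrite exprMn !enorm_sqr !dotvE real_normK ?num_real // mulrA expr2.
Qed.

Lemma enormN x : enorm (- x) = enorm x.
Proof. by rewrite -scaleN1r enormZ normrN1 mul1r. Qed.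

Lemma enormB x y : enorm (x - y) = enorm (y - x).
Proof. by rewrite -enormN opprB. Qed.

Lemma dotv_le x y : dotv x y <= enorm x * enorm y.
Proof.
have [->|x0] := eqVneq x 0; first by rewrite dotv0l enorm0 mul0r.
have [->|y0] := eqVneq y 0; first by rewrite dotv0r enorm0 mulr0.
have := dotvv_ge0 (enorm y *: x - enorm x *: y).
rewrite !dotvE (dotvC y x) -!enorm_sqr.
move: x0 y0; rewrite -!enorm_gt0; set X := enorm x; set Y := enorm y => X0 Y0 h.
have XY : 0 < X * Y by rewrite mulr_gt0.
rewrite -(ler_pM2l XY); nra.
Qed.

Lemma dotv_ge x y : - (enorm x * enorm y) <= dotv x y.
Proof. by rewrite lerNl -dotvNl (le_trans (dotv_le _ _)) // enormN. Qed.

Lemma enormD x y : enorm (x + y) <= enorm x + enorm y.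
Proof.
rewrite -(ler_pXn2r (ltn0Sn 1)) ?nnegrE ?addr_ge0 ?enorm_ge0 //.
rewrite enorm_sqr !dotvE sqrrD -!enorm_sqr (dotvC y x).
have := dotv_le x y; nra.
Qed.

Lemma enorm_triangle z x y : enorm (x - y) <= enorm (x - z) + enorm (z - y).
Proof. by rewrite -[x - y](subrKA z) enormD. Qed.

Lemma enorm_addr_sqr x y : enorm (x + y) ^+ 2 =
  enorm x ^+ 2 + 2 * dotv x y + enorm y ^+ 2.
Proof. by rewrite !enorm_sqr !dotvE (dotvC y x); ring. Qed.

Lemma coord_le_enorm x i : `|x ord0 i| <= enorm x.
Proof.
rewrite -(ler_pXn2r (ltn0Sn 1)) ?nnegrE ?enorm_ge0 //.
rewrite real_normK ?num_real // enorm_sqr /dotv (bigD1 i) //= expr2 lerDl.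
by apply: sumr_ge0 => j _; rewrite -expr2 sqr_ge0.
Qed.

Lemma norm_le_enorm x : `|x| <= enorm x.
Proof.
rewrite -[`|x|]/(mx_norm x) mx_normrE.
apply: bigmax_le; first exact: enorm_ge0.
by move=> [i j] _ /=; rewrite (ord1 i) coord_le_enorm.
Qed.

Lemma coord_le_norm x i : `|x ord0 i| <= `|x|.
Proof.
rewrite -[`|x|]/(mx_norm x) mx_normrE.
by apply: (le_bigmax _ (fun j : 'I_1 * 'I_N => `|x j.1 j.2|) (ord0, i)).
Qed.

Lemma enorm_le_norm x : enorm x <= N%:R * `|x|.
Proof.
rewrite -(ler_pXn2r (ltn0Sn 1)) ?nnegrE ?enorm_ge0 ?mulr_ge0 ?ler0n //.
rewrite enorm_sqr /dotv exprMn.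
apply: (@le_trans _ _ (\sum_(i < N) `|x| ^+ 2)).
  apply: ler_sum => i _; rewrite -expr2 -real_normK ?num_real //.
  by rewrite ler_pXn2r ?nnegrE // coord_le_norm.
rewrite sumr_const card_ord -[leLHS]mulr_natl ler_wpM2r ?sqr_ge0 //.
by rewrite -natrX ler_nat; case: (N) => // k; rewrite leq_pmulr.
Qed.

Lemma nbhs_enormP x (P : set 'rV[R]_N) :
  nbhs x P <-> exists2 e, 0 < e & forall y, enorm (y - x) < e -> P y.
Proof.
split.
  move=> /nbhs_ballP [e /= e0 eP]; exists e => // y yx; apply: eP.
  by rewrite -ball_normE /= (le_lt_trans (norm_le_enorm _)) // enormB.
move=> [e e0 eP]; apply/nbhs_ballP; exists (e / N.+1%:R) => /=.
  by rewrite divr_gt0.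
move=> y; rewrite -ball_normE /= ltr_pdivlMr // => xy; apply: eP.
rewrite enormB (le_lt_trans (enorm_le_norm _)) // (le_lt_trans _ xy) //.
by rewrite mulrC ler_wpM2l // ler_nat.
Qed.

Lemma nbhs0_enormP x (P : set 'rV[R]_N) :
  nbhs x P <-> exists2 e, 0 < e & forall h, enorm h < e -> P (x + h).
Proof.
split=> [/nbhs_enormP [e e0 eP]|[e e0 eP]].
  by exists e => // h he; apply: eP; rewrite addrC addKr.
apply/nbhs_enormP; exists e => // y ye; rewrite -(subrKC x y).
exact: eP.
Qed.

End Euclidean.

(** * Quadratic forms and the smallest eigenvalue *)

Section QuadraticForms.
Context {R : realType} {N : nat}.
Implicit Types (x y z h p v : 'rV[R]_N) (a b c e : R) (X : 'M[R]_N).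

Definition bil X x y : R := dotv (x *m X) y.

Lemma bilDl X x y z : bil X (x + y) z = bil X x z + bil X y z.
Proof. by rewrite /bil mulmxDl dotvDl. Qed.

Lemma bilDr X x y z : bil X x (y + z) = bil X x y + bil X x z.
Proof. by rewrite /bil dotvDr. Qed.

Lemma bilZl X a x y : bil X (a *: x) y = a * bil X x y.
Proof. by rewrite /bil -scalemxAl dotvZl. Qed.

Lemma bilZr X a x y : bil X x (a *: y) = a * bil X x y.
Proof. by rewrite /bil dotvZr. Qed.

Lemma bilNl X x y : bil X (- x) y = - bil X x y.
Proof. by rewrite -scaleN1r bilZl mulN1r. Qed.

Lemma bilNr X x y : bil X x (- y) = - bil X x y.
Proof. by rewrite -scaleN1r bilZr mulN1r. Qed.

Definition bilE := (bilDl, bilDr, bilNl, bilNr, bilZl, bilZr).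

Lemma bil_sumE X x y :
  bil X x y = \sum_(i < N) \sum_(j < N) x ord0 i * X i j * y ord0 j.
Proof.
rewrite /bil /dotv exchange_big; apply: eq_bigr => j _.
by rewrite mxE mulr_suml.
Qed.

Lemma bil_tr X x y : bil X^T x y = bil X y x.
Proof.
rewrite !bil_sumE exchange_big; apply: eq_bigr => i _; apply: eq_bigr => j _.
by rewrite mxE; ring.
Qed.

Lemma bilC X x y : X^T = X -> bil X x y = bil X y x.
Proof. by move=> Xs; rewrite -{1}Xs bil_tr. Qed.

Lemma bil_delta X i j : bil X (delta_mx ord0 i) (delta_mx ord0 j) = X i j.
Proof. by rewrite /bil dotv_delta -rowE mxE. Qed.

Lemma bilMxD X (Y : 'M[R]_N) x y : bil (X + Y) x y = bil X x y + bil Y x y.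
Proof. by rewrite /bil mulmxDr dotvDl. Qed.

Lemma bilMxZ X a x y : bil (a *: X) x y = a * bil X x y.
Proof. by rewrite /bil -scalemxAr dotvZl. Qed.

Lemma bilMxN X x y : bil (- X) x y = - bil X x y.
Proof. by rewrite -scaleN1r bilMxZ mulN1r. Qed.

Lemma bil_scalar a x y : bil a%:M x y = a * dotv x y.
Proof. by rewrite /bil mul_mx_scalar dotvZl. Qed.

Definition bilMxE := (bilMxD, bilMxN, bilMxZ, bil_scalar).

Lemma bil0l X y : bil X 0 y = 0.
Proof. by rewrite /bil mul0mx dotv0l. Qed.

Lemma bil_bound X :
  exists2 C : R, 0 <= C & forall x y, `|bil X x y| <= C * enorm x * enorm y.
Proof.
exists (\sum_(i < N) \sum_(j < N) `|X i j|).
  by apply: sumr_ge0 => i _; apply: sumr_ge0.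
move=> x y; rewrite bil_sumE -mulrA mulr_suml.
apply: le_trans (ler_norm_sum _ _ _) _; apply: ler_sum => i _.
rewrite mulr_suml; apply: le_trans (ler_norm_sum _ _ _) _.
apply: ler_sum => j _; rewrite 2!normrM mulrAC mulrC ler_wpM2l //.
by rewrite ler_pM // coord_le_enorm.
Qed.

(** If a < 0, the linear term dominates for small t: t (|c| + 1) <= - a / 2 makes the sum negative.
    This extracts first order conditions from one-sided quadratic bounds. *)
Lemma lin_ge0 a c e : 0 < e ->
  (forall t, 0 < t -> t < e -> 0 <= a * t + c * t ^+ 2) -> 0 <= a.
Proof.
move=> e0 H; rewrite leNgt; apply/negP => a0.
pose t := Num.min (e / 2) (- a / (2 * (`|c| + 1))).
have c1 : 0 < 2 * (`|c| + 1) by rewrite mulr_gt0 // ltr_wpDl.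
have t0 : 0 < t by rewrite lt_min !divr_gt0 // oppr_gt0.
have te : t < e by rewrite gt_min ltr_pdivrMr // ltr_pMr ?ltr1n.
have tc : t * (2 * (`|c| + 1)) <= - a by rewrite -ler_pdivlMr // ge_min lexx orbT.
have := H t t0 te; have := ler_norm c; move: tc t0; clear -a0; nra.
Qed.

Lemma cts_enormP (f : 'rV[R]_N -> R) x :
  {for x, continuous f} <-> forall e, 0 < e ->
    exists2 d, 0 < d & forall y, enorm (y - x) < d -> `|f y - f x| < e.
Proof.
split=> [fx e e0|fx].
  move/(@cvgrPdist_lt _ _ _ (nbhs x)): fx => /(_ e e0) /nbhs_enormP [d d0 dP].
  by exists d => // y /dP /=; rewrite distrC.
apply/(@cvgrPdist_lt _ _ _ (nbhs x)) => e /fx [d d0 dP]; apply/nbhs_enormP; exists d => // y.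
by move=> /dP; rewrite distrC.
Qed.

Lemma continuous_dotv p : continuous (fun x => dotv p x).
Proof.
move=> x; apply/cts_enormP => e e0; exists (e / (enorm p + 1)).
  by rewrite divr_gt0 // ltr_wpDl // enorm_ge0.
move=> y; rewrite ltr_pdivlMr ?ltr_wpDl ?enorm_ge0 // => xy.
rewrite -dotvNr -dotvDr ltr_norml ltrNl.
have := dotv_le p (y - x); have := dotv_ge p (y - x); have := enorm_ge0 p.
have := enorm_ge0 (y - x); move: xy; nra.
Qed.

Lemma bil_cts X x e : 0 < e -> exists2 d, 0 < d &
  forall h, enorm h < d -> `|bil X (x + h) (x + h) - bil X x x| < e.
Proof.
move=> e0; have [C C0 CP] := bil_bound X.
have D0 : 0 < 2 * C * enorm x + C + 1.
  by have := mulr_ge0 C0 (enorm_ge0 x); lra.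
exists (Num.min 1 (e / (2 * C * enorm x + C + 1))).
  by rewrite lt_min ltr01 divr_gt0.
move=> h; rewrite lt_min ltr_pdivlMr // => /andP[h1 he].
rewrite !bilE; set s := (X in `|X|).
have -> : s = bil X x h + bil X h x + bil X h h by rewrite /s; ring.
apply: le_lt_trans (ler_normD _ _) _.
have := ler_normD (bil X x h) (bil X h x).
have := CP x h; have := CP h x; have := CP h h.
have := enorm_ge0 h; have := enorm_ge0 x.
set k := enorm h; set m := enorm x; move: h1 he; rewrite -/k -/m => k1 ke m0 k0.
have := mulr_ge0 C0 k0; move: ke; nra.
Qed.

Lemma continuous_bil X : continuous (fun x => bil X x x).
Proof.
move=> x; apply/cts_enormP => e /(bil_cts X x)[d d0 dP]; exists d => // y.
by move=> /dP; rewrite subrKC.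
Qed.

(** Minimise the quadratic form on the unit sphere, at v with value l. Moving v by - t k, where k =
    v X - l v is the residual, changes the form minus l |.|^2 by - 2 t |k|^2 to first order, so k =
    0. *)
Lemma sym_min_eigenvalue X : (0 < N)%N -> X^T = X ->
  exists2 l, eigenvalue X l & forall h, l * dotv h h <= bil X h h.
Proof.
move=> N0 Xs; pose S := [set x : 'rV[R]_N | dotv x x = 1].
have dotE x : dotv x x = bil 1%:M x x by rewrite bil_scalar mul1r.
have S0 : S !=set0.
  exists (delta_mx ord0 (Ordinal N0)); rewrite /S /=.
  by rewrite dotv_delta mxE !eqxx.
have Sc : compact S.
  apply: bounded_closed_compact.
    exists 1; split => // M M1 x Sx; apply: (le_trans (norm_le_enorm _)).
    by rewrite (le_trans _ (ltW M1)) // -(@expr_le1 _ 2) ?enorm_ge0 // enorm_sqr Sx.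
  have -> : S = (fun x => bil 1%:M x x) @^-1` [set 1].
    by apply/seteqP; split => x; rewrite /S /= dotE.
  by apply: preimage_closed => [x _|]; [exact: continuous_bil|exact: closed_eq].
have /(EVT_min_rV S0 Sc) [v vS vP] : {within S, continuous (fun x => bil X x x)}.
  by apply: continuous_subspaceT; exact: continuous_bil.
rewrite inE /S /= in vS; pose l := bil X v v.
have lP h : l * dotv h h <= bil X h h.
  have [->|h0] := eqVneq h 0; first by rewrite dotv0l mulr0 bil0l.
  have n0 : 0 < enorm h by rewrite enorm_gt0.
  have := vP ((enorm h)^-1 *: h); rewrite inE /S /= !dotvE !bilE -enorm_sqr.
  have -> : (enorm h)^-1 * ((enorm h)^-1 * enorm h ^+ 2) = 1.
    by field; rewrite gt_eqF.
  move=> /(_ erefl); rewrite mulrA -invfM -expr2 ler_pdivlMl ?exprn_gt0 //.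
  by rewrite mulrC.
exists l => //; apply/eigenvalueP; exists v; last first.
  by apply: contra_eqN vS => /eqP ->; rewrite dotv0l eq_sym oner_eq0.
have [k kE] : exists k, k = v *m X - l *: v by exists (v *m X - l *: v).
suff : dotv k k = 0.
  rewrite -enorm_sqr => /eqP; rewrite sqrf_eq0 enorm_eq0 kE subr_eq0.
  by move/eqP.
apply/eqP; rewrite eq_le dotvv_ge0 andbT -oppr_ge0.
pose c := bil X k k - l * dotv k k.
suff : 0 <= - (2 * dotv k k) by move=> ?; lra.
apply: (@lin_ge0 _ c 1) => // t t0 _.
have := lP (v - t *: k); rewrite !dotvE !bilE (dotvC k v) (bilC k v Xs) vS.
have -> : bil X v k = dotv k k + l * dotv v k.
  by rewrite [X in dotv X k + _]kE !dotvDl dotvNl dotvZl /bil; ring.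
rewrite /c -/l; lra.
Qed.

Lemma smallest_eigenvalueP X : (0 < N)%N -> X^T = X ->
  eigenvalue X (smallest_eigenvalue X) /\
  forall h, smallest_eigenvalue X * dotv h h <= bil X h h.
Proof.
move=> N0 Xs; have [l lX lP] := sym_min_eigenvalue N0 Xs.
suff -> : smallest_eigenvalue X = l by [].
have lb : lbound [set a | eigenvalue X a] l.
  move=> a /= /eigenvalueP[v va v0]; have := lP v.
  by rewrite /bil va dotvZl ler_pM2r // -enorm_sqr exprn_gt0 // enorm_gt0.
by apply/eqP; rewrite eq_le ge_inf ?lb_le_inf //; [exists l|exists l].
Qed.

(** The variational characterisation, through which every later bound on the smallest eigenvalue
    becomes linear arithmetic on values of quadratic forms. *)
Lemma smallest_eigenvalue_ge X c : (0 < N)%N -> X^T = X ->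
  (c <= smallest_eigenvalue X) <-> (forall h, c * dotv h h <= bil X h h).
Proof.
move=> N0 Xs; have [/eigenvalueP[v vX v0] lP] := smallest_eigenvalueP N0 Xs.
split=> [cl h|/(_ v)].
  by apply: le_trans (lP h); rewrite ler_wpM2r ?dotvv_ge0.
rewrite /bil vX dotvZl ler_pM2r // -enorm_sqr exprn_gt0 // enorm_gt0 //.
Qed.

Lemma sym_scalarD X a : X^T = X -> (X + a%:M)^T = X + a%:M.
Proof. by move=> Xs; rewrite linearD /= tr_scalar_mx Xs. Qed.

Lemma smallest_eigenvalueD X a : (0 < N)%N -> X^T = X ->
  smallest_eigenvalue (X + a%:M) = smallest_eigenvalue X + a.
Proof.
move=> N0 Xs; have Ys := sym_scalarD a Xs.
apply/eqP; rewrite eq_le -lerBlDr; apply/andP; split.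
  apply/(smallest_eigenvalue_ge _ N0 Xs) => h.
  have := (smallest_eigenvalueP N0 Ys).2 h; rewrite !bilMxE; lra.
apply/(smallest_eigenvalue_ge _ N0 Ys) => h.
have := (smallest_eigenvalueP N0 Xs).2 h; rewrite !bilMxE; lra.
Qed.

End QuadraticForms.

(** * Second order Taylor expansion *)

Section SecondOrder.
Context {R : realType} {N : nat}.
Implicit Types (x y z h p v : 'rV[R]_N) (a b c e : R) (X : 'M[R]_N).
Implicit Types (f g phi : 'rV[R]_N -> R).

Local Notation "''e_' i" := (delta_mx ord0 i : 'rV[R]_N)
  (at level 8, i at level 2, format "''e_' i").

(** The difference quotient is a + h c. This computes all derivatives of affine and quadratic
    functions below. *)
Lemma is_derive_along f x v a c :
  (forall t : R, f (x + t *: v) = f x + t * a + t ^+ 2 * c) ->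
  is_derive x v f a.
Proof.
move=> fE.
have H : (fun h : R => h^-1 *: ((f \o shift x) (h *: v) - f x)) @ 0^' --> a.
  apply: (@cvg_trans _ ((fun h : R => a + h * c) @ 0^')); last first.
    suff : (fun h : R => a + h * c) @ 0^' --> a + 0 * c by rewrite mul0r addr0.
    apply: cvgD; first exact: cvg_cst.
    apply: cvgM; last exact: cvg_cst.
    exact: cvg_within.
  apply: near_eq_cvg; near=> h; have h0 : h != 0.
    by near: h; exact: nbhs_dnbhs_neq.
  rewrite /= (addrC _ x) fE /GRing.scale /=; field; exact: h0.
by apply: DeriveDef; [apply/cvg_ex; exists a|exact: cvg_lim H].
Unshelve. all: by end_near. Qed.

Lemma is_derive_shift f x v w a :
  is_derive (x + w) v f a -> is_derive x v (fun y => f (y + w)) a.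
Proof.
have E : (fun h : R => h^-1 *: (((fun y => f (y + w)) \o shift x) (h *: v) - f (x + w)))
   = (fun h : R => h^-1 *: ((f \o shift (x + w)) (h *: v) - f (x + w))).
  by apply/funext => h /=; rewrite addrA.
by case=> dx vx; apply: DeriveDef; rewrite /derivable /derive E.
Qed.

Lemma is_derive_subf f g x v a b : is_derive x v f a -> is_derive x v g b ->
  is_derive x v (fun y => f y - g y) (a - b).
Proof. by move=> df dg; exact: is_deriveB. Qed.

Lemma mvt_along f v x (K t : R) : 0 <= K ->
  (forall s, `|s| <= `|t| -> derivable f (x + s *: v) v /\
     `|'D_v f (x + s *: v)| <= K) ->
  `|f (x + t *: v) - f x| <= K * `|t|.
Proof.
move=> K0 H; pose g (s : R) := f (x + s *: v).
have gE s : (fun h : R => h^-1 *: ((g \o shift s) (h *: 1) - g s)) =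
    (fun h : R => h^-1 *: ((f \o shift (x + s *: v)) (h *: v) - f (x + s *: v))).
  apply/funext => h; rewrite /= /g; congr (_ *: (f _ - _)).
  by rewrite [h *: 1]mulr1 scalerDl addrCA.
have dg s : `|s| <= `|t| -> is_derive s (1 : R) g ('D_v f (x + s *: v)).
  by move=> /H[ds _]; apply: DeriveDef; rewrite /derivable /derive gE.
have key a b : a <= b -> (forall s, s \in `[a, b]%R -> `|s| <= `|t|) ->
    `|g b - g a| <= K * (b - a).
  move=> ab abt; have [||c cab ->] := @MVT_segment _ g (fun s => 'D_v f (x + s *: v)) a b ab.
  - by move=> s sab; apply: dg; apply: abt; apply: subset_itv_oo_cc.
  - apply: derivable_within_continuous => s sab.
    by apply: (@ex_derive _ _ _ _ _ _ _ (dg s _)); apply: abt.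
  by rewrite normrM (ger0_norm (_ : 0 <= b - a)) ?subr_ge0 // ler_wpM2r ?subr_ge0 // (H _ _).2
    // abt.
have g0 : g 0 = f x by rewrite /g scale0r addr0.
rewrite -/(g t) -g0.
have [t0|t0] := leP 0 t.
  rewrite (ger0_norm t0) -[X in K * X]subr0; apply: key => // s.
  by rewrite in_itv /= => /andP[s0 st]; rewrite ger0_norm ?(ger0_norm t0).
rewrite (ltr0_norm t0) -[X in K * X]add0r distrC; apply: key (ltW t0) _ => s.
by rewrite in_itv /= => /andP[s0 st]; rewrite ler0_norm ?(ltr0_norm t0) ?lerN2.
Qed.

(** Only derivatives along coordinate vectors are given, so x + h is reached by switching on the
    coordinates of h one at a time; all points on the way stay within distance [enorm h] of x. *)
Lemma mvt_ball f x h (K : R) : 0 <= K ->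
  (forall k, enorm k <= enorm h -> forall i, derivable f (x + k) 'e_i /\
     `|partial i f (x + k)| <= K) ->
  `|f (x + h) - f x| <= N%:R * (K * enorm h).
Proof.
move=> K0 H.
pose tr m : 'rV[R]_N := \row_(i < N) (if (i < m)%N then h ord0 i else 0).
suff key m : (m <= N)%N -> `|f (x + tr m) - f x| <= m%:R * (K * enorm h).
  have := key N (leqnn N); suff -> : tr N = h by [].
  by apply/rowP => i; rewrite mxE ltn_ord.
elim: m => [_|m IH mN].
  suff -> : tr 0%N = 0 by rewrite addr0 subrr normr0 mul0r.
  by apply/rowP => i; rewrite !mxE.
pose j := Ordinal mN.
have trS : tr m.+1 = tr m + h ord0 j *: 'e_j.
  apply/rowP => i; rewrite !mxE eqxx /= ltnS leq_eqVlt.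
  have [->|ij] := eqVneq i j; first by rewrite eqxx ltnn /= mulr1 add0r.
  by rewrite mulr0 addr0; move: ij; rewrite -val_eqE /= => /negbTE ->.
have step : `|f (x + tr m.+1) - f (x + tr m)| <= K * `|h ord0 j|.
  rewrite trS addrA; apply: mvt_along => // s sh; rewrite -addrA; apply: H.
  rewrite -(ler_pXn2r (ltn0Sn 1)) ?nnegrE ?enorm_ge0 // !enorm_sqr.
  apply: ler_sum => i _; rewrite -!expr2 !mxE eqxx /=.
  have [->|ij] := eqVneq i j.
    by rewrite ltnn mulr1 add0r -[X in X <= _]real_normK ?num_real //
      -[X in _ <= X]real_normK ?num_real // ler_pXn2r ?nnegrE.
  rewrite mulr0 addr0; case: ifP => // _; by rewrite expr0n sqr_ge0.
rewrite -(subrKA (f (x + tr m))) (le_trans (ler_normD _ _)) //.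
rewrite -natr1 mulrDl mul1r addrC lerD //; first exact: IH (ltnW mN).
by rewrite (le_trans step) // ler_wpM2l // coord_le_enorm.
Qed.

Lemma C1_taylor (Om : set 'rV[R]_N) f x e : open Om -> Om x -> C1_on Om f ->
  0 < e -> exists2 d, 0 < d & forall h, enorm h < d ->
    `|f (x + h) - f x - dotv (gradient f x) h| <= e * enorm h.
Proof.
move=> Oo Ox fC e0; pose e' := e / N.+1%:R.
have e'0 : 0 < e' by rewrite divr_gt0.
have : nbhs x (fun y => Om y /\ forall i, `|partial i f y - partial i f x| < e').
  apply: filterI; first exact: open_nbhs_nbhs.
  apply: (@filter_forall _ _ (fun i y => `|partial i f y - partial i f x| < e')
    (nbhs x) (nbhs_filter x)).
  move=> i; have [_ /(_ i)[_ ci]] := fC x Ox.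
  by have /cts_enormP /(_ e' e'0) := ci => -[d d0 dP]; apply/nbhs_enormP; exists d.
move=> /nbhs0_enormP[d d0 dP]; exists d => // h hd.
pose g y := f y - dotv (gradient f x) (y - x).
have dg k : enorm k < d -> forall i,
    is_derive (x + k) 'e_i g (partial i f (x + k) - partial i f x).
  move=> kd i; refine (is_derive_subf _ _).
    apply: DeriveDef => //; have [Ok _] := dP k kd.
    by have [_ /(_ i)[]] := fC _ Ok.
  apply: (@is_derive_along _ _ _ _ 0) => t.
  by rewrite !dotvE dotv_delta mxE; ring.
have := @mvt_ball g x h e' (ltW e'0).
rewrite /g subrr dotv0r subr0 (addrC x) addrK addrAC => H.
apply: le_trans (H _) _.
  move=> k kh i; have kd := le_lt_trans kh hd; have D := dg k kd i.
  split; first exact: ex_derive.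
  rewrite /partial derive_val ltW //; by have [_ /(_ i)] := dP k kd.
rewrite mulrA ler_wpM2r ?enorm_ge0 // /e' mulrCA ler_piMr ?ltW //.
by rewrite ltr_pdivrMr // mul1r ltr_nat.
Qed.

Lemma dotv_gradient_partial f x i h :
  dotv (gradient (partial i f) x) h = bil (hessian f x) 'e_i h.
Proof.
rewrite /bil -rowE; congr dotv; apply/rowP => j.
by rewrite !mxE.
Qed.

Lemma C2_partial_taylor (Om : set 'rV[R]_N) f x e : open Om -> Om x ->
  C2_on Om f -> 0 < e -> exists2 d, 0 < d & forall h, enorm h < d ->
  [/\ Om (x + h) & forall i, `|partial i f (x + h) - partial i f x -
       bil (hessian f x) 'e_i h| <= e * enorm h].
Proof.
move=> Oo Ox [_ fC] e0.
have : nbhs x (fun y => Om y /\ forall i, `|partial i f y - partial i f x -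
       bil (hessian f x) 'e_i (y - x)| <= e * enorm (y - x)).
  apply: filterI; first exact: open_nbhs_nbhs.
  apply: (@filter_forall _ _ (fun i y => `|partial i f y - partial i f x -
       bil (hessian f x) 'e_i (y - x)| <= e * enorm (y - x)) (nbhs x) (nbhs_filter x)).
  move=> i; have [d d0 dP] := C1_taylor Oo Ox (fC i) e0.
  apply/nbhs0_enormP; exists d => // h /dP.
  by rewrite dotv_gradient_partial (addrC x h) addrK.
move=> /nbhs0_enormP[d d0 dP]; exists d => // h hd; have [Oxh Hxh] := dP h hd.
by split => // i; have := Hxh i; rewrite (addrC x h) addrK.
Qed.

Lemma hessian_sym_le (Om : set 'rV[R]_N) f x i j e : open Om -> Om x ->
  C2_on Om f -> 0 < e -> exists2 d, 0 < d & forall s, 0 < s -> s < d ->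
  `|f (x + s *: 'e_i + s *: 'e_j) - f (x + s *: 'e_i) - f (x + s *: 'e_j) + f x
    - hessian f x i j * s ^+ 2| <= e * s ^+ 2.
Proof.
move=> Oo Ox fC e0; pose e' := e / 3; have e'0 : 0 < e' by rewrite divr_gt0.
have [d d0 dP] := C2_partial_taylor Oo Ox fC e'0.
have n1 k : enorm ('e_k : 'rV[R]_N) = 1.
  apply/eqP; rewrite -(eqrXn2 (ltn0Sn 1)) ?enorm_ge0 //.
  by rewrite enorm_sqr dotv_delta mxE !eqxx expr1n.
exists (d / 2); first by rewrite divr_gt0.
move: dP; move: (hessian f x) => X dP s s0 sd.
(* The mixed second difference is an increment of G along e_i. The derivative of G there is the
   error of two expansions of [partial i f], at distances at most s and 2 s, hence at most 3 e' s =
   e s. *)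
pose G y := f (y + s *: 'e_j) - f y - s * dotv (X i j *: 'e_i) (y - x).
have -> : f (x + s *: 'e_i + s *: 'e_j) - f (x + s *: 'e_i) - f (x + s *: 'e_j)
    + f x - X i j * s ^+ 2 = G (x + s *: 'e_i) - G x.
  rewrite /G subrr dotv0r (addrC x (s *: 'e_i)) addrK !dotvE dotv_delta mxE !eqxx /=.
  ring.
rewrite -[s ^+ 2]/(s * s) mulrA -{3}(ger0_norm (ltW s0)).
apply: mvt_along => [|t]; first by rewrite mulr_ge0 // ltW.
rewrite (ger0_norm (ltW s0)) => ts; rewrite /G.
have t1 : enorm (t *: 'e_i) <= s by rewrite enormZ n1 mulr1.
have t2 : enorm (t *: 'e_i + s *: 'e_j) <= 2 * s.
  rewrite (le_trans (enormD _ _)) // !enormZ !n1 (ger0_norm (ltW s0)) !mulr1.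
  lra.
have e1d : enorm (t *: 'e_i) < d by lra.
have e2d : enorm (t *: 'e_i + s *: 'e_j) < d by lra.
have [xO1 /(_ i) H1] := dP _ e1d; have [xO2 /(_ i) H2] := dP _ e2d.
have [_ /(_ i)[df1 _]] := fC.1 _ xO1.
have [_ /(_ i)[df2 _]] := fC.1 _ xO2.
have D : is_derive (x + t *: 'e_i) 'e_i
   (fun y => f (y + s *: 'e_j) - f y - s * dotv (X i j *: 'e_i) (y - x))
   (partial i f (x + (t *: 'e_i + s *: 'e_j)) - partial i f (x + t *: 'e_i)
     - s * X i j).
  refine (is_derive_subf _ _); last first.
    apply: (@is_derive_along _ _ _ _ 0) => u.
    by rewrite !dotvE dotv_delta !mxE !eqxx /=; ring.
  refine (is_derive_subf _ _); last exact: DeriveDef.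
  by refine (is_derive_shift _); rewrite -addrA; exact: DeriveDef.
split; first exact: ex_derive.
rewrite derive_val; move: H1 H2.
rewrite !bilE !bil_delta => H1 H2.
apply: (@le_trans _ _ (e' * enorm (t *: 'e_i) + e' * enorm (t *: 'e_i + s *: 'e_j))).
  apply: le_trans (lerD H1 H2); rewrite -(normrN (_ - _ - t * _)).
  apply: le_trans (ler_normD _ _); rewrite le_eqVlt; apply/orP; left; apply/eqP.
  by congr `|_|; ring.
move: t1 t2 e0; rewrite /e' -mulrDr => t1 t2 e0.
have : enorm (t *: 'e_i) + enorm (t *: 'e_i + s *: 'e_j) <= 3 * s by lra.
nra.
Qed.

(** Schwarz's theorem: the mixed second difference is symmetric in i and j and approximates both
    entries, times s^2, up to e s^2 / 2. *)
Lemma hessian_sym (Om : set 'rV[R]_N) f x : open Om -> Om x ->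
  C2_on Om f -> (hessian f x)^T = hessian f x.
Proof.
move=> Oo Ox fC; apply/matrixP => i j; rewrite mxE; set X := hessian f x.
apply/eqP; rewrite -subr_eq0 -normr_eq0 eq_le normr_ge0 andbT.
apply/ler_addgt0Pr => e e0; rewrite add0r.
have e2 : 0 < e / 2 by rewrite divr_gt0.
have [d d0 dP] := hessian_sym_le i j Oo Ox fC e2.
have [d' d'0 d'P] := hessian_sym_le j i Oo Ox fC e2.
pose s := Num.min d d' / 2.
have m0 : 0 < Num.min d d' by rewrite lt_min d0.
have s0 : 0 < s by rewrite divr_gt0.
have sm : s < Num.min d d' by rewrite ltr_pdivrMr // ltr_pMr // ltr1n.
move: sm; rewrite lt_min => /andP[sd sd'].
have := dP s s0 sd; have := d'P s s0 sd'; rewrite -/X.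
rewrite [x + _ + _]addrAC !ler_norml => /andP[? ?] /andP[? ?].
by apply/andP; split; rewrite -(ler_pM2r (exprn_gt0 2 s0)); lra.
Qed.

(** Apply [mvt_ball] to f minus its quadratic polynomial at x: its partial derivatives are at most
    e' |h| within distance |h| of x, and e' absorbs the dimension factor. *)
Lemma C2_taylor (Om : set 'rV[R]_N) f x e : open Om -> Om x ->
  C2_on Om f -> 0 < e -> exists2 d, 0 < d & forall h, enorm h < d ->
    `|f (x + h) - f x - dotv (gradient f x) h
       - 2^-1 * bil (hessian f x) h h| <= e * enorm h ^+ 2.
Proof.
move=> Oo Ox fC e0; pose e' := e / N.+1%:R.
have e'0 : 0 < e' by rewrite divr_gt0.
have Xs := hessian_sym Oo Ox fC; set X := hessian f x in Xs *.
have [d d0 dP] := C2_partial_taylor Oo Ox fC e'0.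
exists d => // h hd.
pose g y := f y - dotv (gradient f x) (y - x) - 2^-1 * bil X (y - x) (y - x).
have dg k : enorm k < d -> forall i, is_derive (x + k) 'e_i g
    (partial i f (x + k) - partial i f x - bil X 'e_i k).
  move=> kd i; refine (is_derive_subf _ _); last first.
    apply: (@is_derive_along _ _ _ _ (2^-1 * bil X 'e_i 'e_i)) => t.
    have -> : x + k + t *: 'e_i - x = k + t *: 'e_i by rewrite addrAC (addrC x k) addrK.
    have -> : x + k - x = k by rewrite (addrC x k) addrK.
    by rewrite !bilE (bilC k 'e_i Xs); field.
  refine (is_derive_subf _ _).
    apply: DeriveDef => //; have [Ok _] := dP k kd.
    by have [_ /(_ i)[]] := fC.1 _ Ok.
  apply: (@is_derive_along _ _ _ _ 0) => t.
  by rewrite !dotvE dotv_delta mxE; ring.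
have := @mvt_ball g x h (e' * enorm h).
rewrite /g subrr dotv0r bil0l mulr0 !subr0 (addrC x) addrK => H.
have E : f (h + x) - dotv (gradient f x) h - 2^-1 * bil X h h - f x =
  f (h + x) - f x - dotv (gradient f x) h - 2^-1 * bil X h h by ring.
rewrite E in H; apply: le_trans (H _ _) _.
- by rewrite mulr_ge0 ?enorm_ge0 // ltW.
- move=> k kh i; have kd := le_lt_trans kh hd; have D := dg k kd i.
  split; first exact: ex_derive.
  rewrite /partial derive_val; have [_ /(_ i) Hi] := dP k kd.
  by apply: (le_trans Hi); rewrite ler_wpM2l // ltW.
have -> : N%:R * (e' * enorm h * enorm h) = (N%:R * e') * enorm h ^+ 2 by ring.
rewrite ler_wpM2r ?sqr_ge0 // /e' mulrCA ler_piMr ?ltW //.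
by rewrite ltr_pdivrMr // mul1r ltr_nat.
Qed.

Lemma continuous_quadratic x0 c p X :
  continuous (fun y => c + dotv p (y - x0) + 2^-1 * bil X (y - x0) (y - x0)).
Proof.
have sc : continuous (fun y => y - x0) by move=> y; apply: (@continuousB _ _ _
  (fun y => y) (fun=> x0)); [exact: cvg_id|exact: cst_continuous].
move=> y; apply: (@continuousD _ _ _ (fun y => c + dotv p (y - x0))).
  apply: continuousD; first exact: cst_continuous.
  by apply: (@continuous_comp _ _ _ (fun y => y - x0) (dotv p));
    [exact: sc|exact: continuous_dotv].
apply: continuousM; first exact: cst_continuous.
by apply: (@continuous_comp _ _ _ (fun y => y - x0) (fun y => bil X y y));
  [exact: sc|exact: continuous_bil].
Qed.

Lemma quadratic_C2 (Om : set 'rV[R]_N) x0 c p X : X^T = X ->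
  let Q := fun y => c + dotv p (y - x0) + 2^-1 * bil X (y - x0) (y - x0) in
  [/\ C2_on Om Q, gradient Q x0 = p & hessian Q x0 = X].
Proof.
move=> Xs Q.
have dQ y i : is_derive y 'e_i Q (p ord0 i + bil X (y - x0) 'e_i).
  apply: (@is_derive_along _ _ _ _ (2^-1 * bil X 'e_i 'e_i)) => t.
  rewrite /Q [y + _ - x0]addrAC; move: (y - x0) => z.
  by rewrite dotvDr dotvZr dotv_delta !bilE (bilC 'e_i z Xs); field.
have pQ i : partial i Q = fun y => (p ord0 i) + dotv (row i X) (y - x0) +
    2^-1 * bil 0 (y - x0) (y - x0).
  apply/funext => y; rewrite /partial derive_val.
  by rewrite (bilC _ _ Xs) /bil -rowE mulmx0 dotv0l mulr0 addr0.
have dpQ y i j : is_derive y 'e_j (partial i Q) (X i j).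
  rewrite pQ; apply: (@is_derive_along _ _ _ _ 0) => t.
  rewrite [y + _ - x0]addrAC; move: (y - x0) => z.
  by rewrite dotvDr dotvZr dotv_delta mxE /bil !mulmx0 !dotv0l; ring.
have ppQ i j : partial j (partial i Q) = fun=> X i j.
  by apply/funext => y; rewrite /partial derive_val.
split.
- split=> [y Oy|i y Oy]; split.
  + exact: continuous_quadratic.
  + move=> i; split; first exact: ex_derive.
    by rewrite pQ; exact: continuous_quadratic.
  + by rewrite pQ; exact: continuous_quadratic.
  + move=> j; split; first exact: ex_derive.
    by rewrite ppQ; exact: cst_continuous.
- by apply/rowP => i; rewrite mxE /partial derive_val subrr bil0l addr0.
- by apply/matrixP => i j; rewrite mxE ppQ.
Qed.

End SecondOrder.

(** * Semicontinuity and second order jets *)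

Section Semicontinuity.
Context {R : realType} {N : nat}.
Implicit Types (x y z h p v : 'rV[R]_N) (a b c e d : R) (X : 'M[R]_N).
Implicit Types (Om K : set 'rV[R]_N) (u w : 'rV[R]_N -> R).

Lemma near_within_enormP Om x (P : 'rV[R]_N -> Prop) :
  (\forall y \near within Om (nbhs x), P y) <->
  exists2 d, 0 < d & forall y, enorm (y - x) < d -> Om y -> P y.
Proof. exact: (nbhs_enormP x [set y | Om y -> P y]). Qed.

Lemma open_enormP Om x : open Om -> Om x ->
  exists2 d, 0 < d & forall y, enorm (y - x) < d -> Om y.
Proof. by move=> Oo Ox; apply/(nbhs_enormP x Om); exact: open_nbhs_nbhs. Qed.

Lemma enorm_lip x y z : `|enorm (x - z) - enorm (y - z)| <= enorm (x - y).
Proof.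
have := enorm_triangle y x z; have := enorm_triangle x y z.
by rewrite (enormB y x) ler_norml => ? ?; apply/andP; split; lra.
Qed.

Lemma continuous_enormB z : continuous (fun y => enorm (y - z)).
Proof.
move=> x; apply/cts_enormP => e e0; exists e => // y.
by apply: le_lt_trans; exact: enorm_lip.
Qed.

Lemma compact_cball x d : compact [set y | enorm (y - x) <= d].
Proof.
apply: bounded_closed_compact.
  exists (d + enorm x); split; first exact: num_real.
  move=> M dM y /= yx; apply: (le_trans (norm_le_enorm _)).
  by have := enormD (y - x) x; rewrite subrK; lra.
apply: (@preimage_closed _ _ (fun y => enorm (y - x)) [set t | t <= d]).
  by move=> y _; exact: continuous_enormB.
exact: closed_le.
Qed.

(** A cluster point x of the filter generated by the superlevel sets u >= u z is a maximum point: if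
    u x < u y, upper semicontinuity would keep u below u y near x. *)
Lemma usc_max Om K u : K !=set0 -> compact K -> K `<=` Om -> usc_on Om u ->
  exists2 x, K x & forall y, K y -> u y <= u x.
Proof.
move=> [k Kk] Kc KO uU.
pose B (z : 'rV[R]_N) := [set y | K y /\ u z <= u y].
pose F : set_system 'rV[R]_N := filter_from K B.
have FF : ProperFilter F.
  apply: filter_from_proper; last by move=> z Kz; exists z.
  apply: filter_from_filter; first by exists k.
  move=> y z Ky Kz; have [yz|zy] := leP (u y) (u z).
    by exists z => // t [Kt zt]; split; split => //; exact: le_trans zt.
  by exists y => // t [Kt yt]; split; split => //; exact: le_trans (ltW zy) yt.
have FK : F K by exists k => // t [].
have [x [Kx xF]] := Kc F FF FK.
exists x => // y Ky; rewrite leNgt; apply/negP => xy.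
have By : F (B y) by exists y.
have [t [[Kt yt] tx]] := xF _ _ By (uU x (u y) (KO _ Kx) xy).
by move: yt; rewrite leNgt => /negP; apply; apply: tx; exact: KO.
Qed.

Lemma usc_subset Om Om' u : Om' `<=` Om -> usc_on Om u -> usc_on Om' u.
Proof.
move=> sOm uU x a Ox xa; have /near_within_enormP[d d0 dP] := uU x a (sOm x Ox) xa.
by apply/near_within_enormP; exists d => // y yd /sOm; exact: dP.
Qed.

Lemma usc_subc Om u g : usc_on Om u ->
  (forall x, Om x -> {for x, continuous g}) -> usc_on Om (fun y => u y - g y).
Proof.
move=> uU gc x a Ox xa; set e := (a - (u x - g x)) / 2.
have e0 : 0 < e by rewrite divr_gt0 // subr_gt0.
have ux : u x < u x + e by rewrite ltrDl.
have /near_within_enormP[d d0 dP] := uU x _ Ox ux.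
have /cts_enormP /(_ e e0) [d' d'0 d'P] := gc x Ox.
apply/near_within_enormP; exists (Num.min d d'); first by rewrite lt_min d0.
move=> y; rewrite lt_min => /andP[yd yd'] Oy.
by have := dP y yd Oy; have := d'P y yd'; rewrite ltr_norml /e => /andP[? ?]; lra.
Qed.

Lemma uscZ Om u k : 0 < k -> usc_on Om u -> usc_on Om (fun y => k * u y).
Proof.
move=> k0 uU x a Ox; rewrite -ltr_pdivlMl // => xa.
have /near_within_enormP[d d0 dP] := uU x _ Ox xa.
apply/near_within_enormP; exists d => // y yd Oy.
by rewrite -ltr_pdivlMl // dP.
Qed.

Lemma usc_maxr Om u w : usc_on Om u -> usc_on Om w ->
  usc_on Om (fun y => Num.max (u y) (w y)).
Proof.
move=> uU wU x a Ox; rewrite gt_max => /andP[ua wa].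
have /near_within_enormP[d d0 dP] := uU x _ Ox ua.
have /near_within_enormP[d' d'0 d'P] := wU x _ Ox wa.
apply/near_within_enormP; exists (Num.min d d'); first by rewrite lt_min d0.
move=> y; rewrite lt_min => /andP[yd yd'] Oy.
by rewrite gt_max dP ?d'P.
Qed.

Lemma usc_lip Om u L :
  (forall x y, Om x -> Om y -> u x - u y <= L * enorm (x - y)) -> usc_on Om u.
Proof.
move=> uL x a Ox xa; apply/near_within_enormP.
have L1 : 0 < `|L| + 1 by rewrite ltr_wpDl.
exists ((a - u x) / (`|L| + 1)); first by rewrite divr_gt0 // subr_gt0.
move=> y; rewrite ltr_pdivlMr // => yx Oy; have := uL y x Oy Ox.
have := ler_norm L; have := enorm_ge0 (y - x); nra.
Qed.

Lemma usc_opp_lsc Om u : usc_on Om (fun y => - u y) -> lsc_on Om u.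
Proof.
move=> uU x a Ox xa; have : - u x < - a by rewrite ltrN2.
move=> /(uU x _ Ox)/near_within_enormP[d d0 dP]; apply/near_within_enormP.
by exists d => // y yd Oy; have := dP y yd Oy; rewrite ltrN2.
Qed.

End Semicontinuity.

(** * Viscosity inequalities tested with paraboloids, and their stability *)

Section Jets.
Context {R : realType} {N : nat}.
Implicit Types (x y z h p v : 'rV[R]_N) (a b c e d mu : R) (X : 'M[R]_N).
Implicit Types (Om K : set 'rV[R]_N) (u w f : 'rV[R]_N -> R).
Implicit Types (H G : 'rV[R]_N -> 'rV[R]_N -> R) (lam : 'M[R]_N -> R).

(** The usual error o(|h|^2) is absent: the paraboloid itself touches. Nothing is lost, since such
    an error can be absorbed by adding e times the identity to X. *)
Definition superjet Om u x p X := exists2 d : R, 0 < d &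
  forall h, enorm h < d -> Om (x + h) ->
    u (x + h) <= u x + dotv p h + 2^-1 * bil X h h.

Definition jet_sub Om lam G mu f u := forall x p X, Om x -> X^T = X ->
  superjet Om u x p X -> f x <= lam X + G x p + mu * u x.

(** The reflected equation satisfied by - u. Keeping the second and first order parts of [jet_sub]
    abstract lets stability and scaling be proved once for both sides. *)
Definition jet_super Om H mu f u :=
  jet_sub Om (fun X => - smallest_eigenvalue (- X)) (fun x p => - H x (- p))
    mu (fun x => - f x) (fun x => - u x).

Lemma viscosity_sub_jet Om H mu u :
  viscosity_subsolution Om (eigen_equation H mu) u ->
  jet_sub Om (@smallest_eigenvalue R N) H mu (fun=> 0) u.
Proof.
move=> [_ uS] x p X Ox Xs [d d0 dP].
have [C2 gQ hQ] := quadratic_C2 Om x (u x) p Xs.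
have := uS x _ Ox C2; rewrite gQ hQ; apply; split.
  by rewrite subrr dotv0r bil0l mulr0 !addr0.
apply/near_within_enormP; exists d => // y yd Oy.
by have := dP _ yd; rewrite subrKC; apply.
Qed.

(** By Taylor, the paraboloid with Hessian D^2 phi + e I lies above phi near x, and the extra e I
    raises the smallest eigenvalue by exactly e. *)
Lemma jet_viscosity_sub Om H mu u : (0 < N)%N -> open Om -> usc_on Om u ->
  jet_sub Om (@smallest_eigenvalue R N) H mu (fun=> 0) u ->
  viscosity_subsolution Om (eigen_equation H mu) u.
Proof.
move=> N0 Oo uU uS; split => // x phi Ox C2 [phix /near_within_enormP[d d0 dP]].
rewrite /eigen_equation; have Xs := hessian_sym Oo Ox C2.
apply/ler_addgt0Pr => e e0; have e2 : 0 < e / 2 by rewrite divr_gt0.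
have [d' d'0 d'P] := C2_taylor Oo Ox C2 e2.
have := uS x (gradient phi x) (hessian phi x + e%:M) Ox (sym_scalarD e Xs).
rewrite smallest_eigenvalueD // => H1; apply: (le_trans (H1 _)); last by lra.
exists (Num.min d d'); first by rewrite lt_min d0.
move=> h; rewrite lt_min => /andP[hd hd'] Oh.
have := dP (x + h); rewrite (addrC x h) addrK addrC => /(_ hd Oh).
have := d'P h hd'; rewrite ler_norml enorm_sqr !bilMxE -phix => /andP[_ ? ?].
lra.
Qed.

Lemma jet_viscosity_super Om H mu u : (0 < N)%N -> open Om -> lsc_on Om u ->
  jet_super Om H mu (fun=> 0) u ->
  viscosity_supersolution Om (eigen_equation H mu) u.
Proof.
move=> N0 Oo uU uS; split => // x phi Ox C2 [phix /near_within_enormP[d d0 dP]].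
rewrite /eigen_equation; have Xs := hessian_sym Oo Ox C2.
have nXs : (- hessian phi x)^T = - hessian phi x by rewrite linearN /= Xs.
apply/ler_addgt0Pr => e e0; have e2 : 0 < e / 2 by rewrite divr_gt0.
have [d' d'0 d'P] := C2_taylor Oo Ox C2 e2.
have := uS x (- gradient phi x) (- hessian phi x + e%:M) Ox (sym_scalarD e nXs).
have -> : - (- hessian phi x + e%:M) = hessian phi x + (- e)%:M.
  by rewrite opprD opprK raddfN.
rewrite smallest_eigenvalueD // opprK oppr0 => H1;
  have : 0 <= - (smallest_eigenvalue (hessian phi x) - e) -
  H x (gradient phi x) + mu * - u x; last by lra.
apply: H1; exists (Num.min d d'); first by rewrite lt_min d0.
move=> h; rewrite lt_min => /andP[hd hd'] Oh.
have := dP (x + h); rewrite (addrC x h) addrK addrC => /(_ hd Oh).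
have := d'P h hd'; rewrite ler_norml enorm_sqr !bilMxE dotvNl -phix.
by move=> /andP[? _ ?]; lra.
Qed.

Lemma superjet_le Om u w x p X d : 0 < d -> u x = w x ->
  (forall y, enorm (y - x) < d -> Om y -> w y <= u y) ->
  superjet Om u x p X -> superjet Om w x p X.
Proof.
move=> d0 uw wu [d' d'0 d'P]; exists (Num.min d d'); first by rewrite lt_min d0.
move=> h; rewrite lt_min => /andP[hd hd'] Oh; rewrite -uw.
by apply: le_trans (d'P h hd' Oh); apply: wu => //; rewrite (addrC x h) addrK.
Qed.

Lemma enorm_mulmx_bound X :
  exists2 C : R, 0 <= C & forall x, enorm (x *m X) <= C * enorm x.
Proof.
have [C C0 CP] := bil_bound X; exists C => // x.
have := CP x (x *m X); rewrite /bil -enorm_sqr ger0_norm ?sqr_ge0 //.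
have [->|x0] := eqVneq (x *m X) 0; first by rewrite enorm0 mulr_ge0 ?enorm_ge0.
by rewrite expr2 ler_pM2r // enorm_gt0.
Qed.

(* The maximum point of v - Q - eta |. - x0|^2, Q the touching paraboloid of u,
   tends to x0 as v tends to u. *)
Lemma jet_stability Om lam G mu f u x0 p X : open Om ->
  (forall Y a, Y^T = Y -> lam (Y + a%:M) = lam Y + a) ->
  Om x0 -> X^T = X ->
  (forall e, 0 < e -> exists2 d, 0 < d & forall y q, enorm (y - x0) < d ->
     Om y -> enorm (q - p) < d -> G y q <= G x0 p + e) ->
  (forall e, 0 < e -> exists2 d, 0 < d & forall y, enorm (y - x0) < d ->
     Om y -> f x0 - e <= f y) ->
  (forall e, 0 < e -> exists (v : 'rV[R]_N -> R) mu' g, [/\ usc_on Om v,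
    jet_sub Om lam G mu' g v, `|mu' - mu| <= e, u x0 - e <= v x0 & forall y, Om y -> f y - e <= g y /\ v y <= u y + e]) ->
  superjet Om u x0 p X -> f x0 <= lam X + G x0 p + mu * u x0.
Proof.
move=> Oo lamD Ox Xs Gc fc app [d0 d00 dP]; apply/ler_addgt0Pr => e e0.
(* The final error e is spent as e/4 on the penalisation 2 eta, e/4 on G, e/8 on f, e/8 on g and e/4
   on the zeroth order term. *)
pose eta := e / 8; have eta0 : 0 < eta by rewrite divr_gt0.
have [dO dO0 dOP] := open_enormP Oo Ox.
have [C C0 CP] := enorm_mulmx_bound X.
have e4 : 0 < e / 4 by rewrite divr_gt0.
have e8 : 0 < e / 8 by rewrite divr_gt0.
have [dG dG0 dGP] := Gc _ e4; have [df df0 dfP] := fc _ e8.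
have [e2 e20 e2mu] : exists2 e2, 0 < e2 & `|mu| * e2 <= e / 8.
  have m1 : 0 < `|mu| + 1 by rewrite ltr_wpDl.
  exists (e / 8 / (`|mu| + 1)); first by rewrite divr_gt0.
  by rewrite mulrCA ler_piMr ?ltW // ltr_pdivrMr // mul1r ltrDl.
pose P k := dotv p k + 2^-1 * bil X k k.
have [d2 d20 d2P] : exists2 d, 0 < d & forall k, enorm k < d -> `|P k| < e2.
  have := @continuous_quadratic R N 0 0 p X 0; move/cts_enormP => /(_ e2 e20)[d dgt0 dQ].
  exists d => // k kd; have := dQ k; rewrite !subr0 => /(_ kd).
  by rewrite dotv0r bil0l mulr0 !addr0 subr0 add0r.
have Ce0 : 0 < C + 2 * eta by rewrite ltr_wpDl // mulr_gt0.
pose m := Num.min (Num.min (Num.min d0 dO) (Num.min df d2))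
   (Num.min dG (dG / (C + 2 * eta))).
have m0 : 0 < m by rewrite !lt_min d00 dO0 df0 d20 dG0 divr_gt0.
pose dl := m / 2; have dl0 : 0 < dl by rewrite divr_gt0.
have : dl < m by rewrite ltr_pdivrMr // ltr_pMr // ltr1n.
rewrite !lt_min => /andP[/andP[/andP[dld0 dldO] /andP[dldf dld2]] /andP[dldG]].
rewrite ltr_pdivlMr // => dldC.
have D0 : 0 < `|u x0| + 1 + e2 + `|mu|.
  by have := normr_ge0 (u x0); have := normr_ge0 mu; lra.
have [ep ep0 [ep1 epe epd epD]] : exists2 ep, 0 < ep & [/\ ep <= 1, ep <= e / 8,
    ep <= eta * dl ^+ 2 / 4 & ep * (`|u x0| + 1 + e2 + `|mu|) <= e / 8].
  exists (Num.min (Num.min 1 (e / 8)) (Num.min (eta * dl ^+ 2 / 4)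
     (e / 8 / (`|u x0| + 1 + e2 + `|mu|)))).
    by rewrite !lt_min ltr01 e8 !divr_gt0 // mulr_gt0 // exprn_gt0.
  by rewrite -ler_pdivlMr // !ge_min !lexx !orbT.
have [v [mu' [g [vU vS mumu vx0 gv]]]] := app ep ep0.
pose Q y := P (y - x0) + eta * bil 1%:M (y - x0) (y - x0).
have Qc : continuous Q.
  suff -> : Q = fun y => 0 + dotv p (y - x0) + 2^-1 * bil (X + (2 * eta)%:M) (y - x0) (y - x0).
    exact: continuous_quadratic.
  by apply/funext => y; rewrite /Q /P !bilMxE; field.
have [|//|||y /= yK ymax] := @usc_max _ _ Om [set y | enorm (y - x0) <= dl]
  (fun y => v y - Q y).
- by exists x0; rewrite /= subrr enorm0 ltW.
- exact: compact_cball.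
- by move=> y /= yd; apply: dOP; exact: le_lt_trans dldO.
- by apply: usc_subc => // t _; exact: Qc.
have Oy : Om y by apply: dOP; exact: le_lt_trans dldO.
have [k kE] : exists k, k = y - x0 by exists (y - x0).
have yk : y = x0 + k by rewrite kE subrKC.
have Qx0 : Q x0 = 0.
  by rewrite /Q /P subrr dotv0r !bil0l !mulr0 !addr0.
have Qy : Q y = P k + eta * enorm k ^+ 2.
  by rewrite /Q -kE bil_scalar mul1r enorm_sqr.
have := ymax x0; rewrite subrr enorm0 Qx0 subr0 => /(_ (ltW dl0)) vy.
have uy : u y <= u x0 + P k.
  rewrite {1}yk /P [u x0 + _]addrA; apply: dP; last by rewrite -yk.
  by rewrite kE; exact: le_lt_trans dld0.
have [gy vuy] := gv y Oy.
(* Penalisation localises the maximum: comparing with x0 gives eta |k|^2 <= 2 ep <= eta dl^2 / 2, so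
   it is interior to the ball. *)
have kdl : enorm k < dl.
  rewrite -(ltr_pXn2r (ltn0Sn 1)) ?nnegrE ?enorm_ge0 // ?ltW //.
  rewrite -(ltr_pM2l eta0); rewrite Qy in vy.
  have : 0 < eta * dl ^+ 2 by rewrite mulr_gt0 // exprn_gt0.
  clear -vy uy vuy vx0 epd; lra.
have Pk : `|P k| < e2 by apply: d2P; exact: lt_trans dld2.
have Yjet : superjet Om v y (p + k *m X + (2 * eta) *: k) (X + (2 * eta)%:M).
  exists (dl - enorm k); first by rewrite subr_gt0.
  move=> h hd Oyh; have := ymax (y + h).
  have khE : y + h - x0 = k + h by rewrite kE addrAC.
  rewrite khE.
  have khd : enorm (k + h) <= dl by apply: le_trans (enormD _ _) _; clear -hd; lra.
  move=> /(_ khd).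
  have -> : Q (y + h) = P (k + h) + eta * dotv (k + h) (k + h).
    by rewrite /Q khE bil_scalar mul1r.
  rewrite Qy enorm_sqr /P !dotvE !bilE !bilMxE -/(bil X k h).
  rewrite (bilC h k Xs) (dotvC h k); clear; lra.
have := vS y _ _ Oy (sym_scalarD (2 * eta) Xs) Yjet.
rewrite lamD // => H1.
have G1 : G y (p + k *m X + (2 * eta) *: k) <= G x0 p + e / 4.
  apply: dGP => //; first by rewrite -kE (lt_trans kdl).
  rewrite -[p + _ + _]addrA (addrC p) addrK; apply: le_lt_trans dldC.
  apply: le_trans (enormD _ _) _; rewrite enormZ ger0_norm; last by rewrite mulr_ge0 // ltW.
  have : (C + 2 * eta) * enorm k < (C + 2 * eta) * dl by rewrite ltr_pM2l.
  have := CP k; clear; lra.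
have f1 : f x0 - e / 8 <= f y by apply: dfP => //; rewrite -kE (lt_trans kdl).
have vy1 : `|v y - u x0| <= ep + e2.
  move: Pk; rewrite ltr_norml => /andP[Pk1 Pk2]; rewrite Qy in vy.
  have : 0 <= eta * enorm k ^+ 2 by rewrite mulr_ge0 ?sqr_ge0 // ltW.
  rewrite ler_norml => etak.
  by apply/andP; split; clear -Pk1 Pk2 etak vy vx0 vuy uy; lra.
have vy2 : `|v y| <= `|u x0| + 1 + e2.
  have := ler_normD (v y - u x0) (u x0); rewrite subrK; clear -vy1 ep1; lra.
have muv : mu' * v y <= mu * u x0 + e / 4.
  have -> : mu' * v y = mu * u x0 + ((mu' - mu) * v y + mu * (v y - u x0)) by ring.
  rewrite lerD2l; have h1 := ler_norm ((mu' - mu) * v y).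
  have h2 := ler_norm (mu * (v y - u x0)).
  rewrite !normrM in h1 h2.
  have h3 : `|mu' - mu| * `|v y| <= ep * (`|u x0| + 1 + e2) by rewrite ler_pM.
  have h4 : `|mu| * `|v y - u x0| <= `|mu| * (ep + e2) by rewrite ler_wpM2l.
  clear -h1 h2 h3 h4 e2mu epD; lra.
rewrite /eta in H1; clear -H1 G1 f1 gy epe muv; lra.
Qed.

End Jets.

(** * The function defining the domain, and comparison with cones *)

Section DomainFunction.
Context {R : realType} {N : nat}.
Implicit Types (x y z h p : 'rV[R]_N) (a b c e d : R) (X : 'M[R]_N).

(** This is |x|^2 plus a supremum of affine functions, hence convex with D^2 W >= 2 I in the weak
    sense. Squared distances are used because the distances themselves are flat in the radial
    direction. *)
Definition ball_gauge (r : R) (Y : set 'rV[R]_N) x : R :=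
  sup [set enorm (x - y) ^+ 2 - r ^+ 2 | y in Y].

Context {r : R} {Y : set 'rV[R]_N} {o : 'rV[R]_N}.
Hypotheses (r0 : 0 < r) (Y0 : Y !=set0) (Yo : forall y, Y y -> enorm (o - y) <= r).
Local Notation W := (ball_gauge r Y).

Lemma gauge_le x c : (forall y, Y y -> enorm (x - y) ^+ 2 - r ^+ 2 <= c) -> W x <= c.
Proof.
move=> H; apply: ge_sup; first by case: Y0 => y Yy; eexists; exists y.
by move=> _ [y Yy <-]; exact: H.
Qed.

Lemma gauge_ge x y : Y y -> enorm (x - y) ^+ 2 - r ^+ 2 <= W x.
Proof.
move=> Yy; apply: ub_le_sup; last by exists y.
exists ((enorm (x - o) + r) ^+ 2 - r ^+ 2) => _ [z Yz <-].
rewrite lerD2r ler_pXn2r ?nnegrE ?enorm_ge0 ?addr_ge0 ?enorm_ge0 ?(ltW r0) //.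
by rewrite (le_trans (enorm_triangle o _ _)) // lerD2l Yo.
Qed.

Lemma gauge_lb x : - r ^+ 2 <= W x.
Proof.
case: Y0 => y Yy; apply: le_trans (gauge_ge x Yy).
by rewrite lerDr sqr_ge0.
Qed.

Lemma gauge_le0 x y : W x <= 0 -> Y y -> enorm (x - y) <= r.
Proof.
move=> Wx Yy; have := gauge_ge x Yy => H.
rewrite -(ler_pXn2r (ltn0Sn 1)) ?nnegrE ?enorm_ge0 ?(ltW r0) //; lra.
Qed.

Lemma gauge_lipD x z D : (forall y, Y y -> enorm (x - y) <= D) ->
  W x - W z <= 2 * D * enorm (x - z).
Proof.
move=> xD; rewrite lerBlDr; apply: gauge_le => y Yy.
have := gauge_ge z Yy; have -> : z - y = (x - y) + (z - x) by rewrite [RHS]addrC subrKA.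
rewrite enorm_addr_sqr (enormB x z); have := dotv_ge (x - y) (z - x).
have := xD y Yy; have := enorm_ge0 (z - x); have := sqr_ge0 (enorm (z - x)).
nra.
Qed.

(** Each paraboloid lies above its tangent plane at x, whose slope is at most 2 r; so only x has to
    satisfy W <= 0, and z is arbitrary. *)
Lemma gauge_lip x z : W x <= 0 -> W x - W z <= 2 * r * enorm (x - z).
Proof. by move=> Wx; apply: gauge_lipD => y; exact: gauge_le0. Qed.

Lemma gauge_conv x z t : 0 <= t -> t <= 1 ->
  W (x + t *: (z - x)) <= (1 - t) * W x + t * W z.
Proof.
move=> t0 t1; apply: gauge_le => y Yy.
have -> : x + t *: (z - x) - y = (1 - t) *: (x - y) + t *: (z - y).
  by apply/rowP => i; rewrite !mxE; ring.
have := gauge_ge x Yy; have := gauge_ge z Yy.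
have := dotvv_ge0 ((x - y) - (z - y)).
rewrite !enorm_sqr; move: (x - y) (z - y) => A B.
rewrite !dotvE (dotvC B A) => H1 H2 H3.
have : 0 <= t * (1 - t) * (dotv A A + - dotv A B + (- dotv A B - - dotv B B)).
  by rewrite mulr_ge0 // ?mulr_ge0 ?subr_ge0 //; move: H1; lra.
have := ler_wpM2l t0 H2; have t1' : 0 <= 1 - t by rewrite subr_ge0.
have := ler_wpM2l t1' H3; lra.
Qed.

Lemma gauge_strong x h : 2 * W x + 2 * enorm h ^+ 2 <= W (x + h) + W (x - h).
Proof.
have : W x <= (W (x + h) + W (x - h) - 2 * enorm h ^+ 2) / 2.
  apply: gauge_le => y Yy.
  have := gauge_ge (x + h) Yy; have := gauge_ge (x - h) Yy.
  rewrite [x + h - y]addrAC [x - h - y]addrAC !enorm_addr_sqr !enormN !dotvNr !dotvDl; lra.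
lra.
Qed.

Lemma continuous_gauge : continuous W.
Proof.
move=> x; apply/cts_enormP => e e0.
pose D := enorm (x - o) + r + 1.
have D0 : 0 < D by rewrite ltr_wpDl // addr_ge0 ?enorm_ge0 ?(ltW r0).
have xD z y : enorm (z - x) < 1 -> Y y -> enorm (z - y) <= D.
  move=> zx Yy; have := enorm_triangle x z y; have := enorm_triangle o x y.
  by have := Yo Yy; rewrite /D; lra.
exists (Num.min 1 (e / (2 * D))); first by rewrite lt_min ltr01 divr_gt0 // mulr_gt0.
move=> z; rewrite lt_min ltr_pdivlMr ?mulr_gt0 // => /andP[z1 ze].
have := @gauge_lipD z x D (fun y => xD z y z1).
have xx : enorm (x - x) < 1 by rewrite subrr enorm0.
have := @gauge_lipD x z D (fun y => xD x y xx).
by rewrite (enormB x z) ltr_norml => ? ?; apply/andP; split; lra.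
Qed.

Lemma compact_gauge c : compact [set x | W x <= c].
Proof.
apply: bounded_closed_compact; last first.
  by apply: (@preimage_closed _ _ W [set t | t <= c]); [move=> x _;
    exact: continuous_gauge|exact: closed_le].
case: Y0 => y Yy; exists (`|c| + r ^+ 2 + 1 + enorm y); split; first exact: num_real.
move=> M cM x /= Wx; apply: (le_trans (norm_le_enorm _)); apply: ltW; apply: le_lt_trans cM.
have := enormD (x - y) y; rewrite subrK => /le_trans; apply; rewrite lerD2r.
have := gauge_ge x Yy; have := ler_norm c; have := enorm_ge0 (x - y).
have := sqr_ge0 (enorm (x - y) - 1); nra.
Qed.

End DomainFunction.

(** For infinite Y, strict inequalities for each y do not bound the supremum strictly. Openness
    does: x pushed away from y by d / 2 is still in Om, so |x - y| < r - d / 2 uniformly in y. *)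
Lemma bigcap_eball_gauge (R : realType) (N : nat) (r : R) (Y Om : set 'rV[R]_N) o x :
  0 < r -> Y !=set0 -> open Om -> Om o -> Om = \bigcap_(y in Y) eball y r ->
  Om x <-> ball_gauge r Y x < 0.
Proof.
move=> r0 Y0 Oo Omo OmE.
have Oy z y : Om z -> Y y -> enorm (z - y) < r by rewrite OmE => /(_ y).
have Yo y : Y y -> enorm (o - y) <= r by move=> /(Oy o y Omo)/ltW.
split=> [Ox|Wx]; last first.
  rewrite OmE => y Yy; have := gauge_ge r0 Yo x Yy => H.
  rewrite /eball /= -(ltr_pXn2r (ltn0Sn 1)) ?nnegrE ?enorm_ge0 ?(ltW r0) //; lra.
have [d0 d00 dP] := open_enormP Oo Ox; pose d := Num.min d0 r.
have d_gt0 : 0 < d by rewrite lt_min d00.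
have d2 : 0 < d / 2 by rewrite divr_gt0.
have dd0 : d <= d0 by rewrite ge_min lexx.
have dr : d <= r by rewrite ge_min lexx orbT.
have rd : 0 <= r - d / 2 by lra.
apply: (@le_lt_trans _ _ ((r - d / 2) ^+ 2 - r ^+ 2)); last by nra.
apply: gauge_le => // y Yy; rewrite lerD2r ler_pXn2r ?nnegrE ?enorm_ge0 //.
have [->|xy] := eqVneq x y; first by rewrite subrr enorm0.
have n0 : 0 < enorm (x - y) by rewrite enorm_gt0 subr_eq0.
pose k := d / 2 / enorm (x - y).
have k0 : 0 <= k by rewrite divr_ge0 // ltW.
have kn : k * enorm (x - y) = d / 2 by rewrite /k divfK // gt_eqF.
have /Oy /(_ Yy) : Om (x + k *: (x - y)).
  apply: dP; rewrite (addrC x) addrK enormZ ger0_norm // kn; lra.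
have -> : x + k *: (x - y) - y = (1 + k) *: (x - y).
  by rewrite scalerDl scale1r addrAC.
rewrite enormZ ger0_norm ?addr_ge0 // mulrDl mul1r kn; lra.
Qed.

(** * Tests with explicit quadratic forms *)

Section QuadraticTests.
Context {R : realType} {N : nat}.
Implicit Types (x y z h p : 'rV[R]_N) (a b c e d : R) (X : 'M[R]_N).
Implicit Types (q : 'rV[R]_N -> R).

(** Hides the matrix, so that test paraboloids can be written as formulas in dot products and
    evaluated in a single direction. *)
Definition quadform q := exists2 X : 'M[R]_N, X^T = X &
  forall h, q h = 2^-1 * bil X h h.

Lemma quadformD q q' : quadform q -> quadform q' -> quadform (fun h => q h + q' h).
Proof.
move=> [X Xs qX] [X' Xs' qX']; exists (X + X').
  by rewrite linearD /= Xs Xs'.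
by move=> h; rewrite qX qX' bilMxE mulrDr.
Qed.

Lemma quadformZ k q : quadform q -> quadform (fun h => k * q h).
Proof.
move=> [X Xs qX]; exists (k *: X); first by rewrite linearZ /= Xs.
by move=> h; rewrite qX bilMxE; ring.
Qed.

Lemma quadform_dotvv : quadform (fun h => dotv h h).
Proof.
exists (2%:M : 'M[R]_N); first by rewrite tr_scalar_mx.
by move=> h; rewrite bilMxE mulrA mulVf ?mul1r.
Qed.

Lemma bil_rank1 p z h k : bil (p^T *m z) h k = dotv p h * dotv z k.
Proof.
rewrite /bil mulmxA [h *m _]mx11_scalar mul_scalar_mx dotvZl; congr (_ * _).
by rewrite mxE dotvC; apply: eq_bigr => i _; rewrite mxE.
Qed.

Lemma quadform_dotv2 p z : quadform (fun h => dotv p h * dotv z h).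
Proof.
exists (p^T *m z + z^T *m p).
  by rewrite linearD /= !trmx_mul !trmxK addrC.
by move=> h; rewrite bilMxE !bil_rank1; field.
Qed.

Definition quad_touch (Om : set 'rV[R]_N) (u : 'rV[R]_N -> R) x p q :=
  exists2 d : R, 0 < d & forall h, enorm h < d -> Om (x + h) ->
    u (x + h) <= u x + dotv p h + q h.

Lemma quad_touch_superjet Om u x p q X : (forall h, q h = 2^-1 * bil X h h) ->
  quad_touch Om u x p q -> superjet Om u x p X.
Proof.
by move=> qX [d d0 dP]; exists d => // h hd Oh; rewrite -qX dP.
Qed.

(* Viscosity inequality lambda_min(D^2 u) + b |Du| >= 0, tested with paraboloids. *)
Definition bsub (Om : set 'rV[R]_N) b (u : 'rV[R]_N -> R) :=
  forall x p q, Om x -> quadform q -> quad_touch Om u x p q ->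
    forall h, 0 <= 2 * q h + b * enorm p * dotv h h.

Lemma jet_sub_quad (Om : set 'rV[R]_N) (H : 'rV[R]_N -> 'rV[R]_N -> R) mu f u x p q h :
  (0 < N)%N -> jet_sub Om (@smallest_eigenvalue R N) H mu f u -> Om x ->
  quadform q -> quad_touch Om u x p q ->
  (f x - H x p - mu * u x) * dotv h h <= 2 * q h.
Proof.
move=> N0 uS Ox [X Xs qX] uq.
have := uS x p X Ox Xs (quad_touch_superjet qX uq).
have := (smallest_eigenvalueP N0 Xs).2 h; have := dotvv_ge0 h.
by rewrite qX mulrA mulfV ?mul1r //; nra.
Qed.

Lemma jet_sub_bsub (Om : set 'rV[R]_N) (H : 'rV[R]_N -> 'rV[R]_N -> R) b mu f u :
  (0 < N)%N -> (forall x p, Om x -> H x p <= b * enorm p) -> 0 <= mu ->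
  (forall x, Om x -> 0 <= f x) -> (forall x, Om x -> u x <= 0) ->
  jet_sub Om (@smallest_eigenvalue R N) H mu f u -> bsub Om b u.
Proof.
move=> N0 Hb mu0 f0 u0 uS x p q Ox qq uq h.
have := jet_sub_quad h N0 uS Ox qq uq; have := Hb x p Ox; have := f0 x Ox.
have : mu * u x <= 0 by rewrite mulr_ge0_le0 // u0.
have := dotvv_ge0 h; nra.
Qed.

End QuadraticTests.

(** * Comparison with cones, Harnack's inequality and the Lipschitz bound *)

Section ConeComparison.
Context {R : realType} {N : nat}.
Implicit Types (x y z h p : 'rV[R]_N).
Context {Om : set 'rV[R]_N} {b : R} {u : 'rV[R]_N -> R}.
Hypotheses (b0 : 0 <= b) (uU : usc_on Om u) (uS : bsub Om b u).

Lemma local_max_touch (phi : 'rV[R]_N -> R) x p q d :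
  quadform q -> Om x -> 0 < d ->
  (forall h, enorm h < d -> Om (x + h) -> u (x + h) - phi (x + h) <= u x - phi x) ->
  (forall h, enorm h < d -> phi (x + h) - phi x <= dotv p h + q h) ->
  forall h, 0 <= 2 * q h + b * enorm p * dotv h h.
Proof.
move=> qq Ox d0 um pq; apply: (uS Ox qq); exists d => // h hd Oh.
by have := um h hd Oh; have := pq h hd; lra.
Qed.

(** The tangential term is twice that of the Taylor expansion. This makes the bound exact for all
    |h| <= |x| / 2 and costs nothing in the radial direction, where the term vanishes. *)
Lemma enorm_quad_le x h : x != 0 -> enorm h <= enorm x / 2 ->
  enorm (x + h) - enorm x <= dotv x h / enorm x +
    (enorm h ^+ 2 - dotv x h ^+ 2 / enorm x ^+ 2) / enorm x.
Proof.
rewrite -enorm_gt0; move: (dotv_le x h) (dotv_ge x h) (enorm_addr_sqr x h).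
move: (enorm_ge0 h) (enorm_ge0 (x + h)).
move: (enorm x) (enorm h) (enorm (x + h)) (dotv x h) => s k t c k0 t0 ck kc tE s0 ks.
pose a := c / s; have -> : c ^+ 2 / s ^+ 2 = a ^+ 2 by rewrite /a expr_div_n.
have cE : c = s * a by rewrite /a mulrCA mulfV ?mulr1 // gt_eqF.
rewrite -/a; have {}ck : a <= k by rewrite /a ler_pdivrMr // mulrC.
have {}kc : - k <= a by rewrite /a ler_pdivlMr // mulNr mulrC.
pose m := (k ^+ 2 - a ^+ 2) / s.
have m0 : 0 <= m by rewrite divr_ge0 ?(ltW s0) // subr_ge0; nra.
have mE : m * s = k ^+ 2 - a ^+ 2 by rewrite /m divfK // gt_eqF.
rewrite -/m lerBlDr -(ler_pXn2r (ltn0Sn 1)) ?nnegrE //; last by lra.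
rewrite tE cE; nra.
Qed.

(** The smallest eigenvalue is at most the second derivative in the radial direction, where the cone
    gives L g'' + b L g' = L (b - 2 b (b + 1) s - 2 (b + 1)) < 0. The bound on d ensures g' >= 1/2.
    The compact sets K replace boundary values of u: points where u exceeds the cone by m stay away
    from the boundary. *)
Lemma cone_comparison z d L : Om z -> 0 < d -> d * (4 * (b + 1)) <= 1 -> 0 < L ->
  let g s := s - (b + 1) * s ^+ 2 in
  (forall m, 0 < m -> exists K : set 'rV[R]_N, [/\ compact K, K `<=` Om,
     forall y, K y -> enorm (y - z) <= d &
     forall y, Om y -> enorm (y - z) <= d ->
       m <= u y - (u z + L * g (enorm (y - z))) -> K y]) ->
  (forall y, Om y -> enorm (y - z) = d -> u y <= u z + L * g d) ->
  forall y, Om y -> enorm (y - z) <= d -> u y <= u z + L * g (enorm (y - z)).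
Proof.
move=> Oz d0 db L0 g hK hd y0 Oy0 y0d; rewrite leNgt; apply/negP => uy0.
pose phi y := u z + L * g (enorm (y - z)); pose m := u y0 - phi y0.
have m0 : 0 < m by rewrite subr_gt0.
have [K [Kc KO Kd KP]] := hK m m0.
have Ky0 : K y0 by apply: KP.
have phic : continuous phi.
  have nc := @continuous_enormB R N z.
  have n2 : continuous (fun y => enorm (y - z) ^+ 2).
    move=> x; exact: (@continuousM _ _ (fun y => enorm (y - z))
      (fun y => enorm (y - z)) x (nc x) (nc x)).
  have gc : continuous (fun y => g (enorm (y - z))).
    move=> x; apply: (@continuousB _ _ _ (fun y => enorm (y - z))
      (fun y => (b + 1) * enorm (y - z) ^+ 2)); first exact: nc.
    by apply: (@continuousM _ _ (fun=> b + 1) (fun y => enorm (y - z) ^+ 2));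
      [exact: cst_continuous|exact: n2].
  move=> x; apply: (@continuousD _ _ _ (fun=> u z) (fun y => L * g (enorm (y - z))));
    first exact: cst_continuous.
  by apply: (@continuousM _ _ (fun=> L) (fun y => g (enorm (y - z))));
    [exact: cst_continuous|exact: gc].
have [|x Kx xmax] :=
    @usc_max _ _ Om K (fun y => u y - phi y) _ Kc KO (usc_subc uU (fun x _ => phic x)).
  by exists y0.
have mx : m <= u x - phi x by exact: xmax Ky0.
have Ox := KO _ Kx; have xd := Kd _ Kx.
have xz : x - z != 0.
  apply/eqP => xz0; move: mx; rewrite /phi xz0 enorm0 /g.
  by move: xz0 => /eqP; rewrite subr_eq0 => /eqP ->; lra.
have xd' : enorm (x - z) < d.
  rewrite lt_neqAle xd andbT; apply/eqP => xzd; have := hd x Ox xzd.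
  by move: mx; rewrite /phi xzd; lra.
pose s := enorm (x - z); have s0 : 0 < s by rewrite enorm_gt0.
(* p is the gradient of phi at x, and q its second order upper bound; the first term of q comes from
   [enorm_quad_le] and vanishes at h = x - z. *)
pose p := (L * (s^-1 - 2 * (b + 1))) *: (x - z).
pose q h := L * s^-1 * (dotv h h + - (s ^+ 2)^-1 * (dotv (x - z) h * dotv (x - z) h))
   + (- (L * (b + 1))) * dotv h h.
have qq : quadform q.
  apply: quadformD; last by apply: quadformZ; exact: quadform_dotvv.
  apply: quadformZ; apply: quadformD; first exact: quadform_dotvv.
  by apply: quadformZ; exact: quadform_dotv2.
have := @local_max_touch phi x p q (Num.min (d - s) (s / 2)) qq Ox.
have dl0 : 0 < Num.min (d - s) (s / 2) by rewrite lt_min subr_gt0 xd' divr_gt0.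
move=> /(_ dl0) lmt.
have E1 : dotv (x - z) (x - z) = s ^+ 2 by rewrite /s enorm_sqr.
have E2 : enorm p = L * (1 - 2 * (b + 1) * s).
  rewrite /p enormZ -/s ger0_norm.
    by field; rewrite gt_eqF.
  rewrite mulr_ge0 ?(ltW L0) // subr_ge0 -[s^-1]mul1r ler_pdivlMr //.
  have : (b + 1) * s <= (b + 1) * d by rewrite ler_wpM2l ?addr_ge0 // ltW.
  lra.
have : 0 <= 2 * q (x - z) + b * enorm p * dotv (x - z) (x - z).
  apply: lmt => [h|h].
    rewrite lt_min => /andP[hds hs] Oxh.
    have xhd : enorm (x + h - z) <= d.
      by rewrite addrAC (le_trans (enormD _ _)) // -/s; lra.
    have [/xmax//|nK] := pselect (K (x + h)).
    rewrite leNgt; apply/negP => lt; apply: nK; apply: KP => //.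
    by apply: le_trans mx _; exact: ltW.
  rewrite lt_min => /andP[_ hs].
  have := @enorm_quad_le (x - z) h xz (ltW hs); have := enorm_addr_sqr (x - z) h.
  rewrite /phi [x + h - z]addrAC -/s /p dotvZl /g /q (enorm_sqr h).
  move: (dotv (x - z) h) (dotv h h) (enorm _) => C D T TE.
  rewrite -(ler_pM2l L0) => H1; rewrite TE.
  have AE : L * (C / s + (D - C ^+ 2 / s ^+ 2) / s) =
     L * s^-1 * C + L * s^-1 * (D + - (s ^+ 2)^-1 * (C * C)).
    by field; rewrite gt_eqF.
  rewrite AE in H1; lra.
rewrite /q E1 E2.
have -> : - (s ^+ 2)^-1 * (s ^+ 2 * s ^+ 2) = - s ^+ 2 by field; rewrite gt_eqF.
apply/negP; rewrite -ltNge subrr mulr0 add0r.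
have : 0 < L * s ^+ 2 by rewrite mulr_gt0 // exprn_gt0.
have : 0 <= L * s ^+ 2 * s * b * (b + 1).
  by rewrite !mulr_ge0 ?sqr_ge0 ?addr_ge0 // ltW.
have : 0 <= L * s ^+ 2 * b by rewrite !mulr_ge0 ?sqr_ge0 // ltW.
lra.
Qed.

(** The slope L is such that the cone with vertex value u z reaches 0 at radius d. As g d >= 3 d /
    4, at radius d / 2 the cone has risen by at most two thirds of - u z. *)
Lemma harnack z d : (forall y, Om y -> u y <= 0) ->
  0 < d -> d * (4 * (b + 1)) <= 1 -> (forall y, enorm (y - z) <= d -> Om y) ->
  forall y, enorm (y - z) <= d / 2 -> 3 * u y <= u z.
Proof.
move=> u0 d0 db dO y yd.
have zz : enorm (z - z) <= d by rewrite subrr enorm0 ltW.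
have yd' : enorm (y - z) <= d by lra.
have Oz := dO z zz; have Oy := dO y yd'.
have := u0 z Oz; rewrite le_eqVlt => /orP[/eqP ->|uz].
  by have := u0 y Oy; lra.
pose gd := d - (b + 1) * d ^+ 2.
have gd0 : 3 / 4 * d <= gd by rewrite /gd; nra.
have gd1 : 0 < gd by lra.
pose L := - u z / gd; have L0 : 0 < L by rewrite divr_gt0 // oppr_gt0.
have Lg : L * gd = - u z by rewrite /L divfK // gt_eqF.
have := cone_comparison Oz d0 db L0; cbv zeta => cone.
set s := enorm (y - z) in yd yd' *.
have : u y <= u z + L * (s - (b + 1) * s ^+ 2).
  apply: cone => // [m m0|x Ox _].
    by exists [set y | enorm (y - z) <= d]; split=> //; exact: compact_cball.
  by rewrite [L * _]Lg subrr u0.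
have s0 : 0 <= s by exact: enorm_ge0.
have Lb : 0 <= L * (b + 1) by rewrite mulr_ge0 ?addr_ge0 // ltW.
have := mulr_ge0 Lb (sqr_ge0 s).
have : L * (3 / 4 * d) <= L * gd by rewrite ler_wpM2l // ltW.
have : L * s <= L * (d / 2) by rewrite ler_wpM2l // ltW.
rewrite Lg; lra.
Qed.

(** Both terms of the constant are used with g s >= 3 s / 4. The term 2 r^2 / d lifts the cone by at
    least A r^2 >= - u z at radius d. The term 4 r gives slope at least 3 r A, more than the slope 2
    r A of A W, so u can exceed the cone by m only where W <= - m / A, a compact set. *)
Lemma gauge_lipschitz (r : R) (Y : set 'rV[R]_N) (o : 'rV[R]_N) A d : 0 < r -> Y !=set0 ->
  (forall y, Y y -> enorm (o - y) <= r) ->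
  (forall x, Om x <-> ball_gauge r Y x < 0) ->
  0 < A -> 0 < d -> d * (4 * (b + 1)) <= 1 ->
  (forall y, Om y -> A * ball_gauge r Y y <= u y <= 0) ->
  forall x z, Om x -> Om z ->
    u x - u z <= A * (4 * r + 2 * r ^+ 2 / d) * enorm (x - z).
Proof.
move=> r0 Y0 Yo OW A0 d0 db uW x z Ox Oz; set W := ball_gauge r Y in uW OW.
have Wlip y y' : Om y -> W y - W y' <= 2 * r * enorm (y - y').
  by move=> /OW/ltW Wy; exact: (gauge_lip r0 Y0 Yo).
have Wlb y : - r ^+ 2 <= W y by exact: (gauge_lb r0 Y0 Yo).
have r2 : 0 < r ^+ 2 by rewrite exprn_gt0.
pose C := 4 * r + 2 * r ^+ 2 / d; rewrite -/C.
have Cd : C * d = 4 * r * d + 2 * r ^+ 2 by rewrite /C; field; rewrite gt_eqF.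
have C0 : 4 * r <= C by rewrite /C lerDl divr_ge0 ?mulr_ge0 ?ltW.
have L0 : 0 < A * C by rewrite mulr_gt0 // (lt_le_trans _ C0) // mulr_gt0.
have uz : - (A * r ^+ 2) <= u z.
  have /andP[h1 _] := uW z Oz; apply: le_trans h1; rewrite -mulrN ler_wpM2l //.
  by rewrite ltW.
have ACd : A * C * d = A * (4 * r * d) + A * (2 * r ^+ 2) by rewrite -mulrA Cd mulrDr.
have Ard : 0 <= A * (4 * r * d) by rewrite !mulr_ge0 // ltW.
have [xzd|xzd] := leP (enorm (x - z)) d; last first.
  have /andP[_ ux] := uW x Ox.
  have : A * C * d <= A * C * enorm (x - z) by rewrite ler_wpM2l // ltW.
  have : 0 <= A * r ^+ 2 by rewrite mulr_ge0 // ltW.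
  lra.
have s0 := enorm_ge0 (x - z).
have gs s : 0 <= s -> s <= d -> 3 / 4 * s <= s - (b + 1) * s ^+ 2.
  by move=> s0' sd; nra.
have := cone_comparison Oz d0 db L0; cbv zeta => cone.
have : u x <= u z + A * C * (enorm (x - z) - (b + 1) * enorm (x - z) ^+ 2).
  apply: cone => // [m m0|y Oy yd].
    exists ([set y | W y <= - (m / A)] `&` [set y | enorm (y - z) <= d]); split.
    - apply: compact_closedI; first exact: (compact_gauge r0 Y0 Yo).
      apply: compact_closed; first exact: norm_hausdorff.
      exact: compact_cball.
    - by move=> y [/= Wy _]; apply/OW; apply: le_lt_trans Wy _; rewrite oppr_lt0 divr_gt0.
    - by move=> y [].
    - move=> y Oy yd my; split => //=.
      rewrite lerNr ler_pdivrMr //; have /andP[_ uy] := uW y Oy.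
      have /andP[uz' _] := uW z Oz.
      have g1 := gs _ (enorm_ge0 (y - z)) yd.
      have g2 := ler_wpM2l (ltW L0) g1.
      have h1 := ler_wpM2l (ltW A0) (Wlip y z Oy).
      have h2 : A * (4 * r) * enorm (y - z) <= A * C * enorm (y - z).
        by rewrite ler_wpM2r ?enorm_ge0 // ler_wpM2l // ltW.
      have h3 : 0 <= A * r * enorm (y - z) by rewrite !mulr_ge0 ?enorm_ge0 // ltW.
      lra.
  have g2 := ler_wpM2l (ltW L0) (gs d (ltW d0) (lexx d)).
  have /andP[_ uy] := uW y Oy.
  have : 0 <= A * r ^+ 2 by rewrite mulr_ge0 // ltW.
  lra.
have Lb : 0 <= A * C * (b + 1) by rewrite mulr_ge0 ?addr_ge0 // ltW.
have := mulr_ge0 Lb (sqr_ge0 (enorm (x - z))); lra.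
Qed.

End ConeComparison.

(** * Hopf barrier *)

Section GaugeJets.
Context {R : realType} {N : nat}.
Implicit Types (x y z h p e : 'rV[R]_N).
Context {Om : set 'rV[R]_N} {r : R} {Y : set 'rV[R]_N} {o : 'rV[R]_N}.
Hypotheses (r0 : 0 < r) (Y0 : Y !=set0) (Yo : forall y, Y y -> enorm (o - y) <= r).
Hypotheses (Oo : open Om) (OW : forall x, Om x <-> ball_gauge r Y x < 0).
Local Notation W := (ball_gauge r Y).

(** The Hessian bound is strong convexity at x + t h and x - t h. For the gradient, go to x - t p:
    the paraboloid drops by t |p|^2 to first order, while A W drops by at most 2 r A t |p|. *)
Lemma gauge_superjet A x p X : 0 < A -> Om x ->
  superjet Om (fun y => A * W y) x p X ->
  (forall h, 2 * A * dotv h h <= bil X h h) /\ enorm p <= 2 * r * A.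
Proof.
move=> A0 Ox [d1 d10 d1P]; have [d2 d20 d2P] := open_enormP Oo Ox.
pose d := Num.min d1 d2; have d0 : 0 < d by rewrite lt_min d10.
have dP h : enorm h < d -> A * W (x + h) <= A * W x + dotv p h + 2^-1 * bil X h h.
  rewrite lt_min => /andP[hd1 hd2]; apply: d1P => //; apply: d2P.
  by rewrite (addrC x) addrK.
split=> [h|].
  have [->|h0] := eqVneq h 0; first by rewrite dotv0l mulr0 bil0l.
  have n0 : 0 < enorm h by rewrite enorm_gt0.
  pose t := d / 2 / enorm h; have t0 : 0 < t by rewrite !divr_gt0.
  have tn : enorm (t *: h) < d.
    rewrite enormZ gtr0_norm // /t divfK ?gt_eqF // ltr_pdivrMr //.
    by rewrite ltr_pMr // ltr1n.
  have := dP _ tn; have := dP (- (t *: h)); rewrite enormN => /(_ tn).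
  have := @gauge_strong R N r Y o r0 Y0 Yo x (t *: h).
  rewrite enorm_sqr !dotvE !bilE => /(ler_wpM2l (ltW A0)) H1 H2 H3.
  by rewrite -(ler_pM2l (exprn_gt0 2 t0)); lra.
have [->|p0] := eqVneq p 0.
  by rewrite enorm0 !mulr_ge0 // ltW.
have n0 : 0 < enorm p by rewrite enorm_gt0.
rewrite -(ler_pM2r n0) -subr_ge0; have d'0 : 0 < d / enorm p by rewrite divr_gt0.
apply: (@lin_ge0 R _ (2^-1 * bil X p p) _ d'0) => t t0 td.
have tn : enorm (- (t *: p)) < d.
  by rewrite enormN enormZ gtr0_norm // -ltr_pdivlMr.
have := dP _ tn; have := @gauge_lip R N r Y o r0 Y0 Yo x (x - t *: p) (ltW ((OW x).1 Ox)).
rewrite opprB subrKC enormZ gtr0_norm // => /(ler_wpM2l (ltW A0)).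
rewrite !dotvE !bilE -enorm_sqr; lra.
Qed.

(** The Hessian contributes 2 A and the gradient term costs at most b times 2 r A: this is where b r
    < 1 enters. *)
Lemma gauge_jet_sub (H : 'rV[R]_N -> 'rV[R]_N -> R) b A x p X : (0 < N)%N ->
  0 < A -> 0 <= b -> (forall x p, Om x -> - H x p <= b * enorm p) -> Om x -> X^T = X ->
  superjet Om (fun y => A * W y) x p X ->
  2 * A * (1 - b * r) <= smallest_eigenvalue X + H x p.
Proof.
move=> N0 A0 b0 Hb Ox Xs /(gauge_superjet A0 Ox)[XP pP].
have /(smallest_eigenvalue_ge _ N0 Xs) := XP.
have := Hb x p Ox; have := ler_wpM2l b0 pP; lra.
Qed.

End GaugeJets.

(** * Bounds on compact sets and the barrier in a cone *)

Section Hopf.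
Context {R : realType} {N : nat}.
Implicit Types (x y z h p e : 'rV[R]_N).
Context {Om : set 'rV[R]_N} {b : R} {u : 'rV[R]_N -> R}.
Hypotheses (b0 : 0 <= b) (uU : usc_on Om u) (uS : bsub Om b u).

(** Upper semicontinuity gives no lower bound; Harnack's inequality does, since u >= 3 u x near
    x. *)
Lemma compact_lower_bound (K : set 'rV[R]_N) : open Om ->
  (forall y, Om y -> u y <= 0) -> compact K -> K `<=` Om ->
  exists2 M, 0 < M & forall y, K y -> - M <= u y.
Proof.
move=> Oo u0 /compact_near_coveringP Kc KO.
have := @Kc R (pinfty_nbhs R) (fun M y => - M <= u y) _ _.
have H : forall x, K x -> \forall x' \near x & i \near pinfty_nbhs R, - i <= u x'.
  move=> x Kx; have Ox := KO x Kx; have [d1 d10 d1P] := open_enormP Oo Ox.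
  have b4 : 0 < 4 * (b + 1) by rewrite mulr_gt0 // ltr_wpDl.
  pose d := Num.min (d1 / 2) (4 * (b + 1))^-1.
  have d0 : 0 < d by rewrite lt_min divr_gt0 // invr_gt0.
  have db : d * (4 * (b + 1)) <= 1.
    by rewrite -ler_pdivlMr // mul1r ge_min lexx orbT.
  have dd1 : d <= d1 / 2 by rewrite ge_min lexx.
  exists ([set y | enorm (y - x) < d / 2], [set M | - (3 * u x) <= M]) => /=.
    split; first by apply/nbhs_enormP; exists (d / 2) => //; rewrite divr_gt0.
    exists (- (3 * u x)); split; first exact: num_real.
    by move=> M /= /ltW.
  move=> [y M] /= [yx Mx]; apply: (@le_trans _ _ (3 * u x)); first by lra.
  apply: (harnack b0 uU uS u0 d0 db); last by rewrite enormB ltW.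
  move=> z zy; apply: d1P; have := enorm_triangle y z x; lra.
move=> /(_ _ H) => P1.
have [M [M0 MP]] := @filter_ex _ (pinfty_nbhs R) _ _ (filterI (nbhs_pinfty_gt (num_real 0)) P1).
by exists M.
Qed.

Lemma compact_upper_bound (K : set 'rV[R]_N) :
  (forall y, Om y -> u y < 0) -> compact K -> K `<=` Om ->
  exists2 m, 0 < m & forall y, K y -> u y <= - m.
Proof.
move=> u0 Kc KO; have [K0|nK] := pselect (K !=set0).
  have [x Kx xmax] := usc_max K0 Kc KO uU.
  exists (- u x); first by rewrite oppr_gt0 u0 //; exact: KO.
  by move=> y /xmax; rewrite opprK.
by exists 1 => // y Ky; exfalso; apply: nK; exists y.
Qed.

(* The barrier c (M |y - x0|^2 / T - (1 + M) T - kap |y - x0|^2), T = e . (y - x0),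
   is, up to its last term, homogeneous of degree 1 about x0: its Hessian in the
   direction y - x0 is -2 c kap, which beats the first order term. *)
Lemma cone_hopf x0 e M t0 c : enorm e = 1 -> 2 <= M -> 0 < t0 -> 0 < c ->
  let kap := b * (6 * M + 1) + 1 in
  t0 * (2 * kap) <= 1 -> t0 * (3 * (b + 1)) <= 1 ->
  let T y := dotv e (y - x0) in
  let D y := M * (enorm (y - x0) ^+ 2 - T y ^+ 2) <= 2 * T y ^+ 2 in
  (forall y, 0 < T y -> T y <= t0 -> D y -> Om y /\ u y <= 0) ->
  (forall y, T y = t0 -> D y -> u y <= - (2 * c * t0)) ->
  forall t, 0 < t -> t <= t0 -> u (x0 + t *: e) <= - c * t.
Proof.
move=> e1 M2 t00 c0 kap tk tb T D HO HC t t_gt0 tt0; rewrite leNgt; apply/negP => ut.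
have Mge0 : 0 <= M by apply: le_trans M2.
have k1 : 1 <= kap by rewrite /kap lerDr mulr_ge0 // addr_ge0 // mulr_ge0.
pose Q y := enorm (y - x0) ^+ 2.
(* On the axis phi <= - c t. On the lateral boundary M Q = (M + 2) T^2, so phi = c (T - kap Q) >= 0
   >= u. On the top T = t0, phi >= - 2 c t0 >= u. So an excess of u over phi on the axis yields a
   maximum inside the cone. *)
pose phi y := c * (M * (Q y / T y) - (1 + M) * T y - kap * Q y).
pose y0 := x0 + t *: e.
have y0E : y0 - x0 = t *: e by rewrite /y0 (addrC x0) addrK.
have Ty0 : T y0 = t by rewrite /T y0E dotvZr -enorm_sqr e1 expr1n mulr1.
have Qy0 : Q y0 = t ^+ 2 by rewrite /Q y0E enormZ e1 mulr1 real_normK ?num_real.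
have phiy0 : phi y0 <= - c * t.
  rewrite /phi Ty0 Qy0; have -> : t ^+ 2 / t = t by field; rewrite gt_eqF.
  have : 0 <= c * kap * t ^+ 2 by rewrite !mulr_ge0 ?sqr_ge0 //; lra.
  lra.
pose m := u y0 - phi y0.
have m0 : 0 < m by rewrite subr_gt0 (le_lt_trans phiy0).
have QT y : T y ^+ 2 <= Q y.
  rewrite /Q /T; have := dotv_le e (y - x0); have := dotv_ge e (y - x0).
  rewrite e1 mul1r; have := enorm_ge0 (y - x0); nra.
have DQ y : D y -> Q y <= 2 * T y ^+ 2.
  by rewrite /D -/(Q y) => Dy; have := QT y; nra.
have phi_ge y : 0 < T y -> T y <= t0 -> D y -> - (2 * c * T y) <= phi y.
  move=> Ty0' Tyt Dy; have := DQ y Dy; have QTy := QT y.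
  have h1 : T y <= Q y / T y by rewrite ler_pdivlMr // -expr2.
  have h2 : M * T y <= M * (Q y / T y) by rewrite ler_wpM2l //; lra.
  move=> h3; have h4 : kap * Q y <= T y.
    have : kap * Q y <= kap * (2 * T y ^+ 2) by rewrite ler_wpM2l //; lra.
    have : T y * (T y * (2 * kap)) <= T y * (t0 * (2 * kap)).
      by rewrite ler_wpM2l ?(ltW Ty0') // ler_wpM2r //; lra.
    have : T y * (t0 * (2 * kap)) <= T y * 1 by rewrite ler_wpM2l // ltW.
    lra.
  rewrite /phi; have : c * (- 2 * T y) <= c * (M * (Q y / T y) - (1 + M) * T y - kap * Q y).
    by rewrite ler_wpM2l ?(ltW c0) //; lra.
  lra.
(* Cuts off the apex, where phi is singular: for T < t1, u - phi <= 2 c T < m. The cap t keeps y0 in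
   the compact set K. *)
pose t1 := Num.min (m / (4 * c)) t.
have t10 : 0 < t1 by rewrite lt_min t_gt0 andbT divr_gt0 // mulr_gt0.
have t1m : t1 * (4 * c) <= m.
  by rewrite -ler_pdivlMr ?mulr_gt0 // ge_min lexx.
have small y : 0 < T y -> T y <= t0 -> D y -> T y < t1 -> u y - phi y < m.
  move=> Ty0' Tyt Dy Tt1; have := phi_ge y Ty0' Tyt Dy.
  have [_] := HO y Ty0' Tyt Dy.
  have : c * T y < c * t1 by rewrite ltr_pM2l.
  lra.
have Tc : continuous T.
  have -> : T = fun y => 0 + dotv e (y - x0) + 2^-1 * bil 0 (y - x0) (y - x0).
    by apply/funext => y; rewrite /T add0r /bil mulmx0 dotv0l mulr0 addr0.
  exact: continuous_quadratic.
have Qc : continuous Q.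
  have -> : Q = fun y => 0 + dotv 0 (y - x0) + 2^-1 * bil 2%:M (y - x0) (y - x0).
    by apply/funext => y; rewrite /Q enorm_sqr dotv0l bil_scalar; field.
  exact: continuous_quadratic.
have T2c : continuous (fun y => T y ^+ 2).
  by move=> y; apply: (@continuousM _ _ T T); exact: Tc.
have Lc : continuous (fun y => M * (Q y - T y ^+ 2) - 2 * T y ^+ 2).
  move=> y; apply: (@continuousB _ _ _ (fun y => M * (Q y - T y ^+ 2)) (fun y => 2 * T y ^+ 2)).
    apply: (@continuousM _ _ (fun=> M) (fun y => Q y - T y ^+ 2)); first exact: cst_continuous.
    by apply: (@continuousB _ _ _ Q (fun y => T y ^+ 2)); [exact: Qc|exact: T2c].
  by apply: (@continuousM _ _ (fun=> 2) (fun y => T y ^+ 2));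
    [exact: cst_continuous|exact: T2c].
pose K := [set y | [/\ t1 <= T y, T y <= t0 & M * (Q y - T y ^+ 2) - 2 * T y ^+ 2 <= 0]].
have KD y : K y -> [/\ 0 < T y, T y <= t0 & D y].
  by move=> [h1 h2 h3]; split => //; [exact: lt_le_trans h1|rewrite /D -/(Q y); lra].
have Kc : compact K.
  apply: (subclosed_compact _ (@compact_cball R N x0 (2 * t0))).
    have -> : K = (T @^-1` [set s | t1 <= s] `&` T @^-1` [set s | s <= t0]) `&`
       (fun y => M * (Q y - T y ^+ 2) - 2 * T y ^+ 2) @^-1` [set s | s <= 0].
      by apply/seteqP; split => y [] //; move=> [].
    apply: closedI; first apply: closedI.
    - by apply: (@preimage_closed _ _ T) => [y _|]; [exact: Tc|exact: closed_ge].
    - by apply: (@preimage_closed _ _ T) => [y _|]; [exact: Tc|exact: closed_le].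
    - by apply: (@preimage_closed _ _ (fun y => M * (Q y - T y ^+ 2) - 2 * T y ^+ 2)
        [set s | s <= 0]) => [y _|]; [exact: Lc|exact: closed_le].
  move=> y /KD[Ty0' Tyt /DQ Qy] /=.
  rewrite -(ler_pXn2r (ltn0Sn 1)) ?nnegrE ?enorm_ge0 //; last by lra.
  apply: le_trans Qy _; nra.
have KO y : K y -> Om y by move=> /KD[? ? ?]; have [] := HO y.
have phic y : K y -> {for y, continuous phi}.
  move=> /KD[Ty0' _ _].
  apply: (@continuousM _ _ (fun=> c) (fun y => M * (Q y / T y) - (1 + M) * T y - kap * Q y)).
    exact: cst_continuous.
  apply: (@continuousB _ _ _ (fun y => M * (Q y / T y) - (1 + M) * T y) (fun y => kap * Q y)).
    apply: (@continuousB _ _ _ (fun y => M * (Q y / T y)) (fun y => (1 + M) * T y)).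
      apply: (@continuousM _ _ (fun=> M) (fun y => Q y / T y)); first exact: cst_continuous.
      apply: (@continuousM _ _ Q (fun y => (T y)^-1)); first exact: Qc.
      by apply: (@continuousV _ _ T); [rewrite gt_eqF|exact: Tc].
    by apply: (@continuousM _ _ (fun=> 1 + M) T); [exact: cst_continuous|exact: Tc].
  by apply: (@continuousM _ _ (fun=> kap) Q); [exact: cst_continuous|exact: Qc].
have Ky0 : K y0.
  split; rewrite ?Ty0 ?Qy0 //; first by rewrite ge_min lexx orbT.
  by rewrite subrr mulr0 sub0r oppr_le0 mulr_ge0 ?sqr_ge0.
have [|x Kx xmax] := @usc_max _ _ K K (fun y => u y - phi y) _ Kc (@subset_refl _ K)
  (usc_subc (usc_subset KO uU) phic).
  by exists y0.
have mx : m <= u x - phi x by exact: xmax Ky0.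
have [Tx0 Txt Dx] := KD x Kx; have [Ox ux] := HO x Tx0 Txt Dx.
have Txt' : T x < t0.
  rewrite lt_neqAle Txt andbT; apply/eqP => Txt0.
  have := HC x Txt0 Dx; have := phi_ge x Tx0 Txt Dx; rewrite Txt0; lra.
have Dx' : M * (Q x - T x ^+ 2) < 2 * T x ^+ 2.
  rewrite lt_neqAle [X in _ && X]Dx andbT; apply/eqP => DxE.
  have : M * (Q x / T x) = (M + 2) * T x.
    have -> : M * (Q x / T x) = (M * Q x) / T x by rewrite mulrA.
    have -> : M * Q x = (M + 2) * T x ^+ 2 by lra.
    by field; rewrite gt_eqF.
  have h4 : kap * Q x <= T x.
    have := DQ x Dx => h3.
    have : kap * Q x <= kap * (2 * T x ^+ 2) by rewrite ler_wpM2l //; lra.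
    have : T x * (T x * (2 * kap)) <= T x * (t0 * (2 * kap)).
      by rewrite ler_wpM2l ?(ltW Tx0) // ler_wpM2r //; lra.
    have : T x * (t0 * (2 * kap)) <= T x * 1 by rewrite ler_wpM2l // ltW.
    lra.
  move: mx; rewrite /phi => + ME; rewrite ME.
  have : 0 <= c * ((M + 2) * T x - (1 + M) * T x - kap * Q x).
    by rewrite mulr_ge0 ?(ltW c0) //; lra.
  lra.
have [d dE] : exists d, d = x - x0 by exists (x - x0).
pose s := T x.
have [dl dl0 dlP] : exists2 dl, 0 < dl & forall h, enorm h < dl ->
    [/\ 0 < T (x + h), T (x + h) <= t0, D (x + h) & enorm h <= s / 2].
  have e10 : 0 < s / 2 by rewrite divr_gt0.
  have e20 : 0 < t0 - s by rewrite subr_gt0.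
  have e30 : 0 < 2 * s ^+ 2 - M * (Q x - s ^+ 2) by rewrite subr_gt0.
  have /cts_enormP /(_ _ e10) [d1 d10 d1P] := Tc x.
  have /cts_enormP /(_ _ e20) [d2 d20 d2P] := Tc x.
  have /cts_enormP /(_ _ e30) [d3 d30 d3P] := Lc x.
  exists (Num.min (Num.min d1 d2) (Num.min d3 (s / 2))); first by rewrite !lt_min d10 d20 d30.
  move=> h; rewrite !lt_min => /andP[/andP[hd1 hd2] /andP[hd3 hs]].
  have xh : x + h - x = h by rewrite (addrC x) addrK.
  have := d1P (x + h); have := d2P (x + h); have := d3P (x + h); rewrite xh.
  move=> /(_ hd3) + /(_ hd2) + /(_ hd1); rewrite !ltr_norml -/s.
  move=> /andP[T1 T2] /andP[T3 T4] /andP[L1 L2]; rewrite /D -/(Q (x + h)).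
  by split; rewrite ?(ltW hs) //; clear -Tx0 T1 T2 T3 T4 L1 L2; lra.
have [a aE] : exists a, a = s^-1 *: d by exists (s^-1 *: d).
pose p := c *: (M *: (2 *: a - (dotv a a) *: e) - (1 + M) *: e - (2 * kap) *: d).
(* The first bracket is |h - (e . h / s) d|^2, which vanishes at h = d by homogeneity. The exact
   expansion divides it by s + e . h >= s / 2, whence the factor 2. *)
pose q h := c * (2 * M / s) * (dotv h h + (- 2 * s^-1 * (dotv e h * dotv d h)
    + s^-2 * dotv d d * (dotv e h * dotv e h))) + (- (c * kap)) * dotv h h.
have qq : quadform q.
  apply: quadformD; last by apply: quadformZ; exact: quadform_dotvv.
  apply: quadformZ; apply: quadformD; first exact: quadform_dotvv.
  by apply: quadformD; apply: quadformZ; exact: quadform_dotv2.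
have := @local_max_touch R N Om b u uS phi x p q dl qq Ox dl0.
move=> lmt; have : 0 <= 2 * q d + b * enorm p * dotv d d.
  apply: lmt => h hdl; have [Txh0 Txht Dxh hs] := dlP h hdl.
    move=> _; have [Tt1|Tt1] := ltP (T (x + h)) t1.
      by apply: ltW; apply: lt_le_trans mx; exact: small.
    apply: xmax; split => //; move: Dxh; rewrite /D -/(Q (x + h)); clear; lra.
  have TE : T (x + h) = s + dotv e h by rewrite /T addrAC dotvDr.
  have QE : Q (x + h) = dotv d d + 2 * dotv d h + dotv h h.
    by rewrite /Q addrAC -dE enorm_addr_sqr !enorm_sqr.
  have QxE : Q x = dotv d d by rewrite /Q -dE enorm_sqr.
  have eh : - (s / 2) <= dotv e h.
    have := dotv_ge e h; rewrite e1 mul1r; clear -hs; lra.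
  have E0 : 0 <= dotv (h - (s^-1 * dotv e h) *: d) (h - (s^-1 * dotv e h) *: d).
    exact: dotvv_ge0.
  move: Txh0; rewrite /phi TE QE QxE -/s /p aE /q !dotvE => Txh0.
  move: E0; rewrite !dotvE (dotvC h d).
  move: (dotv e h) (dotv d h) (dotv h h) (dotv d d) Txh0 eh => tau B Dh Qd Txh0 eh.
  set E := (X in 0 <= X -> _) => E0.
  have s_gt0 : 0 < s by [].
  have sn0 : s != 0 by rewrite gt_eqF.
  have stn0 : s + tau != 0 by rewrite gt_eqF.
  have EE : E = Dh + (- 2 * s^-1 * (tau * B) + s^-2 * Qd * (tau * tau)).
    by rewrite /E; field.
  clearbody E.
  have key : (Qd + 2 * B + Dh) / (s + tau) - Qd / s =
    2 * B / s - Qd * tau / s ^+ 2 + E / (s + tau).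
    by rewrite EE; field; rewrite sn0 stn0.
  have Ele : E / (s + tau) <= 2 * E / s.
    rewrite ler_pdivrMr // mulrAC ler_pdivlMr //; clear -E0 eh s_gt0; nra.
  have M0 : 0 <= c * M by rewrite mulr_ge0 // ltW.
  have := ler_wpM2l M0 Ele; rewrite -EE.
  have -> : (Qd + 2 * B + Dh) / (s + tau) =
      Qd / s + (2 * B / s - Qd * tau / s ^+ 2 + E / (s + tau)).
    by rewrite -key; ring.
  move=> H1; rewrite -subr_ge0 in H1; rewrite -subr_ge0.
  apply: le_trans H1 _; rewrite le_eqVlt; apply/orP; left; apply/eqP.
  by field; rewrite ?sn0 ?stn0.
have ds : dotv e d = s by rewrite dE.
have Qd : dotv d d = Q x by rewrite /Q -dE enorm_sqr.
have s_gt0 : 0 < s by [].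
have Q0 : 0 < Q x by apply: lt_le_trans (QT x); rewrite exprn_gt0.
have qd : q d = - (c * kap) * Q x.
  by rewrite /q ds Qd; field; rewrite gt_eqF.
have aa : dotv a a <= 2.
  rewrite aE !dotvE Qd mulrA -invfM -expr2 ler_pdivrMl ?exprn_gt0 //.
  by rewrite mulrC; exact: DQ.
have na : enorm a <= 3 / 2.
  rewrite -(ler_pXn2r (ltn0Sn 1)) ?nnegrE ?enorm_ge0 // enorm_sqr.
  by apply: le_trans aa _; lra.
have nd : enorm d <= 3 / 2 * t0.
  have -> : d = s *: a by rewrite aE scalerA mulfV ?scale1r // gt_eqF.
  rewrite enormZ gtr0_norm // mulrC ler_pM ?enorm_ge0 // ltW //.
(* The origin of [kap]: |2 a - |a|^2 e| <= 5 gives 5 M + (1 + M), so b |p| <= c (kap - 1 + 3 b t0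
   kap) < 2 c kap because 3 b t0 <= 1. *)
have np : enorm p <= c * (6 * M + 1 + 2 * kap * (3 / 2 * t0)).
  rewrite /p enormZ gtr0_norm // ler_wpM2l ?(ltW c0) //.
  have h1 := enormD (M *: (2 *: a - dotv a a *: e) - (1 + M) *: e) (- ((2 * kap) *: d)).
  have h2 := enormD (M *: (2 *: a - dotv a a *: e)) (- ((1 + M) *: e)).
  have h3 := enormD (2 *: a) (- (dotv a a *: e)).
  rewrite !enormN !enormZ e1 !mulr1 in h1 h2 h3.
  rewrite (ger0_norm (dotvv_ge0 a)) in h3.
  rewrite (ger0_norm Mge0) in h2.
  have M1 : 0 <= 1 + M by rewrite addr_ge0.
  rewrite (ger0_norm M1) in h2.
  have kk : 0 <= 2 * kap by rewrite mulr_ge0 // (le_trans _ k1).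
  rewrite (ger0_norm kk) in h1.
  rewrite ger0_norm // in h3.
  have h4 := ler_wpM2l kk nd.
  have h5 : M * enorm (2 *: a - dotv a a *: e) <= M * 5.
    by rewrite ler_wpM2l //; clear -h3 na aa; lra.
  clear -h1 h2 h4 h5; lra.
rewrite qd Qd; apply/negP; rewrite -ltNge.
have h1 := ler_wpM2l b0 np.
have -> : 2 * (- (c * kap) * Q x) + b * enorm p * Q x =
    Q x * (b * enorm p - 2 * (c * kap)) by ring.
rewrite pmulr_rlt0 // subr_lt0; apply: le_lt_trans h1 _.
have -> : b * (c * (6 * M + 1 + 2 * kap * (3 / 2 * t0))) = c * (kap - 1 + kap * (3 * b * t0)).
  by rewrite /kap; field.
have -> : 2 * (c * kap) = c * (2 * kap) by ring.
rewrite ltr_pM2l //.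
have : kap * (3 * b * t0) <= kap * 1.
  by rewrite ler_wpM2l ?(le_trans ler01 k1) //; lra.
by lra.
Qed.

End Hopf.

(** * Hopf's lemma *)

Section GlobalHopf.
Context {R : realType} {N : nat}.
Implicit Types (x y z h p e : 'rV[R]_N).
Context {Om : set 'rV[R]_N} {r : R} {Y : set 'rV[R]_N} {o : 'rV[R]_N}.
Hypotheses (r0 : 0 < r) (Y0 : Y !=set0) (Yo : forall y, Y y -> enorm (o - y) <= r).
Hypotheses (Oo : open Om) (OW : forall x, Om x <-> ball_gauge r Y x < 0) (Omo : Om o).
Local Notation W := (ball_gauge r Y).

Lemma gauge_exit x : Om x -> x != o ->
  exists2 s : R, 1 <= s & W (o + s *: (x - o)) = 0.
Proof.
move=> Ox xo; have n0 : 0 < enorm (x - o) by rewrite enorm_gt0 subr_eq0.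
(* At parameter S the point is at distance |x - o| + 2 r from o, hence at least r from y, so W >= 0
   there. *)
case: Y0 => y Yy; pose S := 1 + 2 * r / enorm (x - o).
have S1 : 1 <= S by rewrite lerDl divr_ge0 ?mulr_ge0 // ltW.
pose f s := W (o + s *: (x - o)).
have fc : continuous f.
  move=> s; apply: (@continuous_comp _ _ _ (fun s : R => o + s *: (x - o)) W); last first.
    exact: (continuous_gauge r0 Y0 Yo).
  apply: (@continuousD _ _ _ (fun=> o) (fun s : R => s *: (x - o)));
    first exact: cst_continuous.
  exact: scalel_continuous.
have f1 : f 1 < 0 by rewrite /f scale1r subrKC; apply/OW.
have fS : 0 <= f S.
  have := gauge_ge r0 Yo (o + S *: (x - o)) Yy; rewrite -/(f S).
  have : r <= enorm (o + S *: (x - o) - y).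
    have := enorm_triangle y (o + S *: (x - o)) o.
    rewrite (addrC o) addrK enormZ ger0_norm; last by lra.
    rewrite {1}/S mulrDl mul1r divfK ?gt_eqF // (enormB y).
    have := Yo Yy; rewrite addrC; lra.
  move=> rS; have : r ^+ 2 <= enorm (o + S *: (x - o) - y) ^+ 2.
    by rewrite ler_pXn2r ?nnegrE ?enorm_ge0 // ltW.
  lra.
have [||s] := @IVT R f 1 S 0 S1.
- exact: continuous_subspaceT.
- by rewrite ge_min (ltW f1) /= le_max fS orbT.
by rewrite in_itv /= => /andP[s1 _] fs; exists s.
Qed.

(** Deep inside Om compactness suffices. Near the boundary, the ray from o through x exits at a
    point xh, and convexity of W puts in Om a cone with apex xh and axis towards o, whose size and
    opening do not depend on xh. The point x lies on the axis, where [cone_hopf] applies. *)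
Lemma hopf b u : 0 <= b -> usc_on Om u -> bsub Om b u ->
  (forall x, Om x -> u x < 0) -> exists2 c, 0 < c & forall x, Om x -> u x <= c * W x.
Proof.
move=> b0 uU uS u0; pose m0 := - W o / 2.
have Wo : W o < 0 by apply/OW.
have m00 : 0 < m0 by rewrite divr_gt0 // oppr_gt0.
have [rho rho0 rhoP] : exists2 rho, 0 < rho & forall z, enorm (z - o) <= rho -> W z <= - m0.
  have := @continuous_gauge R N r Y o r0 Y0 Yo o => /cts_enormP /(_ m0 m00) [d d0 dP].
  exists (d / 2); first by rewrite divr_gt0.
  move=> z zo; have := dP z; rewrite ltr_norml => /(_ _) H1.
  have /H1 /andP[_] : enorm (z - o) < d by lra.
  rewrite /m0; lra.
(* Makes the cone so narrow that it lies in the convex hull of its apex and the ball of radius rho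
   about o, whatever the distance l <= 2 r from xh to o. *)
pose M := 8 * r ^+ 2 / rho ^+ 2 + 2.
have M2 : 2 <= M by rewrite lerDr; apply: divr_ge0; [apply: mulr_ge0 => //|]; exact: sqr_ge0.
have Mrho : 8 * r ^+ 2 <= M * rho ^+ 2.
  have -> : M * rho ^+ 2 = 8 * r ^+ 2 + 2 * rho ^+ 2 by rewrite /M; field; rewrite gt_eqF.
  by rewrite lerDl; apply: mulr_ge0 => //; exact: sqr_ge0.
pose kap := b * (6 * M + 1) + 1.
have kap0 : 0 < 2 * kap.
  have : 0 <= b * (6 * M + 1) by rewrite mulr_ge0 //; lra.
  rewrite /kap; lra.
have b3 : 0 < 3 * (b + 1) by lra.
pose t0 := Num.min (Num.min rho (2 * r)) (Num.min (2 * kap)^-1 (3 * (b + 1))^-1).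
have t00 : 0 < t0 by rewrite !lt_min rho0 !invr_gt0 kap0 b3 mulr_gt0.
have t0rho : t0 <= rho by rewrite /t0 !ge_min lexx.
have t0r : t0 <= 2 * r by rewrite /t0 !ge_min lexx orbT.
have t0k : t0 * (2 * kap) <= 1 by rewrite -ler_pdivlMr // mul1r /t0 !ge_min lexx !orbT.
have t0b : t0 * (3 * (b + 1)) <= 1 by rewrite -ler_pdivlMr // mul1r /t0 !ge_min lexx !orbT.
(* The depth - W guaranteed at height T = t0 in such a cone: u <= - m3 on the top, and points with W
   > - m2 lie at height at most t0. *)
pose m2 := t0 / (2 * r) * m0.
have r2 : 0 < 2 * r by rewrite mulr_gt0.
have m20 : 0 < m2 by rewrite mulr_gt0 // divr_gt0.
pose K := [set x | W x <= - m2].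
have [|m3 m30 m3P] := compact_upper_bound uU u0 (@compact_gauge R N r Y o r0 Y0 Yo (- m2)).
  by move=> x /= Wx; apply/OW; rewrite (le_lt_trans Wx) // oppr_lt0.
pose c := m3 / (2 * t0).
have c0 : 0 < c by rewrite divr_gt0 // mulr_gt0.
have ct0 : 2 * c * t0 = m3 by rewrite /c; field; rewrite gt_eqF.
(* The first entry serves near the boundary, where - W x <= 2 r t; the second deep inside, where W
   >= - r^2. *)
exists (Num.min (c / (2 * r)) (m3 / r ^+ 2)).
  by rewrite lt_min; apply/andP; split; apply: divr_gt0 => //; exact: exprn_gt0.
set cc := Num.min _ _ => x Ox.
have Wx0 : W x < 0 by apply/OW.
have [Wx|Wx] := leP (W x) (- m2).
  apply: le_trans (m3P x Wx) _.
  have /(ler_wnM2r (ltW Wx0)) : cc <= m3 / r ^+ 2 by rewrite ge_min lexx orbT.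
  apply: le_trans.
  have m3r : 0 <= m3 / r ^+ 2 by rewrite divr_ge0 ?sqr_ge0 // ltW.
  have := ler_wpM2l m3r (gauge_lb r0 Y0 Yo x).
  by have -> : m3 / r ^+ 2 * - r ^+ 2 = - m3 by field; rewrite gt_eqF.
have xo : x != o.
  apply/eqP => xo; move: Wx; rewrite xo ltNge => /negP; apply.
  apply: le_trans (rhoP o _) _; first by rewrite subrr enorm0 ltW.
  by rewrite lerN2 /m2 ler_piMl ?(ltW m00) // ler_pdivrMr // mul1r.
have [s s1 Ws] := gauge_exit Ox xo; set xh := o + s *: (x - o) in Ws.
have Wxh0 : W xh <= 0 by rewrite Ws.
have n0 : 0 < enorm (x - o) by rewrite enorm_gt0 subr_eq0.
have sx : 0 < s by lra.
have xho : enorm (xh - o) = s * enorm (x - o).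
  by rewrite /xh (addrC o) addrK enormZ gtr0_norm.
pose l := enorm (xh - o); have l0 : 0 < l by rewrite /l xho mulr_gt0.
have l2r : l <= 2 * r.
  case: Y0 => y Yy; have := enorm_triangle y xh o; rewrite (enormB y o).
  have := Yo Yy; have := gauge_le0 r0 Yo Wxh0 Yy; rewrite /l; lra.
have rhol : rho < l.
  rewrite ltNge; apply/negP => /rhoP; rewrite Ws; lra.
pose e := l^-1 *: (o - xh).
have oxh : o - xh = l *: e by rewrite /e scalerA mulfV ?scale1r // gt_eqF.
have e1 : enorm e = 1.
  by rewrite /e enormZ gtr0_norm ?invr_gt0 // -enormB -/l mulVf // gt_eqF.
pose t := (s - 1) * enorm (x - o).
have xE : x = xh + t *: e.
  have tl : t * l^-1 * s = s - 1 by rewrite /t /l xho; field; rewrite !gt_eqF.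
  have oxhE : o - xh = - (s *: (x - o)) by rewrite /xh opprD addrA subrr sub0r.
  rewrite /e scalerA oxhE scalerN scalerA tl /xh.
  by apply/rowP => i; rewrite !mxE; ring.
have t_ge0 : 0 <= t by rewrite mulr_ge0 ?subr_ge0 // ltW.
pose T y := dotv e (y - xh).
(* Project y from the apex to the point z of the hyperplane through o: |z - o|^2 <= 2 l^2 / M <=
   rho^2, and W is convex with W xh = 0. *)
have WD y : 0 < T y -> T y <= l -> M * (enorm (y - xh) ^+ 2 - T y ^+ 2) <= 2 * T y ^+ 2 ->
    W y <= - (T y / (2 * r) * m0).
  move=> Ty Tl Dy; pose la := T y / l.
  have la0 : 0 < la by rewrite divr_gt0.
  have la1 : la <= 1 by rewrite ler_pdivrMr // mul1r.
  pose z := xh + la^-1 *: (y - xh).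
  have zE : z - o = la^-1 *: (y - xh - T y *: e).
    have laT : la^-1 * T y = l by rewrite /la invf_div divfK // gt_eqF.
    have xe : xh - o = - (l *: e) by rewrite -oxh opprB.
    by rewrite scalerBr scalerA laT -xe /z addrAC addrC.
  have /rhoP Wz : enorm (z - o) <= rho.
    rewrite -(ler_pXn2r (ltn0Sn 1)) ?nnegrE ?enorm_ge0 ?(ltW rho0) //.
    rewrite zE enormZ exprMn real_normK ?num_real // enorm_addr_sqr.
    rewrite enormN enormZ e1 mulr1 real_normK ?num_real // dotvNr dotvZr (dotvC _ e) -/(T y).
    rewrite exprVn ler_pdivrMl ?exprn_gt0 //.
    have laE : la ^+ 2 * rho ^+ 2 * l ^+ 2 = T y ^+ 2 * rho ^+ 2.
      by rewrite /la; field; rewrite gt_eqF.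
    rewrite -(ler_pM2r (exprn_gt0 2 l0)) laE.
    have M0 : 0 < M by lra.
    rewrite -(ler_pM2l M0).
    set D := (X in M * (X * _)); have Dle : M * D <= 2 * T y ^+ 2 by rewrite /D; lra.
    have l2 : l ^+ 2 <= 4 * r ^+ 2 by nra.
    have : M * D * l ^+ 2 <= 2 * T y ^+ 2 * (4 * r ^+ 2).
      apply: (@le_trans _ _ (2 * T y ^+ 2 * l ^+ 2)).
        by rewrite ler_wpM2r ?sqr_ge0.
      by apply: ler_wpM2l l2; apply: mulr_ge0 => //; exact: sqr_ge0.
    have := ler_wpM2l (sqr_ge0 (T y)) Mrho; lra.
  have yE : y = xh + la *: (z - xh).
    by rewrite /z [xh + _ - xh]addrAC subrr add0r scalerA mulfV ?scale1r ?subrKC // gt_eqF.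
  rewrite {1}yE; have := @gauge_conv R N r Y o r0 Y0 Yo xh z la (ltW la0) la1;
    rewrite Ws mulr0 add0r.
  move/le_trans; apply; have := ler_wpM2l (ltW la0) Wz.
  move/le_trans; apply; rewrite mulrN lerN2 ler_wpM2r ?(ltW m00) // /la.
  by rewrite ler_wpM2l ?(ltW Ty) // lef_pV2 ?posrE.
have tT : T x = t.
  by rewrite /T [in x - _]xE (addrC xh) addrK dotvZr -enorm_sqr e1 expr1n mulr1.
have t_gt0 : 0 < t.
  rewrite lt_neqAle t_ge0 andbT; apply/eqP => t0E; move: Wx0.
  by rewrite xE -t0E scale0r addr0 Ws ltxx.
have tt0 : t <= t0.
  rewrite leNgt; apply/negP => t0t; move: Wx; rewrite ltNge => /negP; apply.
  have tl : t <= l by rewrite /l xho /t ler_pM2r // gerBl.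
  have := WD x; rewrite tT => /(_ t_gt0 tl) H1.
  have : W x <= - (t / (2 * r) * m0).
    apply: H1; rewrite [in x - _]xE (addrC xh) addrK enormZ e1 mulr1 real_normK ?num_real //.
    by rewrite subrr mulr0 mulr_ge0 ?sqr_ge0.
  move/le_trans; apply; rewrite lerN2 ler_wpM2r ?(ltW m00) //.
  by rewrite ler_wpM2r ?invr_ge0 ?(ltW r2) // ltW.
have tl : t0 <= l by lra.
have := @cone_hopf R N Om b u b0 uU uS xh e M t0 c e1 M2 t00 c0.
cbv zeta => /(_ t0k t0b) H1.
have : u (xh + t *: e) <= - c * t.
  apply: H1 => // [y Ty Tt0 Dy|y Ty Dy].
    have Oy : Om y.
      apply/OW; apply: le_lt_trans (WD y Ty (le_trans Tt0 tl) Dy) _.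
      by rewrite oppr_lt0 mulr_gt0 // divr_gt0.
    by split => //; exact/ltW/u0.
  rewrite ct0; apply: m3P => /=.
  have Ty' : T y = t0 by [].
  by have := WD y; rewrite Ty' => /(_ t00 tl); apply; rewrite -Ty'.
rewrite -xE => /le_trans; apply.
have /(ler_wnM2r (ltW Wx0)) : cc <= c / (2 * r) by rewrite ge_min lexx.
apply: le_trans.
have := gauge_lip r0 Y0 Yo x Wxh0.
rewrite Ws sub0r {2}xE opprD addrA subrr sub0r enormN enormZ e1 mulr1 ger0_norm //.
move=> H2; have : c / (2 * r) * (- W x) <= c / (2 * r) * (2 * r * t).
  by rewrite ler_wpM2l // divr_ge0 // ltW.
have -> : c / (2 * r) * (2 * r * t) = c * t by field; rewrite gt_eqF.
lra.
Qed.

End GlobalHopf.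

(** * Operations on jet subsolutions *)

Section EigenvalueBound.
Context {R : realType} {N : nat}.
Implicit Types (x y z h p : 'rV[R]_N) (X Z : 'M[R]_N).

(* Harnack's inequality bounds - w from below on a ball by a fixed multiple of
   - w o, and comparison with a paraboloid there bounds mu. *)
Lemma jet_sub_eigenvalue_bound (Om : set 'rV[R]_N) b o : (0 < N)%N -> open Om ->
  Om o -> 0 <= b -> exists C, forall H mu w,
    (forall x p, Om x -> H x p <= b * enorm p) -> 0 <= mu -> usc_on Om w ->
    (forall x, Om x -> w x < 0) ->
    jet_sub Om (@smallest_eigenvalue R N) H mu (fun=> 0) w -> mu <= C.
Proof.
move=> N0 Oo Omo b0; have [d1 d10 d1P] := open_enormP Oo Omo.
have b4 : 0 < 4 * (b + 1) by rewrite mulr_gt0 // ltr_wpDl.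
pose d := Num.min (d1 / 2) (4 * (b + 1))^-1.
have d0 : 0 < d by rewrite lt_min divr_gt0 // invr_gt0.
have db : d * (4 * (b + 1)) <= 1 by rewrite -ler_pdivlMr // mul1r ge_min lexx orbT.
have dd1 : d <= d1 / 2 by rewrite ge_min lexx.
have dO y : enorm (y - o) <= d -> Om y.
  by move=> yd; apply: d1P; apply: le_lt_trans yd _; lra.
exists (16 * (2 + b * d) / d ^+ 2) => H mu w Hb mu0 wU w0 wS.
have wbs : bsub Om b w.
  by apply: jet_sub_bsub wS => // x /w0/ltW.
have hn y : enorm (y - o) <= d / 2 -> 3 * w y <= w o.
  by apply: (harnack b0 wU wbs _ d0 db dO) => z /w0/ltW.
(* With w o = - 3 m, Harnack gives w <= - m on the half ball. The paraboloid - 4 m + K |y - o|^2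
   with K d^2 = 16 m vanishes on the sphere of radius d / 2, so w - phi, equal to m at o, has an
   interior maximum. *)
have [m mE] : exists m, w o = - (3 * m) by exists (- w o / 3); field.
have m0 : 0 < m by have := w0 o Omo; rewrite mE; lra.
have [K KE] : exists K, K * d ^+ 2 = 16 * m.
  by exists (16 * m / d ^+ 2); rewrite divfK // sqrf_eq0 gt_eqF.
have d20 : 0 < d ^+ 2 by rewrite exprn_gt0.
have K0 : 0 < K by rewrite -(pmulr_lgt0 _ d20) KE mulr_gt0.
pose phi y := - (4 * m) + dotv 0 (y - o) + 2^-1 * bil (2 * K)%:M (y - o) (y - o).
have phiE y : phi y = - (4 * m) + K * enorm (y - o) ^+ 2.
  by rewrite /phi dotv0l bil_scalar enorm_sqr; field.
have phic : continuous phi by exact: continuous_quadratic.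
pose B := [set y | enorm (y - o) <= d / 2].
have BO : B `<=` Om by move=> y; rewrite /B /= => yB; apply: dO; lra.
have Bo : B o by rewrite /B /= subrr enorm0 divr_ge0 // ltW.
have [|x Bx xmax] := usc_max _ (@compact_cball R N o (d / 2)) BO
   (usc_subc wU (fun x _ => phic x)); first by exists o.
have := xmax o Bo; rewrite !phiE mE subrr enorm0 => H1.
have Ox := BO x Bx; have wx := hn x Bx.
have xd : enorm (x - o) < d / 2.
  rewrite lt_neqAle [X in _ && X]Bx andbT; apply/eqP => xE.
  move: H1; rewrite xE; have -> : K * (d / 2) ^+ 2 = 4 * m.
    have -> : K * (d / 2) ^+ 2 = (K * d ^+ 2) / 4 by field.
    by rewrite KE; field.
  lra.
pose q h := K * dotv h h.
have qq : quadform q by apply: quadformZ; exact: quadform_dotvv.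
have touch : quad_touch Om w x ((2 * K) *: (x - o)) q.
  exists (d / 2 - enorm (x - o)); first by rewrite subr_gt0.
  move=> h hd Oh; have xhE : x + h - o = (x - o) + h by rewrite addrAC.
  have := xmax (x + h); rewrite !phiE xhE enorm_addr_sqr /q dotvZl enorm_sqr.
  rewrite (enorm_sqr h) => H2; have := H2 _; rewrite -lerBlDr; move: H2 => _ H2.
  have : B (x + h) by rewrite /B /= xhE (le_trans (enormD _ _)) //; lra.
  by move=> /H2; lra.
pose v : 'rV[R]_N := delta_mx ord0 (Ordinal N0).
have v1 : dotv v v = 1 by rewrite dotv_delta mxE !eqxx.
have := jet_sub_quad v N0 wS Ox qq touch; rewrite /q v1 !mulr1.
have := Hb x ((2 * K) *: (x - o)) Ox; rewrite enormZ ger0_norm; last by lra.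
have Kx : b * (2 * K * enorm (x - o)) <= b * (2 * K * (d / 2)).
  by rewrite ler_wpM2l // ler_wpM2l //; lra.
have mw : mu * m <= mu * (- w x) by rewrite ler_wpM2l //; lra.
move=> h1 h2; have {}mw : mu * m <= K * (2 + b * d) by lra.
rewrite ler_pdivlMr // -(ler_pM2r m0).
have -> : 16 * (2 + b * d) * m = (16 * m) * (2 + b * d) by ring.
rewrite -KE mulrAC [X in _ <= X]mulrAC; apply: ler_wpM2r => //.
by rewrite sqr_ge0.
Qed.

End EigenvalueBound.

(** * Scaling and the Perron bump *)

Section JetOperations.
Context {R : realType} {N : nat}.
Implicit Types (x y z h p : 'rV[R]_N) (X Z : 'M[R]_N) (a t d mu : R).
Implicit Types (Om : set 'rV[R]_N) (u w f : 'rV[R]_N -> R).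

Lemma smallest_eigenvalueZ (k : R) X : (0 < N)%N -> 0 < k -> X^T = X ->
  smallest_eigenvalue (k *: X) = k * smallest_eigenvalue X.
Proof.
move=> N0 k0 Xs; have kXs : (k *: X)^T = k *: X by rewrite linearZ /= Xs.
apply/eqP; rewrite eq_le; apply/andP; split.
  rewrite -ler_pdivrMl //; apply/(smallest_eigenvalue_ge _ N0 Xs) => h.
  have := (smallest_eigenvalueP N0 kXs).2 h; rewrite bilMxE -mulrA ler_pdivrMl //.
apply/(smallest_eigenvalue_ge _ N0 kXs) => h.
by rewrite bilMxE -mulrA ler_pM2l //; exact: (smallest_eigenvalueP N0 Xs).2.
Qed.

Lemma jet_subZ Om lam (G : 'rV[R]_N -> 'rV[R]_N -> R) mu f u (k : R) :
  (forall a X, 0 < a -> X^T = X -> lam (a *: X) = a * lam X) ->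
  (forall x a p, Om x -> 0 <= a -> G x (a *: p) = a * G x p) -> 0 < k ->
  jet_sub Om lam G mu f u -> jet_sub Om lam G mu (fun x => k * f x) (fun x => k * u x).
Proof.
move=> lamZ GZ k0 uS x p X Ox Xs [d d0 dP].
have ki0 : 0 < k^-1 by rewrite invr_gt0.
have := uS x (k^-1 *: p) (k^-1 *: X) Ox; rewrite lamZ // GZ ?(ltW ki0) //.
move=> H1; have {H1} := H1 _ _; rewrite linearZ /= Xs => /(_ erefl) H1.
have : f x <= k^-1 * lam X + k^-1 * G x p + mu * u x.
  apply: H1; exists d => // h hd Oh; rewrite dotvZl bilMxE.
  by have := dP h hd Oh; rewrite -ler_pdivlMl // => /le_trans; apply;
    rewrite le_eqVlt; apply/orP; left; apply/eqP; field; rewrite gt_eqF.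
rewrite -(ler_pM2l k0) => /le_trans; apply; rewrite le_eqVlt; apply/orP; left.
by apply/eqP; field; rewrite gt_eqF.
Qed.

Lemma quadratic_ge0 p Z d : 0 < d ->
  (forall h, enorm h < d -> 0 <= dotv p h + 2^-1 * bil Z h h) ->
  p = 0 /\ forall h, 0 <= bil Z h h.
Proof.
move=> d0 H1; have p0 : p = 0.
  apply/eqP/negPn/negP => p0; have n0 : 0 < enorm p by rewrite enorm_gt0.
  have d'0 : 0 < d / enorm p by rewrite divr_gt0.
  have : 0 <= - enorm p ^+ 2.
    apply: (@lin_ge0 R _ (2^-1 * bil Z p p) _ d'0) => t t0 td.
    have := H1 (- (t *: p)); rewrite enormN enormZ gtr0_norm // -ltr_pdivlMr //.
    by move=> /(_ td); rewrite !dotvE !bilE -enorm_sqr; lra.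
  by have := exprn_gt0 2 n0; lra.
split => // h; have [->|h0] := eqVneq h 0; first by rewrite bil0l.
have n0 : 0 < enorm h by rewrite enorm_gt0.
pose t := d / 2 / enorm h; have t0 : 0 < t by rewrite !divr_gt0.
have := H1 (t *: h); rewrite enormZ gtr0_norm // /t divfK ?gt_eqF //.
rewrite p0 dotv0l add0r -/t !bilE => /(_ _)H2.
have : d / 2 < d by lra.
by move=> /H2; rewrite !pmulr_rge0.
Qed.

(* If u fails the supersolution test at x0, with test paraboloid Q, then
   raising u to max(u, Q - eta |. - x0|^2 + dl) near x0 gives a subsolution. *)
Lemma jet_bump Om (H : 'rV[R]_N -> 'rV[R]_N -> R) mu f u x0 p X :
  (0 < N)%N -> open Om -> 0 <= mu ->
  (forall e, 0 < e -> exists2 d : R, 0 < d & forall y (q : 'rV[R]_N),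
    enorm (y - x0) < d -> Om y ->
     enorm (q - p) < d -> `|H y q - H x0 p| <= e) ->
  (forall e, 0 < e -> exists2 d, 0 < d & forall y, enorm (y - x0) < d -> Om y ->
     f y <= f x0 + e) ->
  usc_on Om u -> jet_sub Om (@smallest_eigenvalue R N) H mu f u ->
  Om x0 -> X^T = X -> superjet Om (fun y => - u y) x0 (- p) (- X) ->
  u x0 < 0 -> f x0 < smallest_eigenvalue X + H x0 p + mu * u x0 ->
  (forall x, Om x -> u x <= 0) ->
  exists w, [/\ usc_on Om w, jet_sub Om (@smallest_eigenvalue R N) H mu f w,
    u x0 < w x0 & forall x, Om x -> u x <= w x <= 0].
Proof.
move=> N0 Oo mu0 Hc fc uU uS Ox Xs [dj dj0 djP] ux0 fx0 ule.
pose S := smallest_eigenvalue X + H x0 p + mu * u x0.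
(* A quarter of the gap each for the penalisation 2 eta, the variation of H, that of f, and the term
   mu Q. *)
have [e [e0 eE]] : exists e, 0 < e /\ S = f x0 + 4 * e.
  by exists ((S - f x0) / 4); split; [rewrite divr_gt0 // subr_gt0|field].
pose eta := e / 2; have eta0 : 0 < eta by rewrite divr_gt0.
have [dH dH0 dHP] := Hc e e0; have [df df0 dfP] := fc e e0.
have [C C0 CP] := enorm_mulmx_bound X.
have [dO dO0 dOP] := open_enormP Oo Ox.
pose e2 := Num.min (- u x0 / 2) (e / (mu + 1)).
have mu1 : 0 < mu + 1 by lra.
have e20 : 0 < e2 by rewrite lt_min !divr_gt0 // oppr_gt0.
have e2u : e2 <= - u x0 / 2 by rewrite ge_min lexx.
have e2mu : mu * e2 <= e.
  have : e2 * (mu + 1) <= e by rewrite -ler_pdivlMr // ge_min lexx orbT.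
  lra.
pose Z := X + (- (2 * eta))%:M; have Zs : Z^T = Z by exact: sym_scalarD.
pose P (k : 'rV[R]_N) := dotv p k + 2^-1 * bil Z k k.
have PE k : P k = dotv p k + 2^-1 * bil X k k - eta * enorm k ^+ 2.
  by rewrite /P !bilMxE enorm_sqr; field.
have [dP dP0 dPP] : exists2 d, 0 < d & forall k, enorm k < d -> `|P k| < e2.
  have := @continuous_quadratic R N 0 0 p Z 0; move/cts_enormP => /(_ e2 e20)[d dgt0 dQ].
  exists d => // k kd; have := dQ k; rewrite !subr0 => /(_ kd).
  by rewrite dotv0r bil0l mulr0 !addr0 subr0 add0r.
have Ce0 : 0 < C + 2 * eta by rewrite ltr_wpDl // mulr_gt0.
have [rho rho0 [rhoj rhoH rhof rhoO [rhoP rhoC]]] : exists2 rho, 0 < rho &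
    [/\ rho <= dj, rho <= dH, rho <= df, rho <= dO & rho <= dP /\ rho * (C + 2 * eta) <= dH].
  exists (Num.min (Num.min (Num.min dj dH) (Num.min df dO)) (Num.min dP (dH / (C + 2 * eta)))).
    by rewrite !lt_min dj0 dH0 df0 dO0 dP0 divr_gt0.
  by rewrite -ler_pdivlMr // !ge_min !lexx !orbT.
(* The first entry keeps Q below u from radius rho / 2 on, so the gluing at rho is invisible; the
   second keeps Q <= 0. *)
pose dl := Num.min (eta * (rho / 2) ^+ 2) (- u x0 / 2).
have dl0 : 0 < dl by rewrite lt_min !divr_gt0 ?oppr_gt0 // mulr_gt0 // exprn_gt0 // divr_gt0.
have dlu : dl <= - u x0 / 2 by rewrite ge_min lexx orbT.
have dle : dl <= eta * (rho / 2) ^+ 2 by rewrite ge_min lexx.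
pose Q y := u x0 + dl + P (y - x0).
have Qu y : rho / 2 <= enorm (y - x0) -> enorm (y - x0) < rho -> Om y -> Q y <= u y.
  move=> h1 h2 Oy; have := djP (y - x0); rewrite subrKC => /(_ (lt_le_trans h2 rhoj) Oy).
  rewrite dotvNl bilMxE /Q PE => H1.
  have : eta * (rho / 2) ^+ 2 <= eta * enorm (y - x0) ^+ 2.
    rewrite ler_pM2l // ler_pXn2r ?nnegrE ?enorm_ge0 //; clear -rho0; lra.
  clear -H1 dle; lra.
have Q0 y : enorm (y - x0) < rho -> Q y <= 0.
  move=> h2; have := dPP (y - x0) (lt_le_trans h2 rhoP).
  by rewrite ltr_norml /Q => /andP[_ Pu]; clear -Pu e2u dlu; lra.
pose w y := if enorm (y - x0) < rho then Num.max (u y) (Q y) else u y.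
have uw y : u y <= w y by rewrite /w; case: ifP => // _; rewrite le_max lexx.
have wu y : Om y -> rho / 2 <= enorm (y - x0) -> w y = u y.
  move=> Oy h1; rewrite /w; case: ifP => // h2.
  by apply/max_idPl; exact: Qu.
have Qc : continuous Q.
  suff -> : Q = fun y => (u x0 + dl) + dotv p (y - x0) + 2^-1 * bil Z (y - x0) (y - x0).
    exact: continuous_quadratic.
  by apply/funext => y; rewrite /Q /P addrA.
exists w; split.
- move=> x a Oxx wa; have ua : u x < a by apply: le_lt_trans wa.
  have /near_within_enormP[d d0 dPu] := uU x a Oxx ua.
  apply/near_within_enormP; have [xr|xr] := ltP (enorm (x - x0)) rho.
    have Qa : 0 < a - Q x.
      by rewrite subr_gt0; move: wa; rewrite /w xr gt_max => /andP[].
    have /cts_enormP /(_ _ Qa) [d' d'0 d'P] := Qc x.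
    exists (Num.min d d'); first by rewrite lt_min d0.
    move=> y; rewrite lt_min => /andP[yd yd'] Oy; have uy := dPu y yd Oy.
    rewrite /w; case: ifP => // _; rewrite gt_max uy /=.
    by have := d'P y yd'; rewrite ltr_norml => /andP[_ Qy]; clear -Qy; lra.
  exists (Num.min d (rho / 2)); first by rewrite lt_min d0 divr_gt0.
  move=> y; rewrite lt_min => /andP[yd yd'] Oy; rewrite wu //; first exact: dPu.
  have := enorm_triangle y x x0; rewrite (enormB x y); clear -yd' xr; lra.
- move=> x q T Oxx Ts wj.
  have [wux|wux] := eqVneq (w x) (u x).
    have uj : superjet Om u x q T.
      by apply: (superjet_le (ltr01 : 0 < 1 :> R) wux _ wj) => y _ _; exact: uw.
    by rewrite wux; exact: uS uj.
  have xr2 : enorm (x - x0) < rho / 2.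
    by rewrite ltNge; apply/negP => h1; rewrite wu ?eqxx in wux.
  have xr : enorm (x - x0) < rho by clear -xr2 rho0; lra.
  have wQ : w x = Q x.
    move: wux; rewrite /w xr; case: (leP (u x) (Q x)) => // _; by rewrite eqxx.
  have [d d0 dPw] : superjet Om Q x q T.
    apply: (superjet_le (_ : 0 < rho - enorm (x - x0)) wQ _ wj).
      by rewrite subr_gt0.
    move=> y yx Oy; rewrite /w; have -> : enorm (y - x0) < rho.
      have := enorm_triangle x y x0; clear -yx; lra.
    by rewrite le_max lexx orbT.
  have [dx dx0 dxP] := open_enormP Oo Oxx.
  have [k kE] : exists k, k = x - x0 by exists (x - x0).
  pose px := p + k *m X + (- (2 * eta)) *: k.
  have QE h : Q (x + h) = Q x + dotv px h + 2^-1 * bil Z h h.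
    rewrite /Q [x + h - x0]addrAC -kE /P /px /Z !dotvE !bilE !bilMxE -/(bil X k h).
    by rewrite (bilC h k Xs) (dotvC h k); field.
  (* Q is itself a paraboloid, with gradient px and Hessian Z at x, so a paraboloid touching it from
     above has that gradient and T >= Z. *)
  have [qpx TZ] : q - px = 0 /\ forall h, 0 <= bil (T - Z) h h.
    apply: (@quadratic_ge0 _ _ (Num.min d dx)); first by rewrite lt_min d0.
    move=> h; rewrite lt_min => /andP[hd hdx].
    have Oh : Om (x + h) by apply: dxP; rewrite (addrC x) addrK.
    have := dPw h hd Oh; rewrite QE dotvDl dotvNl !bilMxE; clear; lra.
  have {}qpx : q = px by apply/eqP; rewrite -subr_eq0 qpx.
  have lT : smallest_eigenvalue X - 2 * eta <= smallest_eigenvalue T.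
    have <- : smallest_eigenvalue Z = smallest_eigenvalue X - 2 * eta.
      by rewrite smallest_eigenvalueD.
    apply/(smallest_eigenvalue_ge _ N0 Ts) => h.
    apply: le_trans ((smallest_eigenvalueP N0 Zs).2 h) _.
    by have := TZ h; rewrite !bilMxE; clear; lra.
  have := dHP x px (lt_le_trans xr rhoH) Oxx.
  have -> : enorm (px - p) < dH.
    rewrite /px -[p + _ + _]addrA (addrC p) addrK; apply: lt_le_trans rhoC.
    apply: le_lt_trans (enormD _ _) _; rewrite enormZ normrN ger0_norm;
      last by rewrite mulr_ge0 // ltW.
    have := CP k; rewrite -kE in xr; have : enorm k * (C + 2 * eta) < rho * (C + 2 * eta).
      by rewrite ltr_pM2r.
    clear; lra.
  move=> /(_ isT); rewrite ler_norml => /andP[H1 _].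
  have f1 := dfP x (lt_le_trans xr rhof) Oxx.
  have := dPP (x - x0) (lt_le_trans xr rhoP); rewrite ltr_norml => /andP[P1 _].
  rewrite wQ qpx; have : mu * (u x0 - e2) <= mu * Q x.
    by rewrite ler_wpM2l // /Q; clear -P1 dl0; lra.
  move: eE; rewrite /S /eta in lT * => eE; clear -lT H1 f1 eE e2mu; lra.
- by rewrite /w subrr enorm0 rho0 lt_max /Q PE subrr dotv0r bil0l enorm0; apply/orP; right;
    clear -dl0; lra.
- move=> x Oxx; rewrite uw /w; case: ifP => [xr|_]; last exact: ule.
  by rewrite ge_max ule // Q0.
Qed.

End JetOperations.

(** * Perron's method and the eigenfunction *)

(** Limits along one ultrafilter exist at all points at once, which replaces the diagonal extraction
    of subsequences. *)
Lemma bounded_ultra_limit (R : realType) (F : set_system nat) (s : nat -> R) C :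
  UltraFilter F -> (forall n, - C <= s n <= 0) ->
  exists l, forall e, 0 < e -> F [set n | `|s n - l| <= e].
Proof.
move=> FU sC; pose S := [set c | F [set n | c <= s n]].
have FF := @ultra_proper _ F FU.
have Sup : has_sup S.
  split; first by exists (- C); apply: filterS filterT => n _ /=; have /andP[] := sC n.
  exists 0 => c /= Fc; have [n cn] := filter_ex Fc.
  by apply: (le_trans cn); have /andP[] := sC n.
exists (sup S) => e e0.
have [c Fc ce] := sup_adherent e0 Sup.
have Fn : F [set n | s n < sup S + e].
  have [Fe|] := @in_ultra_setVsetC _ F [set n | sup S + e <= s n] FU.
    have : sup S + e <= sup S by apply: ub_le_sup => //; have [] := Sup.
    lra.
  by apply: filterS => n /= /negP; rewrite -ltNge.
apply: filterS (filterI Fc Fn) => n [/= cn nS].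
by rewrite ler_norml; apply/andP; split; lra.
Qed.

(** * Perron's method with right-hand side - W, and the limit *)

Section Perron.
Context {R : realType} {N : nat}.
Implicit Types (x y z h p : 'rV[R]_N) (X : 'M[R]_N) (u v w f : 'rV[R]_N -> R).
Implicit Types (a c d e t mu A : R) (q : 'rV[R]_N).
Context {r b : R} {Y Om : set 'rV[R]_N} {o : 'rV[R]_N} {H : 'rV[R]_N -> 'rV[R]_N -> R}.
Hypotheses (N0 : (0 < N)%N) (r0 : 0 < r) (Y0 : Y !=set0).
Hypotheses (Yo : forall y, Y y -> enorm (o - y) <= r) (Oo : open Om).
Hypotheses (OW : forall x, Om x <-> ball_gauge r Y x < 0) (Omo : Om o).
Hypotheses (b0 : 0 <= b) (br : b * r < 1).
Hypotheses (Hb : forall x p, Om x -> `|H x p| <= b * enorm p).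
Hypotheses (HZ : forall x t p, Om x -> 0 <= t -> H x (t *: p) = t * H x p).
Hypotheses (Hc : forall x p e, Om x -> 0 < e -> exists2 d : R, 0 < d &
  forall y q, enorm (y - x) < d -> Om y -> enorm (q - p) < d ->
    `|H y q - H x p| <= e).
Local Notation W := (ball_gauge r Y).
Local Notation lamin := (@smallest_eigenvalue R N).
Local Notation be := (1 - b * r).

Let Hle x p : Om x -> H x p <= b * enorm p.
Proof. by move=> Ox; apply: le_trans (ler_norm _) (Hb p Ox). Qed.

Let HNle x p : Om x -> - H x p <= b * enorm p.
Proof. by move=> Ox; apply: le_trans (Hb p Ox); rewrite -normrN ler_norm. Qed.

Let Wlb x : - r ^+ 2 <= W x. Proof. exact: gauge_lb r0 Y0 Yo x. Qed.

Let Wlt0 x : Om x -> W x < 0. Proof. by move/OW. Qed.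

Let WleO c : 0 < c -> [set x | W x <= - c] `<=` Om.
Proof. by move=> c0 x /= Wx; apply/OW; rewrite (le_lt_trans Wx) // oppr_lt0. Qed.

Let Wlip x z : Om x -> W x - W z <= 2 * r * enorm (x - z).
Proof. by move=> /Wlt0/ltW; exact: gauge_lip r0 Y0 Yo x z. Qed.

Definition lip_const : R := 4 * r + 2 * r ^+ 2 / (4 * (b + 1))^-1.

Lemma bsub_lip u A : usc_on Om u -> bsub Om b u -> 0 < A ->
  (forall x, Om x -> A * W x <= u x <= 0) ->
  forall x z, Om x -> Om z -> `|u x - u z| <= A * lip_const * enorm (x - z).
Proof.
move=> uU uS A0 uW.
have b4 : 0 < 4 * (b + 1) by rewrite mulr_gt0 // ltr_wpDl.
have d0 : 0 < (4 * (b + 1))^-1 by rewrite invr_gt0.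
have db : (4 * (b + 1))^-1 * (4 * (b + 1)) <= 1 by rewrite mulVf // gt_eqF.
have L x z := @gauge_lipschitz R N Om b u b0 uU uS r Y o A _ r0 Y0 Yo OW A0 d0 db uW x z.
move=> x z Ox Oz; rewrite ler_norml; apply/andP; split; last exact: L.
by rewrite lerNl opprB enormB; exact: L.
Qed.

Definition perron_class mu A v := [/\ usc_on Om v,
  jet_sub Om lamin H mu (fun x => - W x) v &
  forall x, Om x -> A * W x <= v x <= 0].

Lemma perron_class_bsub mu A v : 0 <= mu -> perron_class mu A v -> bsub Om b v.
Proof.
move=> mu0 [_ vS vW]; apply: jet_sub_bsub vS => // x Ox.
  by rewrite oppr_ge0 ltW // Wlt0.
by have /andP[] := vW x Ox.
Qed.

(** Where A W exceeds v one has W > - be / mu; the margin 2 A be then pays for mu A W >= - A be and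
    leaves A be >= r^2 >= - W. *)
Lemma perron_class_max mu A v : 0 < mu -> 0 < A -> r ^+ 2 <= A * be ->
  usc_on Om v -> jet_sub Om lamin H mu (fun x => - W x) v ->
  (forall x, Om x -> v x <= 0) ->
  (forall x, W x <= - (be / mu) -> A * W x <= v x) ->
  perron_class mu A (fun x => Num.max (v x) (A * W x)).
Proof.
move=> mu0 A0 Abe vU vS v0 vW; split.
- apply: usc_maxr => //; apply: uscZ => //.
  by apply: (@usc_lip _ _ _ _ (2 * r)) => x y Ox _; exact: Wlip.
- move=> x p X Ox Xs xj; have [vAW|vAW] := leP (A * W x) (v x).
    apply: (vS x p X Ox Xs).
    apply: (superjet_le (ltr01 : 0 < 1 :> R) _ _ xj); first exact: max_l.
    by move=> y _ _; rewrite le_max lexx.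
  have Aj : superjet Om (fun x => A * W x) x p X.
    apply: (superjet_le (ltr01 : 0 < 1 :> R) _ _ xj); first exact/max_r/ltW.
    by move=> y _ _; rewrite le_max lexx orbT.
  have := gauge_jet_sub r0 Y0 Yo Oo OW N0 A0 b0 HNle Ox Xs Aj.
  have : - (be / mu) < W x by rewrite ltNge; apply: contraTN vAW => /vW; rewrite leNgt.
  have muA : 0 < mu * A by rewrite mulr_gt0.
  rewrite -(ltr_pM2l muA) mulrN mulrACA.
  have -> : mu * be * (A * mu^-1) = A * be by field; rewrite gt_eqF.
  have := Wlb x; lra.
- move=> x Ox; rewrite le_max lexx orbT ge_max v0 //=.
  by rewrite pmulr_rle0 // ltW // Wlt0.
Qed.

(** With Hopf's constant c, k (mu' - mu) c = 1 gives - k (mu' - mu) w >= - W, so k w is a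
    subsolution for mu. It need not lie above a multiple of W near the boundary, hence the maximum
    with A W; A is large enough that A W <= k w on the compact set W <= - be / mu. *)
Lemma perron_nonempty mu mu' w : 0 < mu -> mu < mu' -> usc_on Om w ->
  (forall x, Om x -> w x < 0) -> jet_sub Om lamin H mu' (fun=> 0) w ->
  exists A v, 0 < A /\ perron_class mu A v.
Proof.
move=> mu0 mumu wU w0 wS.
have be0 : 0 < be by rewrite subr_gt0.
have wb : bsub Om b w.
  apply: jet_sub_bsub wS => //; last by move=> x /w0/ltW.
  by rewrite ltW // (lt_trans mu0).
have [c c0 cP] := hopf r0 Y0 Yo OW Omo b0 wU wb w0.
have d0 : 0 < be / mu by rewrite divr_gt0.
have [M M0 MP] := compact_lower_bound b0 wU wb Oo (fun y Oy => ltW (w0 y Oy))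
  (@compact_gauge R N r Y o r0 Y0 Yo (- (be / mu))) (WleO d0).
pose k := ((mu' - mu) * c)^-1.
have k0 : 0 < k by rewrite invr_gt0 mulr_gt0 // subr_gt0.
have kc : k * ((mu' - mu) * c) = 1 by rewrite mulVf // gt_eqF // mulr_gt0 // subr_gt0.
pose A := Num.max (k * M / (be / mu)) (r ^+ 2 / be).
have A0 : 0 < A by rewrite lt_max (divr_gt0 (exprn_gt0 2 r0) be0) orbT.
exists A, (fun x => Num.max (k * w x) (A * W x)); split => //.
apply: perron_class_max => //.
- by rewrite -ler_pdivrMr // le_max lexx orbT.
- exact: uscZ.
- have := jet_subZ (fun a X apos Xs => smallest_eigenvalueZ N0 apos Xs) HZ k0 wS.
  move=> kwS x p X Ox Xs /(kwS x p X Ox Xs); rewrite mulr0 => H1.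
  have := cP x Ox; have mm : 0 <= k * (mu' - mu) by rewrite mulr_ge0 ?subr_ge0 // ltW.
  move=> /(ler_wpM2l mm).
  have -> : k * (mu' - mu) * (c * W x) = W x by rewrite -[RHS]mul1r -kc; ring.
  lra.
- by move=> x Ox; rewrite pmulr_rle0 // ltW // w0.
- move=> x Wx; apply: le_trans (ler_wpM2l (ltW A0) Wx) _.
  apply: le_trans (ler_wpM2l (ltW k0) (MP x Wx)); rewrite !mulrN lerN2.
  by rewrite -ler_pdivrMr // le_max lexx.
Qed.

(** The supremum inherits the common Lipschitz constant. At a given point one almost optimal
    competitor serves as the approximation in [jet_stability]; a bump at a failure of the
    supersolution test would contradict maximality. *)
Lemma perron_solution mu A v0 : 0 < mu -> 0 < A -> perron_class mu A v0 ->
  exists u, [/\ perron_class mu A u, jet_super Om H mu (fun x => - W x) u,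
    forall x, Om x -> u x < 0 &
    forall v, perron_class mu A v -> forall x, Om x -> v x <= u x].
Proof.
move=> mu0 A0 v0P; pose S x := [set v x | v in perron_class mu A].
pose u x := sup (S x).
have Sub x : Om x -> has_sup (S x).
  move=> Ox; split; first by exists (v0 x), v0.
  by exists 0 => _ [v [_ _ vW] <-]; have /andP[] := vW x Ox.
have umax v : perron_class mu A v -> forall x, Om x -> v x <= u x.
  by move=> vP x Ox; apply: ub_le_sup; [have [] := Sub x Ox|exists v].
have ule x c : Om x -> (forall v, perron_class mu A v -> v x <= c) -> u x <= c.
  move=> Ox cP; apply: ge_sup; first by have [] := Sub x Ox.
  by move=> _ [v vP <-]; exact: cP.
have uW x : Om x -> A * W x <= u x <= 0.
  move=> Ox; apply/andP; split.
    by apply: le_trans (umax v0 v0P x Ox); have [_ _ /(_ x Ox)/andP[]] := v0P.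
  by apply: ule => // v [_ _ /(_ x Ox)/andP[]].
have ulip x z : Om x -> Om z -> u x - u z <= A * lip_const * enorm (x - z).
  move=> Ox Oz; rewrite lerBlDr; apply: ule => // v vP.
  have [vU _ vW] := vP.
  have := bsub_lip vU (perron_class_bsub (ltW mu0) vP) A0 vW Ox Oz.
  by rewrite ler_norml => /andP[_ ?]; have := umax v vP z Oz; lra.
have uU : usc_on Om u by apply: usc_lip ulip.
have Wlip' x y : Om x -> Om y -> `|W x - W y| <= 2 * r * enorm (x - y).
  move=> Ox Oy; rewrite ler_norml lerNl opprB (Wlip _ Ox) andbT.
  by rewrite enormB Wlip.
have uS : jet_sub Om lamin H mu (fun x => - W x) u.
  move=> x p X Ox Xs uj.
  apply: (@jet_stability R N Om lamin H mu (fun x => - W x) u x p X) => //.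
  - by move=> Z a; exact: smallest_eigenvalueD.
  - move=> e e0; have [d d0 dP] := Hc p Ox e0; exists d => // y q yd Oy qd.
    by have := dP y q yd Oy qd; rewrite ler_norml => /andP[_ ?]; lra.
  - move=> e e0; exists (e / (2 * r)); first by rewrite divr_gt0 // mulr_gt0.
    move=> y; rewrite ltr_pdivlMr ?mulr_gt0 // => yd Oy.
    by have := Wlip x Oy; lra.
  - move=> e e0; have [_ [v vP <-] vx] := sup_adherent e0 (Sub x Ox).
    have [vU vS vW] := vP; exists v, mu, (fun x => - W x); split => //.
    + by rewrite subrr normr0 ltW.
    + exact: ltW.
    + by move=> y Oy; have := umax v vP y Oy; split; lra.
(* At a zero of u the paraboloid 0 touches from above, and the equation would give - W x <= 0.
   Strict negativity leaves room for the bump. *)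
have u0 x : Om x -> u x < 0.
  move=> Ox; have /andP[_ ux0] := uW x Ox.
  rewrite lt_neqAle ux0 andbT; apply/eqP => ux.
  have X0 : (0 : 'M[R]_N)^T = 0 by rewrite trmx0.
  have uj : superjet Om u x 0 0.
    exists 1 => // h _ Oh; rewrite ux dotv0l /bil mulmx0 dotv0l mulr0 !addr0.
    by have /andP[] := uW _ Oh.
  have := uS x 0 0 Ox X0 uj; have := Wlt0 Ox.
  have -> : H x 0 = 0 by have := HZ 0 Ox (lexx 0); rewrite scale0r mul0r.
  have : lamin 0 <= 0.
    have := (smallest_eigenvalueP N0 X0).2 (delta_mx ord0 (Ordinal N0)).
    by rewrite dotv_delta mxE !eqxx mulr1 /bil mulmx0 dotv0l.
  rewrite ux mulr0; lra.
exists u; split => //.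
move=> x p X Ox Xs uj; rewrite leNgt; apply/negP => Hlt.
have nX : (- X)^T = - X by rewrite linearN /= Xs.
have [|||||w [wU wS wx wu]] := @jet_bump R N Om H mu (fun x => - W x) u x (- p) (- X)
   N0 Oo (ltW mu0) _ _ uU uS Ox nX _ (u0 x Ox).
- by move=> e e0; exact: Hc.
- move=> e e0; exists (e / (2 * r)); first by rewrite divr_gt0 // mulr_gt0.
  move=> y; rewrite ltr_pdivlMr ?mulr_gt0 // => yd Oy.
  by have := Wlip y Ox; rewrite (enormB x); lra.
- by rewrite !opprK.
- lra.
- by move=> y /uW/andP[].
have wP : perron_class mu A w.
  split => // y Oy; have /andP[h1 h2] := wu y Oy; rewrite h2 andbT.
  by apply: le_trans h1; have /andP[] := uW y Oy.
by have := umax w wP x Ox; rewrite leNgt wx.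
Qed.

Lemma approximate_eigenfunction mu1 e :
  0 < mu1 -> 0 < e ->
  (forall mu, mu < mu1 -> exists mu' w, [/\ mu < mu', usc_on Om w,
     forall x, Om x -> w x < 0 & jet_sub Om lamin H mu' (fun=> 0) w]) ->
  (forall mu w, usc_on Om w -> (forall x, Om x -> w x < 0) ->
     jet_sub Om lamin H mu (fun=> 0) w -> mu <= mu1) ->
  exists mu tau v, [/\ 0 <= mu /\ `|mu - mu1| <= e, 0 <= tau <= e,
    usc_on Om v /\ jet_sub Om lamin H mu (fun x => tau * - W x) v,
    jet_super Om H mu (fun x => tau * - W x) v &
    (forall x, Om x -> mu1 / be * W x <= v x <= 0) /\
    exists2 x, Om x & v x <= - 2^-1].
Proof.
move=> mu10 e0 mulow muup; have be0 : 0 < be by rewrite subr_gt0.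
have r20 : 0 < r ^+ 2 by rewrite exprn_gt0.
(* The bound mu1 / 2 keeps mu positive, be / (2 r^2) rules out the first entry of A' below, and the
   last one makes s^-1 <= e. *)
pose ep := Num.min (Num.min (e / 2) (mu1 / 2))
  (Num.min (be / (2 * r ^+ 2)) (e * be / (2 * mu1))).
have ep0 : 0 < ep.
  by rewrite !lt_min !divr_gt0 ?mulr_gt0.
have epe : ep <= e / 2 by rewrite /ep !ge_min lexx.
have epm : ep <= mu1 / 2 by rewrite /ep !ge_min lexx orbT.
have epb : ep * (2 * r ^+ 2) <= be.
  by rewrite -ler_pdivlMr ?mulr_gt0 // /ep !ge_min lexx !orbT.
have epeb : ep * (2 * mu1) <= e * be.
  by rewrite -ler_pdivlMr ?mulr_gt0 // /ep !ge_min lexx !orbT.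
pose mu := mu1 - ep.
have mu0 : 0 < mu by rewrite /mu; lra.
have [|mu' [w [mumu wU w0 wS]]] := mulow mu; first by rewrite /mu; lra.
have [A [v0 [A0 v0P]]] := perron_nonempty mu0 mumu wU w0 wS.
have [u [uP uSup u0 umax]] := perron_solution mu0 A0 v0P.
have [uU uS uW] := uP.
pose S := [set - u x | x in Om]; pose s := sup S.
have Ssup : has_sup S.
  split; first by exists (- u o), o.
  exists (A * r ^+ 2) => _ [x Ox <-]; have /andP[h _] := uW x Ox.
  by have := ler_wpM2l (ltW A0) (Wlb x); lra.
have us x : Om x -> - s <= u x.
  by move=> Ox; rewrite lerNl; apply: ub_le_sup; [have [] := Ssup|exists x].
have s0 : 0 < s by have := us o Omo; have := u0 o Omo; lra.
(* The first entry pays for the right-hand side - W <= r^2; the second makes A' W <= - s <= u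
   wherever W <= - be / mu. *)
pose A' := Num.max (r ^+ 2 / be) (s * mu / be).
have A'0 : 0 < A' by rewrite lt_max divr_gt0.
have uA' x : Om x -> A' * W x <= u x.
  move=> Ox; have mP : perron_class mu A' (fun x => Num.max (u x) (A' * W x)).
    apply: perron_class_max => //.
    - by rewrite -ler_pdivrMr // le_max lexx.
    - by move=> y /u0/ltW.
    - move=> y Wy; have Oy : Om y by apply: (WleO _ Wy); rewrite divr_gt0.
      apply: le_trans (us y Oy); move: Wy; rewrite -(ler_pM2l A'0) => /le_trans; apply.
      rewrite mulrN lerN2 -ler_pdivrMr ?divr_gt0 //.
      have -> : s / (be / mu) = s * mu / be by field; rewrite !gt_eqF.
      by rewrite le_max lexx orbT.
  have [mU mS mW] := mP.
  have /umax /(_ x Ox) : perron_class mu A (fun x => Num.max (u x) (A' * W x)).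
    split => // y Oy; have /andP[_ ->] := mW y Oy; rewrite andbT le_max.
    by have /andP[->] := uW y Oy.
  by rewrite ge_max => /andP[].
(* A' W <= u gives - W >= - u / A', so u is a subsolution for mu + 1 / A', which cannot exceed mu1 =
   mu + ep. *)
have A'ep : 1 <= A' * ep.
  have : mu + A'^-1 <= mu1.
    apply: (muup _ u uU u0) => x p X Ox Xs uj.
    have := uS x p X Ox Xs uj.
    have h : W x <= A'^-1 * u x by rewrite ler_pdivlMl // uA'.
    have -> : (mu + A'^-1) * u x = mu * u x + A'^-1 * u x by ring.
    lra.
  by rewrite /mu => h; rewrite -ler_pdivrMl // mulr1; lra.
(* The other entry would give A' ep <= 1/2. After division by s the lower barrier is mu / be times
   W, and mu / be <= mu1 / be is independent of e. *)
have A'E : A' = s * mu / be.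
  apply/max_r; rewrite leNgt; apply/negP => lt.
  have A'r : A' = r ^+ 2 / be by apply/max_l/ltW.
  have : r ^+ 2 / be * ep <= 2^-1.
    by rewrite mulrAC ler_pdivrMr //; lra.
  by rewrite -A'r; lra.
have smu : be <= s * mu * ep.
  by move: A'ep; rewrite A'E mulrAC ler_pdivlMr // mul1r.
have si0 : 0 < s^-1 by rewrite invr_gt0.
have sie : s^-1 <= e.
  rewrite -[s^-1]mul1r ler_pdivrMr //.
  have h1 : be * (2 * mu1) <= s * mu * ep * (2 * mu1) by rewrite ler_wpM2r //; lra.
  have h2 : s * mu * (ep * (2 * mu1)) <= s * mu * (e * be).
    by rewrite ler_wpM2l // mulr_ge0 // ltW.
  have h3 : s * mu * (e * be) <= s * mu1 * (e * be).
    by rewrite ler_wpM2r ?mulr_ge0 ?(ltW e0) ?(ltW be0) // ler_wpM2l ?(ltW s0) // /mu; lra.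
  have h4 : 0 < be * mu1 by rewrite mulr_gt0.
  rewrite -(ler_pM2l h4); lra.
exists mu, s^-1, (fun x => s^-1 * u x); split.
- split; first exact: ltW.
  by rewrite /mu addrAC subrr sub0r normrN ger0_norm ?(ltW ep0) //; lra.
- by rewrite (ltW si0).
- split; first exact: uscZ.
  exact: jet_subZ (fun a X apos Xs => smallest_eigenvalueZ N0 apos Xs) HZ si0 uS.
- have : jet_sub Om (fun X => - lamin (- X)) (fun x p => - H x (- p)) mu
      (fun x => s^-1 * - - W x) (fun x => s^-1 * - u x).
    apply: jet_subZ si0 uSup.
      by move=> a X a0 Xs; rewrite -scalerN smallest_eigenvalueZ ?mulrN // linearN /= Xs.
    by move=> x a p Ox a0; rewrite -scalerN HZ // mulrN.
  move=> H1 x p X Ox Xs xj; have := H1 x p X Ox Xs; rewrite !mulrN.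
  apply; have [d d0 dP] := xj; exists d => // h hd Oh; have := dP h hd Oh.
  by rewrite !mulrN.
- split=> [x Ox|].
    have /andP[_ ux] := uW x Ox; rewrite pmulr_rle0 // ux andbT.
    have := uA' x Ox; rewrite A'E -(ler_pM2l si0); apply: le_trans.
    have -> : s^-1 * (s * mu / be * W x) = mu / be * W x.
      by field; rewrite !gt_eqF.
    rewrite ler_wnM2r ?(ltW (Wlt0 Ox)) // ler_wpM2r ?invr_ge0 ?(ltW be0) // /mu; lra.
  have s20 : 0 < s / 2 by rewrite divr_gt0.
  have [_ [x Ox <-] xs] := sup_adherent s20 Ssup; exists x => //.
  move: xs; rewrite -/s => xs; rewrite /= mulrC ler_pdivrMr //; lra.
Qed.

Lemma jet_solution_limit A mu1 : 0 < A ->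
  (forall e, 0 < e -> exists mu tau v, [/\ 0 <= mu /\ `|mu - mu1| <= e, 0 <= tau <= e,
    usc_on Om v /\ jet_sub Om lamin H mu (fun x => tau * - W x) v,
    jet_super Om H mu (fun x => tau * - W x) v &
    (forall x, Om x -> A * W x <= v x <= 0) /\
    exists2 x, Om x & v x <= - 2^-1]) ->
  exists psi, [/\ forall x, ~ Om x -> psi x = 0,
    forall x, Om x -> A * W x <= psi x <= 0,
    forall x z, Om x -> Om z -> `|psi x - psi z| <= A * lip_const * enorm (x - z),
    jet_sub Om lamin H mu1 (fun=> 0) psi /\ jet_super Om H mu1 (fun=> 0) psi &
    exists2 x, Om x & psi x < 0].
Proof.
move=> A0 app; set L := A * _.
have Wneg x : Om x -> W x < 0 by move/OW.
have Wge x : - r ^+ 2 <= W x by exact: gauge_lb r0 Y0 Yo x.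
have r20 : 0 < r ^+ 2 by rewrite exprn_gt0.
have /choice[F FP] : forall n : nat, exists t : R * R * ('rV[R]_N -> R),
    [/\ 0 <= t.1.1 /\ `|t.1.1 - mu1| <= n.+1%:R^-1, 0 <= t.1.2 <= n.+1%:R^-1,
    usc_on Om t.2 /\ jet_sub Om lamin H t.1.1 (fun x => t.1.2 * - W x) t.2,
    jet_super Om H t.1.1 (fun x => t.1.2 * - W x) t.2 &
    (forall x, Om x -> A * W x <= t.2 x <= 0) /\ exists2 x, Om x & t.2 x <= - 2^-1].
  move=> n; have [|mu [tau [v vP]]] := app n.+1%:R^-1; first by rewrite invr_gt0.
  by exists (mu, tau, v).
pose mu n := (F n).1.1; pose tau n := (F n).1.2; pose v n := (F n).2.
have vlip n x z : Om x -> Om z -> `|v n x - v n z| <= L * enorm (x - z).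
  have [[m0 _] /andP[t0 _] [vU vS] _ [vW _]] := FP n.
  apply: (bsub_lip vU _ A0 vW).
  apply: jet_sub_bsub vS => //.
  - by move=> x' Ox; rewrite mulr_ge0 // oppr_ge0 ltW // Wneg.
  - by move=> x' Ox; have /andP[] := vW x' Ox.
have [G [GU Gev]] := @ultraFilterLemma _ (@nbhs _ (set_system nat) \oo) _.
have GF := @ultra_proper _ G GU.
have vb x : Om x -> forall n, - (A * r ^+ 2) <= v n x <= 0.
  move=> Ox n; have [_ _ _ _ [vW _]] := FP n; have /andP[h1 ->] := vW x Ox.
  by rewrite andbT; apply: le_trans h1; rewrite -mulrN ler_wpM2l // ltW.
(* The value 0 outside Om encodes the boundary condition. *)
have /choice[psi psiP] : forall x, exists l : R,
    (~ Om x -> l = 0) /\ (Om x -> forall e, 0 < e -> G [set n | `|v n x - l| <= e]).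
  move=> x; have [Ox|nOx] := pselect (Om x); last by exists 0; split.
  by have [l lP] := bounded_ultra_limit GU (vb x Ox); exists l; split.
have psi_lim x e : Om x -> 0 < e -> G [set n | `|v n x - psi x| <= e].
  by move=> Ox; have [_ /(_ Ox e)] := psiP x.
have psiW x : Om x -> A * W x <= psi x <= 0.
  move=> Ox; apply/andP; split; apply/ler_addgt0Pr => e e0.
    have [n] := filter_ex (psi_lim x e Ox e0); rewrite /= ler_norml => /andP[_ h].
    by have [_ _ _ _ [/(_ x Ox)/andP[h1 _] _]] := FP n; rewrite -/(v n) in h1; lra.
  have [n] := filter_ex (psi_lim x e Ox e0); rewrite /= ler_norml => /andP[h _].
  by have [_ _ _ _ [/(_ x Ox)/andP[_ h1] _]] := FP n; rewrite -/(v n) in h1; lra.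
have psi_lip x z : Om x -> Om z -> `|psi x - psi z| <= L * enorm (x - z).
  move=> Ox Oz; apply/ler_addgt0Pr => e e0; have e2 : 0 < e / 2 by rewrite divr_gt0.
  have [n [/= h1 h2]] := filter_ex (filterI (psi_lim x _ Ox e2) (psi_lim z _ Oz e2)).
  have := vlip n x z Ox Oz; move: h1 h2; rewrite !ler_norml.
  by move=> /andP[? ?] /andP[? ?] /andP[? ?]; apply/andP; split; lra.
have L0 : 0 < `|L| + 1 by rewrite ltr_wpDl.
(* Cover the compact set W <= 0: near interior points use the common Lipschitz constant, near points
   with W = 0 the squeeze between A W and 0, valid for every n. *)
have unif e : 0 < e -> G [set n | forall x, Om x -> `|v n x - psi x| <= e].
  move=> e0; have := @compact_gauge R N r Y o r0 Y0 Yo 0.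
  move=> /compact_near_coveringP /(_ _ G (fun n x => Om x -> `|v n x - psi x| <= e) _) cov.
  have : \near G, [set x | W x <= 0] `<=` (fun x => Om x -> `|v G x - psi x| <= e).
    apply: cov => x /= Wx0; have [Ox|nOx] := pselect (Om x).
      have e3 : 0 < e / 3 by rewrite divr_gt0.
      exists ([set y | enorm (y - x) < e / 3 / (`|L| + 1)],
        [set n | `|v n x - psi x| <= e / 3]).
        split; last exact: psi_lim.
        by apply/nbhs_enormP; exists (e / 3 / (`|L| + 1)) => //; rewrite divr_gt0.
      move=> [y n] /= [yx vn] Oy; move: yx; rewrite ltr_pdivlMr // => yx.
      have h1 := vlip n y x Oy Ox; have h2 := psi_lip y x Oy Ox.
      have : L * enorm (y - x) <= e / 3.
        by have := ler_norm L; have := enorm_ge0 (y - x); nra.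
      move: vn h1 h2; rewrite !ler_norml.
      by move=> /andP[? ?] /andP[? ?] /andP[? ?] ?; apply/andP; split; lra.
    have WA : 0 < e / A by rewrite divr_gt0.
    have := @continuous_gauge R N r Y o r0 Y0 Yo x => /cts_enormP /(_ _ WA) [d d0 dP].
    have Wx : W x = 0.
      apply/eqP; rewrite eq_le Wx0 /= leNgt; apply/negP => /OW; exact: nOx.
    exists ([set y | enorm (y - x) < d], setT).
      by split; [apply/nbhs_enormP; exists d|exact: filterT].
    move=> [y n] /= [yx _] Oy; have := dP y yx.
    rewrite Wx subr0 ltr_norml => /andP[h _].
    have : - e < A * W y by rewrite mulrC -ltr_pdivrMr // mulNr.
    have [_ _ _ _ [/(_ y Oy)/andP[h1 h2] _]] := FP n; rewrite -/(v n) in h1 h2.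
    have /andP[h3 h4] := psiW y Oy => h5.
    by rewrite ler_norml; apply/andP; split; lra.
  apply: filterS => n /= H1 x Ox; apply: H1 => //.
  by rewrite /= ltW // Wneg.
have pick e : 0 < e -> exists n, [/\ forall x, Om x -> `|v n x - psi x| <= e & n.+1%:R^-1 <= e].
  move=> e0; have ev : G [set n : nat | n.+1%:R^-1 <= e].
    apply: Gev; have [k _ kP] := near_infty_natSinv_lt (PosNum e0).
    by exists k => // n /= kn; apply/ltW; exact: kP.
  by have [n [h1 h2]] := filter_ex (filterI (unif e e0) ev); exists n.
exists psi; split => //.
- by move=> x nOx; have [/(_ nOx)] := psiP x.
- split.
    move=> x p X Ox Xs uj.
    apply: (@jet_stability R N Om lamin H mu1 (fun=> 0) psi x p X) => //.
    + by move=> Z a; exact: smallest_eigenvalueD.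
    + move=> e e0; have [d d0 dP] := Hc p Ox e0; exists d => // y q yd Oy qd.
      by have := dP y q yd Oy qd; rewrite ler_norml => /andP[_ ?]; lra.
    + by move=> e e0; exists 1 => // y _ _; rewrite sub0r oppr_le0 ltW.
    + move=> e e0; have [n [nU ne]] := pick e e0.
      have [[m0 m1] /andP[t0 t1] [vU vS] _ _] := FP n.
      exists (v n), (mu n), (fun x => tau n * - W x); split => //.
      * exact: le_trans m1 ne.
      * by have := nU x Ox; rewrite ler_norml => /andP[? ?]; lra.
      * move=> y Oy; have := nU y Oy; rewrite ler_norml => /andP[_ ?].
        have : 0 <= tau n * - W y by rewrite mulr_ge0 // oppr_ge0 ltW // Wneg.
        by split; lra.
  move=> x p X Ox Xs uj.
  apply: (@jet_stability R N Om (fun X => - lamin (- X)) (fun x p => - H x (- p))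
    mu1 (fun x => - (fun=> 0) x) (fun x => - psi x) x p X) => //.
  + move=> Z a Zs; have nZs : (- Z)^T = - Z by rewrite linearN /= Zs.
    have -> : - (Z + a%:M) = - Z + (- a)%:M by rewrite opprD raddfN.
    by rewrite smallest_eigenvalueD //; ring.
  + move=> e e0; have [d d0 dP] := Hc (- p) Ox e0; exists d => // y q yd Oy qd.
    have := dP y (- q) yd Oy; rewrite -opprD enormN => /(_ qd).
    by rewrite ler_norml => /andP[? _]; lra.
  + by move=> e e0; exists 1 => // y _ _; rewrite oppr0 sub0r oppr_le0 ltW.
  (* For the reflected equation the right-hand side is tau W, with the wrong sign; tau r^2 <= e
     makes it at least - e. *)
  + move=> e e0; have [|n [nU ne]] := pick (Num.min e (e / r ^+ 2)).
      by rewrite lt_min e0 divr_gt0.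
    have [[m0 m1] /andP[t0 t1] _ vS _] := FP n.
    have ne1 : n.+1%:R^-1 <= e by apply: (le_trans ne); rewrite ge_min lexx.
    have ne2 : n.+1%:R^-1 <= e / r ^+ 2 by apply: (le_trans ne); rewrite ge_min lexx orbT.
    have nUe y : Om y -> `|v n y - psi y| <= e.
      by move=> /nU /le_trans; apply; rewrite ge_min lexx.
    exists (fun x => - v n x), (mu n), (fun x => - (tau n * - W x)); split => //.
    * apply: (@usc_lip _ _ _ _ L) => y z Oy Oz; have := vlip n z y Oz Oy.
      by rewrite (enormB z y) ler_norml => /andP[_ ?]; lra.
    * exact: le_trans m1 ne1.
    * by have := nUe x Ox; rewrite ler_norml => /andP[? ?]; lra.
    * move=> y Oy; have := nUe y Oy; rewrite ler_norml => /andP[? _].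
      split; last by lra.
      rewrite oppr0 sub0r lerN2.
      have : tau n <= e / r ^+ 2 by exact: le_trans t1 ne2.
      rewrite ler_pdivlMr //; apply: le_trans; rewrite ler_wpM2l //.
      by rewrite lerNl.
(* Uniform convergence keeps the point where v <= - 1/2 from being lost at the boundary: there psi
   <= - 1/4. *)
have e4 : 0 < (4^-1 : R) by rewrite invr_gt0.
have [n [nU _]] := pick _ e4.
have [_ _ _ _ [_ [x Ox vx]]] := FP n; exists x => //.
by have := nU x Ox; rewrite ler_norml => /andP[? _]; rewrite -/(v n) in vx; lra.
Qed.

(* By Harnack's inequality the set where u < 0 is relatively closed. *)
Lemma strong_maximum_principle u : connected Om -> usc_on Om u -> bsub Om b u ->
  (forall x, Om x -> u x <= 0) -> (exists2 x, Om x & u x < 0) ->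
  forall x, Om x -> u x < 0.
Proof.
move=> Oc uU uS u0 [x0 Ox0 ux0].
pose B := [set x | Om x /\ u x < 0].
have b4 : 0 < 4 * (b + 1) by rewrite mulr_gt0 // ltr_wpDl.
suff BO : B = Om by move=> x; rewrite -BO => -[].
apply: Oc; first by exists x0.
- exists B; last by apply/seteqP; split => x; [case=> ? ?|case].
  rewrite openE => x [Ox ux].
  have /near_within_enormP[d d0 dP] := uU x 0 Ox ux.
  have [d' d'0 d'P] := open_enormP Oo Ox.
  apply/nbhs_enormP; exists (Num.min d d'); first by rewrite lt_min d0.
  move=> y; rewrite lt_min => /andP[yd yd']; have Oy := d'P y yd'.
  by split => //; exact: dP.
- exists (closure B); first exact: closed_closure.
  apply/seteqP; split => x; first by move=> [Ox ux]; split => //; exact: subset_closure.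
  move=> [Ox Bx]; split => //; have [d1 d10 d1P] := open_enormP Oo Ox.
  pose d := Num.min (d1 / 2) (4 * (b + 1))^-1.
  have d0 : 0 < d by rewrite lt_min divr_gt0 // invr_gt0.
  have db : d * (4 * (b + 1)) <= 1 by rewrite -ler_pdivlMr // mul1r ge_min lexx orbT.
  have dd1 : d <= d1 / 2 by rewrite ge_min lexx.
  have nx : nbhs x [set y | enorm (y - x) < d / 2].
    by apply/nbhs_enormP; exists (d / 2) => //; rewrite divr_gt0.
  have [z [[Oz uz] /= zx]] := Bx _ nx.
  suff : 3 * u x <= u z by lra.
  apply: (harnack b0 uU uS u0 d0 db); last by rewrite enormB ltW.
  move=> y yz; apply: d1P; have := enorm_triangle z y x; lra.
Qed.

End Perron.

(** * The theorem *)

(** Excludes an empty set of centres, whose intersection of balls would be the whole space. *)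
Lemma setT_not_bounded (R : realType) (N : nat) : (0 < N)%N ->
  ~ bounded_set [set: 'rV[R]_N].
Proof.
move=> N0 [M [_ MP]]; pose i := Ordinal N0.
have M1 : M < `|M| + 1 by have := ler_norm M; lra.
have := MP _ M1 ((`|M| + 2) *: delta_mx ord0 i) I.
have := coord_le_norm ((`|M| + 2) *: delta_mx ord0 i : 'rV[R]_N) i.
rewrite !mxE !eqxx mulr1 ger0_norm; last by have := normr_ge0 M; lra.
by move=> /le_trans h /h; lra.
Qed.

(** An infinite supremum is excluded since its product with r > 0 would not be below 1; homogeneity
    extends the bound from the unit ball to all p. *)
Lemma first_order_boundP (R : realType) (N : nat) (r : R) (Om : set 'rV[R]_N)
    (H : 'rV[R]_N -> 'rV[R]_N -> R) o : 0 < r -> Om o ->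
  (forall x t xi, Om x -> 0 <= t -> H x (t *: xi) = t * H x xi) ->
  (first_order_bound Om H * r%:E < 1)%E ->
  exists b, [/\ 0 <= b, b * r < 1 &
    forall x p, Om x -> `|H x p| <= b * enorm p].
Proof.
move=> r0 Oo HZ Hr; pose B := first_order_bound Om H.
have Bub x p : Om x -> enorm p < 1 -> (`|H x p|%:E <= B)%E.
  move=> Ox p1; apply: ereal_sup_ubound; exists (x, p) => //=; split => //=.
  by rewrite /eball /= subr0.
have B0 : (0 <= B)%E.
  apply: (@le_trans _ _ (`|H o 0|%:E)); first by rewrite lee_fin.
  by apply: Bub => //; rewrite enorm0.
have [b bE] : exists b, B = b%:E.
  move: B0 Hr; rewrite -/B; move: (B) => [b' _ _||//]; first by exists b'.
  by rewrite gt0_mulye ?lte_fin.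
have b0 : 0 <= b by rewrite -lee_fin -bE.
exists b; split => //; first by rewrite -lte_fin EFinM -bE.
move=> x p Ox; have Hb q : enorm q < 1 -> `|H x q| <= b.
  by move=> q1; rewrite -lee_fin -bE; exact: Bub.
(* The unit ball is open, so p is divided by slightly more than its norm; the excess costs b e / (b
   + 1) <= e. *)
apply/ler_addgt0Pr => e e0; pose s := enorm p + e / (b + 1).
have b1 : 0 < b + 1 by lra.
have eb : 0 < e / (b + 1) by rewrite divr_gt0.
have s0 : 0 < s by rewrite /s; have := enorm_ge0 p; lra.
have -> : p = s *: (s^-1 *: p) by rewrite scalerA mulfV ?scale1r // gt_eqF.
rewrite HZ ?(ltW s0) // normrM (gtr0_norm s0) scalerA mulfV ?gt_eqF // scale1r.
have : s * `|H x (s^-1 *: p)| <= s * b.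
  rewrite ler_wpM2l ?(ltW s0) // Hb // enormZ gtr0_norm ?invr_gt0 //.
  by rewrite ltr_pdivrMl // mulr1 /s; lra.
move/le_trans; apply; rewrite /s mulrDl mulrC lerD2l.
by rewrite mulrAC ler_pdivrMr // ler_wpM2l ?ltW // ltrDl.
Qed.

Lemma within_continuous2_enorm (R : realType) (N : nat) (Om : set 'rV[R]_N)
    (H : 'rV[R]_N -> 'rV[R]_N -> R) x p e : open Om ->
  {within Om `*` [set: 'rV[R]_N],
     continuous (fun z : 'rV[R]_N * 'rV[R]_N => H z.1 z.2)} ->
  Om x -> 0 < e -> exists2 d : R, 0 < d &
    forall y q, enorm (y - x) < d -> Om y -> enorm (q - p) < d ->
      `|H y q - H x p| <= e.
Proof.
move=> Oo Hc Ox e0.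
have OO : open (Om `*` [set: 'rV[R]_N]).
  rewrite openE => -[y q] [/= Oy _]; exists (Om, setT); last by move=> [].
  by split; [exact: open_nbhs_nbhs|exact: filterT].
move: Hc; rewrite continuous_open_subspace // => /(_ (x, p)).
rewrite inE => /(_ (conj Ox I)).
move/(@cvgrPdist_lt _ _ _ (nbhs (x, p))) => /(_ e e0).
case=> -[/= A B] [/nbhs_enormP [d1 d10 d1P] /nbhs_enormP [d2 d20 d2P]] AB.
exists (Num.min d1 d2); first by rewrite lt_min d10.
move=> y q; rewrite !lt_min => /andP[y1 _] _ /andP[_ q2].
have := AB (y, q) (conj (d1P y y1) (d2P q q2)).
by rewrite /= distrC => /ltW.
Qed.

Theorem theorem5p3 (R : realType) (N : nat) (r : R) (Om : set 'rV[R]_N)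
    (H : 'rV[R]_N -> 'rV[R]_N -> R) (omega : R -> R)
    (N_ge2 : (2 <= N)%N) (r_gt0 : 0 < r) (Om_class : class_C r Om)
    (H_cont : {within Om `*` [set: 'rV[R]_N],
                 continuous (fun z : 'rV[R]_N * 'rV[R]_N => H z.1 z.2)})
    (H_hom : forall x t xi, Om x -> 0 <= t -> H x (t *: xi) = t * H x xi)
    (omega_mod : modulus_of_continuity omega)
    (H_mod : forall x y xi, Om x -> Om y ->
       `|H x xi - H y xi| <= omega (enorm (x - y) * (1 + enorm xi)))
    (b_small : (first_order_bound Om H * r%:E < 1)%E) :
  mu1_minus Om H \is a fin_num /\
  exists psi : 'rV[R]_N -> R,
    [/\ [lipschitz psi x | x in closure Om],
        forall x, Om x -> psi x < 0,
        viscosity_solution Om (eigen_equation H (fine (mu1_minus Om H))) psi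
      & forall x, (closure Om `\` Om°) x -> psi x = 0].
Proof.
have N0 : (0 < N)%N by rewrite (leq_trans _ N_ge2).
have [[Oo Om0 Oc Ob] [Y OmE]] := Om_class; case: Om0 => o Omo.
have Y0 : Y !=set0.
  have [//|Y0] := pselect (Y !=set0).
  exfalso; apply: (setT_not_bounded (R := R) N0); move: Ob; rewrite OmE.
  suff -> : \bigcap_(y in Y) eball y r = [set: 'rV[R]_N] by [].
  by apply/seteqP; split => // x _ y Yy; exfalso; apply: Y0; exists y.
have OW x : Om x <-> ball_gauge r Y x < 0 by exact: (@bigcap_eball_gauge R N r Y Om o x).
have Yo y : Y y -> enorm (o - y) <= r.
  by move=> Yy; move: Omo; rewrite OmE => /(_ y Yy) /ltW.
have [b [b0 br Hb]] := first_order_boundP r_gt0 Omo H_hom b_small.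
have Hle x p : Om x -> H x p <= b * enorm p.
  by move=> Ox; apply: le_trans (ler_norm _) (Hb x p Ox).
have HNle x p : Om x -> - H x p <= b * enorm p.
  by move=> Ox; apply: le_trans (Hb x p Ox); rewrite -normrN ler_norm.
have Hc x p e (Ox : Om x) (e0 : 0 < e) := within_continuous2_enorm p Oo H_cont Ox e0.
pose W := ball_gauge r Y.
have Wlt0 x : Om x -> W x < 0 by move/OW.
have Wlip x z : W x <= 0 -> W x - W z <= 2 * r * enorm (x - z).
  by move=> Wx; exact: gauge_lip r_gt0 Y0 Yo x z Wx.
have be0 : 0 < 1 - b * r by rewrite subr_gt0.
pose E := [set mu : R | exists w : 'rV[R]_N -> R,
    (forall x, Om x -> w x < 0) /\ viscosity_subsolution Om (eigen_equation H mu) w].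
have mu1E : mu1_minus Om H = ereal_sup [set mu%:E | mu in E] by [].
have Ejet mu w : usc_on Om w -> (forall x, Om x -> w x < 0) ->
    jet_sub Om (@smallest_eigenvalue R N) H mu (fun=> 0) w -> E mu.
  by move=> wU w0 wS; exists w; split => //; exact: jet_viscosity_sub.
(* W itself is a negative subsolution for m0, its margin 2 (1 - b r) paying for m0 W >= - m0 r^2;
   hence the eigenvalue is positive. *)
pose m0 := 2 * (1 - b * r) / r ^+ 2.
have m00 : 0 < m0 by rewrite divr_gt0 ?mulr_gt0 // exprn_gt0.
have Em0 : E m0.
  apply: (Ejet m0 W) => //.
    by apply: (@usc_lip _ _ _ _ (2 * r)) => x z /Wlt0/ltW Wx _; exact: Wlip.
  move=> x p X Ox Xs xj.
  have xj1 : superjet Om (fun y => 1 * W y) x p X.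
    by have -> : (fun y => 1 * W y) = W by apply/funext => y; rewrite mul1r.
  have := gauge_jet_sub r_gt0 Y0 Yo Oo OW N0 ltr01 b0 HNle Ox Xs xj1.
  have := ler_wpM2l (ltW m00) (gauge_lb r_gt0 Y0 Yo x).
  have -> : m0 * - r ^+ 2 = - (2 * (1 - b * r)) by rewrite /m0; field; rewrite gt_eqF.
  rewrite -/W; lra.
have [C CP] := jet_sub_eigenvalue_bound N0 Oo Omo b0.
(* The maximum with 0 covers negative mu, for which the Harnack bound is not stated. *)
have EC mu : E mu -> mu <= Num.max 0 C.
  move=> [w [w0 wS]]; rewrite le_max; have [//|mu0] := leP mu 0.
  by apply/orP; right; apply: (CP H mu w Hle (ltW mu0) wS.1 w0); exact: viscosity_sub_jet.
have fin : mu1_minus Om H \is a fin_num.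
  rewrite mu1E fin_numE; apply/andP; split.
    have : (m0%:E <= ereal_sup [set mu%:E | mu in E])%E.
      by apply: ereal_sup_ubound; exists m0.
    by case: ereal_sup.
  have : (ereal_sup [set mu%:E | mu in E] <= (Num.max 0 C)%:E)%E.
    by apply: ge_ereal_sup => _ [mu /EC muC <-]; rewrite lee_fin.
  by case: ereal_sup.
split=> //; pose m := fine (mu1_minus Om H); rewrite -/m.
have mE : ereal_sup [set mu%:E | mu in E] = m%:E by rewrite /m fineK // -mu1E.
have Em mu : E mu -> mu <= m.
  by move=> Emu; rewrite -lee_fin -mE; apply: ereal_sup_ubound; exists mu.
have m_gt0 : 0 < m by exact: lt_le_trans (Em _ Em0).
have mlow mu : mu < m -> exists mu' (w : 'rV[R]_N -> R), [/\ mu < mu', usc_on Om w,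
     forall x, Om x -> w x < 0 & jet_sub Om (@smallest_eigenvalue R N) H mu' (fun=> 0) w].
  rewrite -lte_fin -mE => /ereal_sup_gt [_ [mu' [w [w0 wS]] <-]]; rewrite lte_fin => mumu.
  by exists mu', w; split => //; [exact: wS.1|exact: viscosity_sub_jet].
have A0 : 0 < m / (1 - b * r) by rewrite divr_gt0.
have app e (e0 : 0 < e) := approximate_eigenfunction N0 r_gt0 Y0 Yo Oo OW Omo b0 br Hb
  H_hom Hc m_gt0 e0 mlow (fun mu w wU w0 wS => Em mu (Ejet mu w wU w0 wS)).
have [psi [psi0 psiW psiL [psiS psiT] psi_neg]] :=
  jet_solution_limit N0 r_gt0 Y0 Yo Oo OW b0 Hb Hc A0 app.
set A := m / _ in A0 psiW psiL; set L := A * _ in psiL.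
have psiU : usc_on Om psi.
  by apply: (@usc_lip _ _ _ _ L) => x z Ox Oz; have := psiL x z Ox Oz;
    rewrite ler_norml => /andP[].
have psib : bsub Om b psi.
  apply: jet_sub_bsub psiS => //; first exact: ltW.
  by move=> x /psiW/andP[].
have psi_le0 x : Om x -> psi x <= 0 by move=> /psiW/andP[].
have psi_lt0 := strong_maximum_principle Oo b0 Oc psiU psib psi_le0 psi_neg.
have clW x : closure Om x -> W x <= 0.
  move=> Ox; rewrite leNgt; apply/negP => Wx.
  have := @continuous_gauge R N r Y o r_gt0 Y0 Yo x => /cts_enormP /(_ _ Wx) [d d0 dP].
  have nx : nbhs x [set y | enorm (y - x) < d] by apply/nbhs_enormP; exists d.
  have [y [/Wlt0 Wy /= yd]] := Ox _ nx.
  by have := dP y yd; rewrite ltr_norml -/W => /andP[? _]; lra.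
have W_out x : closure Om x -> ~ Om x -> W x = 0.
  move=> /clW Wx nOx; apply/eqP; rewrite eq_le Wx /= leNgt; apply/negP.
  by move=> /OW.
(* L serves for two points of Om. Towards a boundary point y, |psi x| <= A |W x| and W y = 0, so the
   Lipschitz constant 2 r of W takes over. *)
pose K := Num.max `|L| (A * (2 * r)).
have K0 : 0 <= K by rewrite le_max normr_ge0.
have KL : L <= K by rewrite le_max ler_norm.
have psiK x y : closure Om x -> closure Om y -> Om x ->
    `|psi x - psi y| <= K * enorm (x - y).
  move=> cx cy Ox; have [Oy|nOy] := pselect (Om y).
    by apply: le_trans (psiL x y Ox Oy) _; rewrite ler_wpM2r ?enorm_ge0.
  rewrite (psi0 y nOy) subr0; have /andP[h1 h2] := psiW x Ox.
  have h3 := Wlip y x (clW y cy); rewrite (W_out y cy nOy) sub0r in h3.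
  apply: (@le_trans _ _ (A * (2 * r) * enorm (x - y))); last first.
    by rewrite ler_wpM2r ?enorm_ge0 // le_max lexx orbT.
  rewrite ler0_norm //; have := ler_wpM2l (ltW A0) h3; rewrite (enormB y x) -/W in h1 *.
  lra.
exists psi; split => //.
(* The factor N converts the Euclidean norm to the sup norm of [lipschitz]. *)
- exists (K * N%:R); split; first exact: num_real.
  move=> M KM [x y] [/= cx cy].
  have KN : K * enorm (x - y) <= M * `|x - y|.
    apply: (@le_trans _ _ (K * (N%:R * `|x - y|))).
      by rewrite ler_wpM2l // enorm_le_norm.
    by rewrite mulrA ler_wpM2r // ltW.
  apply: le_trans KN; have [Ox|nOx] := pselect (Om x); first exact: psiK.
  have [Oy|nOy] := pselect (Om y); first by rewrite distrC enormB; exact: psiK.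
  by rewrite !psi0 // subrr normr0 mulr_ge0 ?enorm_ge0.
- split.
  + rewrite continuous_open_subspace // => x; rewrite inE => Ox.
    apply/cts_enormP => e e0; have [d d0 dP] := open_enormP Oo Ox.
    have K1 : 0 < K + 1 by lra.
    exists (Num.min d (e / (K + 1))); first by rewrite lt_min d0 divr_gt0.
    move=> y; rewrite lt_min ltr_pdivlMr // => /andP[yd ye].
    have Oy := dP y yd; have cl z : Om z -> closure Om z by exact: subset_closure.
    apply: le_lt_trans (psiK y x (cl y Oy) (cl x Ox) Oy) _.
    by have := enorm_ge0 (y - x); lra.
  + exact: jet_viscosity_sub.
  + apply: jet_viscosity_super => //; apply: usc_opp_lsc.
    apply: (@usc_lip _ _ _ _ L) => x z Ox Oz; have := psiL x z Ox Oz.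
    by rewrite ler_norml => /andP[? _]; lra.
- move=> x [cx]; rewrite (interior_id _).1 //; exact: psi0.
Qed.
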